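(* Let $\alpha>0$ and let $A$ be a finite subset of $\mathbb Z^2$ with $0\in A$. Then $$\lim_{n\to\infty}\mathbb P\big[\Upsilon_nA\subset U^{(n)}_{t_\alpha}\ \big|\ 0\in U^{(n)}_{t_\alpha}\big]=\exp(-\pi\alpha\,\mathrm{cap}(A)).$$
   Context: Let $(S_k)$ be simple random walk on $\mathbb Z^2$, $P_x$ its law from $x$, $\tau_1(A)=\inf\{k\ge1:S_k\in A\}$. The potential kernel is $a(x)=\sum_{k\ge0}(P_0[S_k=0]-P_x[S_k=0])$. For finite nonempty $A$, $\mathrm{hm}_A(x)=\lim_{\|y\|\to\infty}P_y[S_{\tau_1(A)}=x]$, and for finite $A\ni0$, $\mathrm{cap}(A)=\sum_{x\in A}a(x)\mathrm{hm}_A(x)$. Let $\mathbb Z^2_n=\mathbb Z^2/n\mathbb Z^2$ be the discrete torus and $\Upsilon_n:\mathbb Z^2\to\mathbb Z^2_n$ the projection modulo $n$. Let $(X_k)_{k\ge0}$ be simple random walk on $\mathbb Z^2_n$ with $X_0$ uniformly distributed, $T_n(x)=\inf\{t\ge0:X_t=x\}$, and $U^{(n)}_t=\{x\in\mathbb Z^2_n:T_n(x)>t\}$ the uncovered set at time $t$. Set $t_\alpha=\frac{4\alpha}{\pi}n^2\ln^2n$. *)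

(* Defs.v *)
From Stdlib Require Import Reals ZArith List ClassicalEpsilon.
Import ListNotations.
Open Scope R_scope.

Definition pt := (Z * Z)%type.

Definition pt_eqb (x y : pt) : bool :=
  Z.eqb (fst x) (fst y) && Z.eqb (snd x) (snd y).

Definition nbrs (x : pt) : list pt :=
  [((fst x + 1)%Z, snd x); ((fst x - 1)%Z, snd x);
   (fst x, (snd x + 1)%Z); (fst x, (snd x - 1)%Z)].

Definition sumR (l : list R) : R := fold_right Rplus 0 l.

Definition series_value (u : nat -> R) : R :=
  epsilon (inhabits 0) (fun l => infinite_sum u l).

Definition norm_pt (y : pt) : R :=
  sqrt (IZR (fst y) ^ 2 + IZR (snd y) ^ 2).

Definition lim_at_infinity (f : pt -> R) (l : R) : Prop :=
  forall eps, eps > 0 -> exists M, forall y, norm_pt y > M -> Rabs (f y - l) < eps.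

Definition limit_at_infinity (f : pt -> R) : R :=
  epsilon (inhabits 0) (fun l => lim_at_infinity f l).

(* Transition probabilities of SRW on Z^2: srw_p k x y = P_x[S_k = y]. *)
Fixpoint srw_p (k : nat) (x y : pt) : R :=
  match k with
  | O => if pt_eqb x y then 1 else 0
  | S k' => / 4 * sumR (map (fun z => srw_p k' z y) (nbrs x))
  end.

Definition pot_kernel (x : pt) : R :=
  series_value (fun k => srw_p k (0%Z, 0%Z) (0%Z, 0%Z) - srw_p k x (0%Z, 0%Z)).

Definition memb (A : list pt) (x : pt) : bool := existsb (pt_eqb x) A.

(* first_hit A k y x = P_y[tau_1(A) = k, S_k = x]  (tau_1(A) = inf{k>=1 : S_k in A}). *)
Fixpoint first_hit (A : list pt) (k : nat) (y x : pt) : R :=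
  match k with
  | O => 0
  | S k' => / 4 * sumR (map (fun z =>
              if memb A z then
                (match k' with O => if pt_eqb z x then 1 else 0 | S _ => 0 end)
              else first_hit A k' z x) (nbrs y))
  end.

Definition hit_dist (A : list pt) (y x : pt) : R :=
  series_value (fun k => first_hit A k y x).

Definition harm_meas (A : list pt) (x : pt) : R :=
  limit_at_infinity (fun y => hit_dist A y x).

(* cap(A) = sum_{x in A} a(x) hm_A(x)  (A given as a duplicate-free list). *)
Definition cap (A : list pt) : R :=
  sumR (map (fun x => pot_kernel x * harm_meas A x) A).

(* Discrete torus Z^2_n: points represented by pairs in {0..n-1}^2. *)
Definition proj (n : Z) (x : pt) : pt := (Z.modulo (fst x) n, Z.modulo (snd x) n).

Definition tnbrs (n : Z) (x : pt) : list pt := map (proj n) (nbrs x).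

(* avoid n B m x = P[X_k not in B for all 0 <= k <= m | X_0 = x], SRW on Z^2_n. *)
Fixpoint avoid (n : Z) (B : pt -> bool) (m : nat) (x : pt) : R :=
  if B x then 0 else
  match m with
  | O => 1
  | S m' => / 4 * sumR (map (avoid n B m') (tnbrs n x))
  end.

Definition torus_points (n : nat) : list pt :=
  flat_map (fun i => map (fun j => (Z.of_nat i, Z.of_nat j)) (seq 0 n)) (seq 0 n).

Definition avoid_unif (n : nat) (B : pt -> bool) (m : nat) : R :=
  / (INR n * INR n) * sumR (map (avoid (Z.of_nat n) B m) (torus_points n)).

Definition t_alpha (alpha : R) (n : nat) : R :=
  4 * alpha / PI * INR n ^ 2 * (ln (INR n)) ^ 2.

Definition proj_set (n : nat) (A : list pt) (x : pt) : bool :=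
  existsb (fun a => pt_eqb (proj (Z.of_nat n) a) x) A.

(* P[ Upsilon_n A subset U_t , 0 in U_t ] / P[0 in U_t], where x in U_t iff
   T_n(x) > t iff x not visited at integer times k <= floor t. *)
Definition cond_prob (n : nat) (A : list pt) (t : R) : R :=
  let m := Z.to_nat (Int_part t) in
  avoid_unif n (fun x => orb (proj_set n A x) (pt_eqb x (0%Z, 0%Z))) m
  / avoid_unif n (fun x => pt_eqb x (0%Z, 0%Z)) m.

(* Main.v *)
Require Import Defs.
From Stdlib Require Import Reals ZArith List ClassicalEpsilon Lra Lia Psatz.
Import ListNotations.
Open Scope R_scope.

(** Let [B] be the projection of [A] on the torus, [h] the mean hitting time of [B] as a
    function of the starting point, and [M] its average.  Pairing [(I - P) h] with the torus Green
    function gives [M = M_0 - n^2 c_n], where [M_0 ~ (2/pi) n^2 ln n] is the mean hitting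
    time of a point from a uniform start and [c_n -> cap A]: integrate the equilibrium
    measure of the torus against the equilibrium potential of the plane.  On the other
    hand, the survival probability [u_m] of the walk killed on [B] satisfies
    [ln u_m = - m / M + o(1)] for [m] of order [n^2 (ln n)^2].  Indeed the tails
    [W_m = sum_(k >= m) u_k] obey [W_(m+1) = W_m - u_m], and [W_m - M u_m] is the
    covariance of [h] with the survival function of the killed walk; the variance of [h]
    is [O(n^4)], and by Poincare and the log-convexity of [u_(2j)] that of the survival
    function is [O(u_m^2 / ln n)] after a time [M / 8].  The difference of the exponents
    for [A] and [{0}] is [m n^2 c_n / (M M_0) -> pi alpha cap A].

    All kernel estimates come from finite Fourier sums on the torus: the heat kernels of
    torus and plane agree up to time of order [n], so that the tail of the series of
    [a] is controlled by the return probability, uniformly in [n]. *)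

(** The exponent [m / M] grows like [2 alpha ln n], while the answer sits in a bounded difference of
    two such exponents. Two features of the proof come from this. The main term [gsum] of the mean
    hitting time is literally the same sum for [A] and for [{0}], so it cancels exactly and is
    needed only to leading order. And the tail recursion must be accurate to [o(1 / ln n)] per unit
    of [m / M]. Put [k = n^2 / M], of order [1 / ln n]. Bounding the variance of the survival
    function by a multiple of [u_m^2] alone would leave an error of order [k] per unit, which adds
    up to a constant; Poincare improves it to [k^(3/2)], which adds up to [O((ln n)^(-1/2))]. This
    gain presupposes that [u] loses only a fraction [O(1 / M)] per step: a lower bound on [u] at
    early times yields it once, and log-convexity carries it to all later times, so that no spectral
    theory of the killed walk is used. *)

Lemma Rabs_le_inv x a : Rabs x <= a -> - a <= x <= a.
Proof.
  intros H. pose proof (Rle_abs x). pose proof (Rle_abs (- x)).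
  rewrite Rabs_Ropp in *. lra.
Qed.

(** * Finite sums *)

Fixpoint bsum (n : nat) (f : nat -> R) : R :=
  match n with O => 0 | S k => bsum k f + f k end.

Lemma bsum_ext n f g : (forall i, (i < n)%nat -> f i = g i) -> bsum n f = bsum n g.
Proof.
  induction n as [|n IH]; intros H; simpl; auto.
  rewrite IH, H; auto.
Qed.

Lemma bsum_plus n f g : bsum n (fun i => f i + g i) = bsum n f + bsum n g.
Proof. induction n; simpl; lra. Qed.

Lemma bsum_minus n f g : bsum n (fun i => f i - g i) = bsum n f - bsum n g.
Proof. induction n; simpl; lra. Qed.

Lemma bsum_scal n c f : bsum n (fun i => c * f i) = c * bsum n f.
Proof. induction n; simpl; lra. Qed.

Lemma bsum_const n c : bsum n (fun _ => c) = INR n * c.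
Proof. induction n; [simpl; lra|]. rewrite S_INR; simpl; lra. Qed.

Lemma bsum_zero n f : (forall i, (i < n)%nat -> f i = 0) -> bsum n f = 0.
Proof.
  intros H; rewrite (bsum_ext n f (fun _ => 0)) by auto.
  rewrite bsum_const; lra.
Qed.

Lemma bsum_le n f g : (forall i, (i < n)%nat -> f i <= g i) -> bsum n f <= bsum n g.
Proof.
  induction n as [|n IH]; intros H; simpl; [lra|].
  apply Rplus_le_compat; auto.
Qed.

Lemma bsum_nonneg n f : (forall i, (i < n)%nat -> 0 <= f i) -> 0 <= bsum n f.
Proof.
  intros H. replace 0 with (bsum n (fun _ => 0)) by (rewrite bsum_const; lra).
  now apply bsum_le.
Qed.

Lemma bsum_abs n f : Rabs (bsum n f) <= bsum n (fun i => Rabs (f i)).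
Proof.
  induction n as [|n IH]; simpl; [rewrite Rabs_R0; lra|].
  eapply Rle_trans; [apply Rabs_triang|lra].
Qed.

Lemma bsum_swap n m (F : nat -> nat -> R) :
  bsum n (fun i => bsum m (F i)) = bsum m (fun j => bsum n (fun i => F i j)).
Proof.
  induction n as [|n IH]; simpl.
  - symmetry; apply bsum_zero; auto.
  - rewrite IH, <- bsum_plus. reflexivity.
Qed.

Lemma bsum_S_l n f : bsum (S n) f = f 0%nat + bsum n (fun i => f (S i)).
Proof. induction n as [|n IH]; simpl in *; lra. Qed.

Lemma bsum_rev n f : bsum n f = bsum n (fun i => f (n - 1 - i)%nat).
Proof.
  induction n as [|n IH]; [reflexivity|].
  rewrite (bsum_S_l n (fun i => f (S n - 1 - i)%nat)).
  replace (S n - 1 - 0)%nat with n by lia.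
  cbn [bsum]. rewrite IH, Rplus_comm. f_equal.
  apply bsum_ext; intros; f_equal; lia.
Qed.

Lemma bsum_single n f k :
  (k < n)%nat -> (forall i, (i < n)%nat -> i <> k -> f i = 0) -> bsum n f = f k.
Proof.
  induction n as [|n IH]; intros Hk H; [lia|]; simpl.
  destruct (Nat.eq_dec k n) as [->|Hne].
  - rewrite bsum_zero; [lra|]. intros i Hi; apply H; lia.
  - rewrite IH, (H n) by (intros; try apply H; lia). lra.
Qed.

Lemma bsum_telescope n f : bsum n (fun i => f (S i) - f i) = f n - f 0%nat.
Proof. induction n; simpl; lra. Qed.

Lemma bsum_le_mono m n f :
  (m <= n)%nat -> (forall i, 0 <= f i) -> bsum m f <= bsum n f.
Proof. induction 1; intros H0; simpl; [lra|]. specialize (IHle H0). specialize (H0 m0). lra. Qed.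

(** Discriminant of a nonnegative quadratic. Allowing [c = 0] lets Cauchy-Schwarz follow without
    separating the case of a null function. *)
Lemma discriminant_le (a b c : R) :
  0 <= c -> (forall t, 0 <= a + 2 * t * b + t ^ 2 * c) -> b ^ 2 <= a * c.
Proof.
  intros Hc H. destruct (Req_dec c 0) as [->|Hc0].
  - destruct (Req_dec b 0) as [->|Hb]; [lra|].
    (* With [c = 0] the polynomial is affine in [t], and this [t] gives it the value [-1]. *)
    specialize (H (- (a + 1) / (2 * b))).
    replace (a + 2 * (- (a + 1) / (2 * b)) * b + (- (a + 1) / (2 * b)) ^ 2 * 0)
      with (-1) in H by (field; auto). lra.
  - specialize (H (- b / c)).
    replace (a + 2 * (- b / c) * b + (- b / c) ^ 2 * c)
      with ((a * c - b ^ 2) / c) in H by (field; auto).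
    assert (0 < c) by lra.
    assert (0 <= (a * c - b ^ 2) / c * c) by (apply Rmult_le_pos; lra).
    replace ((a * c - b ^ 2) / c * c) with (a * c - b ^ 2) in H1 by (field; auto). lra.
Qed.

Definition bsum2 (n : nat) (F : nat -> nat -> R) : R :=
  bsum n (fun i => bsum n (F i)).

Lemma bsum2_ext n F G :
  (forall i j, (i < n)%nat -> (j < n)%nat -> F i j = G i j) -> bsum2 n F = bsum2 n G.
Proof. intros H; apply bsum_ext; intros; apply bsum_ext; auto. Qed.

Lemma bsum2_plus n F G : bsum2 n (fun i j => F i j + G i j) = bsum2 n F + bsum2 n G.
Proof.
  unfold bsum2. rewrite <- bsum_plus. apply bsum_ext; intros; apply bsum_plus.
Qed.

Lemma bsum2_minus n F G : bsum2 n (fun i j => F i j - G i j) = bsum2 n F - bsum2 n G.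
Proof.
  unfold bsum2. rewrite <- bsum_minus. apply bsum_ext; intros; apply bsum_minus.
Qed.

Lemma bsum2_scal n c F : bsum2 n (fun i j => c * F i j) = c * bsum2 n F.
Proof.
  unfold bsum2. rewrite <- bsum_scal. apply bsum_ext; intros; apply bsum_scal.
Qed.

Lemma bsum2_const n c : bsum2 n (fun _ _ => c) = INR n ^ 2 * c.
Proof. unfold bsum2. rewrite !bsum_const. ring. Qed.

Lemma bsum2_le n F G :
  (forall i j, (i < n)%nat -> (j < n)%nat -> F i j <= G i j) -> bsum2 n F <= bsum2 n G.
Proof. intros H; apply bsum_le; intros; apply bsum_le; auto. Qed.

Lemma bsum2_nonneg n F :
  (forall i j, (i < n)%nat -> (j < n)%nat -> 0 <= F i j) -> 0 <= bsum2 n F.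
Proof. intros H; apply bsum_nonneg; intros; apply bsum_nonneg; auto. Qed.

Lemma bsum2_abs n F : Rabs (bsum2 n F) <= bsum2 n (fun i j => Rabs (F i j)).
Proof.
  eapply Rle_trans; [apply bsum_abs|]. apply bsum_le; intros; apply bsum_abs.
Qed.

Lemma bsum2_bsum n m (F : nat -> nat -> nat -> R) :
  bsum2 n (fun i j => bsum m (F i j)) = bsum m (fun k => bsum2 n (fun i j => F i j k)).
Proof.
  unfold bsum2. rewrite (bsum_swap m n). apply bsum_ext; intros; apply bsum_swap.
Qed.

Lemma bsum2_bsum2 n m (F : nat -> nat -> nat -> nat -> R) :
  bsum2 n (fun i j => bsum2 m (F i j))
  = bsum2 m (fun k l => bsum2 n (fun i j => F i j k l)).
Proof.
  unfold bsum2 at 2. rewrite bsum2_bsum. apply bsum_ext; intros.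
  apply bsum2_bsum.
Qed.

Lemma bsum2_single n F a b :
  (a < n)%nat -> (b < n)%nat ->
  (forall i j, (i < n)%nat -> (j < n)%nat -> (i, j) <> (a, b) -> F i j = 0) ->
  bsum2 n F = F a b.
Proof.
  intros Ha Hb H. unfold bsum2. rewrite (bsum_single n _ a Ha).
  - apply bsum_single; auto. intros j Hj Hne; apply H; auto. congruence.
  - intros i Hi Hne. apply bsum_zero. intros j Hj; apply H; auto. congruence.
Qed.

(** * Characters of the torus *)

Definition ang (n k : nat) (z : Z) : R := 2 * PI * INR k * IZR z / INR n.

Lemma ang_0_l n z : ang n 0 z = 0.
Proof. unfold ang, Rdiv; simpl; ring. Qed.

Lemma ang_plus n k z w : ang n k (z + w) = ang n k z + ang n k w.
Proof. unfold ang, Rdiv; rewrite plus_IZR; ring. Qed.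

Lemma ang_sub n k z w : ang n k (z - w) = ang n k z - ang n k w.
Proof. unfold ang, Rdiv; rewrite minus_IZR; ring. Qed.

Lemma ang_opp n k z : ang n k (- z) = - ang n k z.
Proof. unfold ang, Rdiv; rewrite opp_IZR; ring. Qed.

Lemma ang_S n k z : ang n (S k) z = ang n k z + ang n 1 z.
Proof. unfold ang, Rdiv; rewrite S_INR; simpl; ring. Qed.

Lemma ang_sym n k l : ang n k (Z.of_nat l) = ang n l (Z.of_nat k).
Proof. unfold ang, Rdiv. rewrite <- !INR_IZR_INZ. ring. Qed.

Lemma ang_period n k z : (0 < n)%nat -> ang n k (z + Z.of_nat n) = ang n k z + 2 * INR k * PI.
Proof.
  intros Hn. apply lt_0_INR in Hn. unfold ang.
  rewrite plus_IZR, <- INR_IZR_INZ. field. lra.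
Qed.

Lemma cos_ang_1 n z : (0 < n)%nat -> cos (ang n 1 z) = 1 -> (Z.of_nat n | z)%Z.
Proof.
  intros Hn H. apply lt_0_INR in Hn.
  assert (Hs : sin (PI * IZR z / INR n) = 0).
  { replace (ang n 1 z) with (2 * (PI * IZR z / INR n)) in H
      by (unfold ang; simpl; field; lra).
    rewrite cos_2a_sin in H. nra. }
  apply sin_eq_0_0 in Hs as [k Hk]. exists k.
  apply eq_IZR. rewrite mult_IZR, <- INR_IZR_INZ.
  pose proof PI_RGT_0.
  apply (Rmult_eq_reg_l (PI / INR n)).
  - replace (PI / INR n * IZR z) with (PI * IZR z / INR n) by (field; lra).
    rewrite Hk. field. lra.
  - apply Rgt_not_eq, Rdiv_lt_0_compat; lra.
Qed.

Lemma trig_sums_not_divide n z :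
  (0 < n)%nat -> ~ (Z.of_nat n | z)%Z ->
  bsum n (fun k => cos (ang n k z)) = 0 /\ bsum n (fun k => sin (ang n k z)) = 0.
Proof.
  intros Hn Hz. set (t := ang n 1 z).
  set (C := bsum n (fun k => cos (ang n k z))).
  set (S := bsum n (fun k => sin (ang n k z))).
  assert (Hend : cos (ang n n z) = 1 /\ sin (ang n n z) = 0).
  { replace (ang n n z) with (2 * IZR z * PI)
      by (unfold ang; field; apply not_0_INR; lia).
    split.
    - replace (2 * IZR z * PI) with (2 * (IZR z * PI)) by ring.
      rewrite cos_2a_sin, (sin_eq_0_1 (IZR z * PI)) by (now exists z). ring.
    - apply sin_eq_0_1. exists (2 * z)%Z. rewrite mult_IZR. reflexivity. }
  destruct Hend as [Hc Hs].
  (* Summing over one period is invariant under a rotation by [t]. *)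
  assert (HC : C = C * cos t - S * sin t).
  { pose proof (bsum_telescope n (fun k => cos (ang n k z))) as H.
    rewrite bsum_minus, Hc, ang_0_l, cos_0 in H. fold C in H.
    rewrite (bsum_ext n _ (fun k => cos t * cos (ang n k z) - sin t * sin (ang n k z))) in H.
    - rewrite bsum_minus, !bsum_scal in H. fold C S in H. lra.
    - intros i _. rewrite ang_S, cos_plus. fold t. ring. }
  assert (HS : S = S * cos t + C * sin t).
  { pose proof (bsum_telescope n (fun k => sin (ang n k z))) as H.
    rewrite bsum_minus, Hs, ang_0_l, sin_0 in H. fold S in H.
    rewrite (bsum_ext n _ (fun k => cos t * sin (ang n k z) + sin t * cos (ang n k z))) in H.
    - rewrite bsum_plus, !bsum_scal in H. fold C S in H. lra.
    - intros i _. rewrite ang_S, sin_plus. fold t. ring. }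
  assert (Ht : cos t <> 1) by (intros E; apply Hz; now apply cos_ang_1 in E).
  assert (HCS : C ^ 2 + S ^ 2 = 0).
  { apply (Rmult_eq_reg_l (1 - cos t)); [|lra].
    replace ((1 - cos t) * (C ^ 2 + S ^ 2)) with
      (C * (C - C * cos t) + S * (S - S * cos t)) by ring.
    replace (C - C * cos t) with (- S * sin t) by lra.
    replace (S - S * cos t) with (C * sin t) by lra. ring. }
  split; nra.
Qed.

Lemma trig_sums_divide n z :
  (0 < n)%nat -> (Z.of_nat n | z)%Z ->
  bsum n (fun k => cos (ang n k z)) = INR n /\ bsum n (fun k => sin (ang n k z)) = 0.
Proof.
  intros Hn [w ->].
  assert (H : forall k, ang n k (w * Z.of_nat n) = 2 * (IZR (Z.of_nat k * w) * PI)).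
  { intros k. unfold ang. rewrite !mult_IZR, <- !INR_IZR_INZ.
    field. apply not_0_INR; lia. }
  assert (Hs : forall k, sin (IZR (Z.of_nat k * w) * PI) = 0)
    by (intros k; apply sin_eq_0_1; eexists; reflexivity).
  split.
  - rewrite (bsum_ext n _ (fun _ => 1)), bsum_const; [ring|].
    intros k _. rewrite H, cos_2a_sin, Hs. ring.
  - apply bsum_zero. intros k _. rewrite H, sin_2a, Hs. ring.
Qed.

(** The real part of a character suffices: the coefficients in all sums below are even in the
    frequency, so the imaginary parts would cancel. *)
Definition char (n i j : nat) (x : pt) : R := cos (ang n i (fst x) + ang n j (snd x)).

Definition at_origin (n : nat) (x : pt) : bool :=
  andb (fst x mod Z.of_nat n =? 0)%Z (snd x mod Z.of_nat n =? 0)%Z.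

(** Orthogonality: the addition formula factorises the double sum into one-dimensional sums, of
    which all the sine sums vanish. *)
Lemma sum_char_frequencies n x :
  (0 < n)%nat ->
  bsum2 n (fun i j => char n i j x) = if at_origin n x then INR n ^ 2 else 0.
Proof.
  intros Hn. unfold bsum2, char.
  rewrite (bsum_ext n _ (fun i => cos (ang n i (fst x)) * bsum n (fun j => cos (ang n j (snd x)))
     - sin (ang n i (fst x)) * bsum n (fun j => sin (ang n j (snd x))))).
  2:{ intros i _. rewrite <- !bsum_scal, <- bsum_minus. apply bsum_ext.
      intros; apply cos_plus. }
  rewrite bsum_minus.
  rewrite (bsum_ext n _ (fun i => bsum n (fun j => cos (ang n j (snd x))) * cos (ang n i (fst x))))
    by (intros; ring).
  rewrite (bsum_ext n (fun i => sin _ * _)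
    (fun i => bsum n (fun j => sin (ang n j (snd x))) * sin (ang n i (fst x))))
    by (intros; ring).
  rewrite !bsum_scal. unfold at_origin.
  assert (D : forall z, (z mod Z.of_nat n =? 0)%Z = true <-> (Z.of_nat n | z)%Z).
  { intros z. rewrite Z.eqb_eq. apply Z.mod_divide. lia. }
  assert (D' : forall z, (z mod Z.of_nat n =? 0)%Z = false -> ~ (Z.of_nat n | z)%Z).
  { intros z E F. apply D in F. congruence. }
  destruct (fst x mod Z.of_nat n =? 0)%Z eqn:E1.
  - destruct (trig_sums_divide n (fst x) Hn) as [-> ->]; [now apply D|].
    destruct (snd x mod Z.of_nat n =? 0)%Z eqn:E2; simpl.
    + destruct (trig_sums_divide n (snd x) Hn) as [-> ->]; [now apply D|]. ring.
    + destruct (trig_sums_not_divide n (snd x) Hn) as [-> ->]; [now apply D'|]. ring.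
  - destruct (trig_sums_not_divide n (fst x) Hn) as [-> ->]; [now apply D'|]. simpl. ring.
Qed.

(** * The averaging operator and its eigenvalues *)

(** Written as the recursion step of [srw_p], so that [srw_p_S] holds by conversion. The same
    operator serves the torus walk, acting on periodic functions. *)
Definition Pop (f : pt -> R) (x : pt) : R := / 4 * sumR (map f (nbrs x)).

Lemma Pop_eq f x :
  Pop f x = (f ((fst x + 1)%Z, snd x) + f ((fst x - 1)%Z, snd x)
             + f (fst x, (snd x + 1)%Z) + f (fst x, (snd x - 1)%Z)) / 4.
Proof. unfold Pop, sumR; simpl. field. Qed.

Lemma Pop_ext f g x : (forall y, f y = g y) -> Pop f x = Pop g x.
Proof. intros H. rewrite !Pop_eq, !H. reflexivity. Qed.

Lemma Pop_const c x : Pop (fun _ => c) x = c.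
Proof. rewrite Pop_eq. field. Qed.

Lemma Pop_plus f g x : Pop (fun y => f y + g y) x = Pop f x + Pop g x.
Proof. rewrite !Pop_eq. field. Qed.

Lemma Pop_minus f g x : Pop (fun y => f y - g y) x = Pop f x - Pop g x.
Proof. rewrite !Pop_eq. field. Qed.

Lemma Pop_scal c f x : Pop (fun y => c * f y) x = c * Pop f x.
Proof. rewrite !Pop_eq. field. Qed.

Lemma Pop_le f g x :
  (forall y, In y (nbrs x) -> f y <= g y) -> Pop f x <= Pop g x.
Proof.
  intros H. rewrite !Pop_eq. unfold nbrs in H.
  assert (f ((fst x + 1)%Z, snd x) <= g ((fst x + 1)%Z, snd x)) by (apply H; simpl; auto).
  assert (f ((fst x - 1)%Z, snd x) <= g ((fst x - 1)%Z, snd x)) by (apply H; simpl; auto).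
  assert (f (fst x, (snd x + 1)%Z) <= g (fst x, (snd x + 1)%Z)) by (apply H; simpl; auto).
  assert (f (fst x, (snd x - 1)%Z) <= g (fst x, (snd x - 1)%Z)) by (apply H; simpl; auto).
  lra.
Qed.

Lemma Pop_ext_in f g x :
  (forall y, In y (nbrs x) -> f y = g y) -> Pop f x = Pop g x.
Proof. intros H. apply Rle_antisym; apply Pop_le; intros y Hy; rewrite H by auto; lra. Qed.

Lemma Pop_abs f x : Rabs (Pop f x) <= Pop (fun y => Rabs (f y)) x.
Proof.
  rewrite !Pop_eq. unfold Rdiv. rewrite Rabs_mult, (Rabs_pos_eq (/ 4)) by lra.
  apply Rmult_le_compat_r; [lra|].
  repeat (eapply Rle_trans; [apply Rabs_triang|]; apply Rplus_le_compat_r). lra.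
Qed.

Lemma Pop_bsum n (F : nat -> pt -> R) x :
  Pop (fun y => bsum n (fun k => F k y)) x = bsum n (fun k => Pop (F k) x).
Proof.
  induction n as [|n IH]; simpl; [apply Pop_const|].
  rewrite Pop_plus, IH. reflexivity.
Qed.

Lemma Pop_bsum2 n (F : nat -> nat -> pt -> R) x :
  Pop (fun y => bsum2 n (fun i j => F i j y)) x = bsum2 n (fun i j => Pop (F i j) x).
Proof.
  unfold bsum2. rewrite Pop_bsum. apply bsum_ext; intros. apply Pop_bsum.
Qed.

Definition psub (x y : pt) : pt := (fst x - fst y, snd x - snd y)%Z.

Lemma Pop_shift f z x : Pop (fun y => f (psub y z)) x = Pop f (psub x z).
Proof.
  rewrite !Pop_eq; unfold psub; simpl.
  replace (fst x - fst z + 1)%Z with (fst x + 1 - fst z)%Z by ring.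
  replace (fst x - fst z - 1)%Z with (fst x - 1 - fst z)%Z by ring.
  replace (snd x - snd z + 1)%Z with (snd x + 1 - snd z)%Z by ring.
  replace (snd x - snd z - 1)%Z with (snd x - 1 - snd z)%Z by ring.
  reflexivity.
Qed.

Lemma one_le_sqrt s : 1 <= sqrt (1 + s ^ 2).
Proof. rewrite <- sqrt_1 at 1. pose proof (pow2_ge_0 s). apply sqrt_le_1; lra. Qed.

(* [phi] is the eigenvalue of [Pop] at frequency [(i, j)], and [dd = 1 - phi].  As [/ 0 = 0],
   sums of [/ dd] skip the zero frequency. *)
Definition sn (n i : nat) : R := sin (PI * INR i / INR n).
Definition phi (n i j : nat) : R := (cos (ang n i 1) + cos (ang n j 1)) / 2.
Definition dd (n i j : nat) : R := 1 - phi n i j.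

Lemma ang_half n i : ang n i 1 = 2 * (PI * INR i / INR n).
Proof. unfold ang, Rdiv. ring. Qed.

Lemma dd_sn n i j : dd n i j = sn n i ^ 2 + sn n j ^ 2.
Proof.
  unfold dd, phi, sn. rewrite !ang_half, !cos_2a_sin. field.
Qed.

Lemma dd_nonneg n i j : 0 <= dd n i j.
Proof. rewrite dd_sn. nra. Qed.

Lemma inv_dd_nonneg n i j : 0 <= / dd n i j.
Proof.
  destruct (Req_dec (dd n i j) 0) as [->|H]; [rewrite Rinv_0; lra|].
  pose proof (dd_nonneg n i j). left. apply Rinv_0_lt_compat. lra.
Qed.

Lemma sn_0 n : sn n 0 = 0.
Proof. unfold sn. simpl. replace (PI * 0 / INR n) with 0 by (unfold Rdiv; ring). apply sin_0. Qed.

Lemma sn_pos n i : (0 < i < n)%nat -> 0 < sn n i.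
Proof.
  intros [H0 Hn]. apply lt_INR in Hn. apply lt_0_INR in H0. pose proof PI_RGT_0.
  apply sin_gt_0.
  - apply Rdiv_lt_0_compat; nra.
  - apply Rmult_lt_reg_r with (INR n); [lra|]. unfold Rdiv.
    rewrite Rmult_assoc, Rinv_l by lra. nra.
Qed.

Lemma sn_nonneg n i : (i < n)%nat -> 0 <= sn n i.
Proof.
  intros H. destruct i; [rewrite sn_0; lra|]. left; apply sn_pos; lia.
Qed.

Lemma dd_pos n i j : (i < n)%nat -> (j < n)%nat -> (i, j) <> (0, 0)%nat -> 0 < dd n i j.
Proof.
  intros Hi Hj H. rewrite dd_sn. destruct i as [|i].
  - destruct j as [|j]; [congruence|].
    assert (0 < sn n (S j)) by (apply sn_pos; lia). nra.
  - assert (0 < sn n (S i)) by (apply sn_pos; lia). nra.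
Qed.

Lemma dd_00 n : dd n 0 0 = 0.
Proof. rewrite dd_sn, sn_0. ring. Qed.

Lemma phi_00 n : phi n 0 0 = 1.
Proof. pose proof (dd_00 n). unfold dd in H. lra. Qed.

Lemma phi_abs_le_1 n i j : Rabs (phi n i j) <= 1.
Proof.
  unfold phi. pose proof (COS_bound (ang n i 1)). pose proof (COS_bound (ang n j 1)).
  apply Rabs_le. lra.
Qed.

Lemma Pop_char n i j x : Pop (char n i j) x = phi n i j * char n i j x.
Proof.
  rewrite Pop_eq; unfold char, phi; simpl.
  rewrite !ang_plus, !ang_sub.
  set (a := ang n i (fst x)). set (b := ang n j (snd x)).
  set (u := ang n i 1). set (v := ang n j 1).
  replace (a + u + b) with ((a + b) + u) by ring.
  replace (a - u + b) with ((a + b) - u) by ring.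
  replace (a + (b + v)) with ((a + b) + v) by ring.
  replace (a + (b - v)) with ((a + b) - v) by ring.
  generalize (a + b); intros w. rewrite !cos_plus, !cos_minus. field.
Qed.

Lemma char_origin n i j : char n i j (0, 0)%Z = 1.
Proof.
  unfold char, ang; simpl. replace (_ + _) with 0 by (unfold Rdiv; ring). apply cos_0.
Qed.

Lemma char_00 n x : char n 0 0 x = 1.
Proof. unfold char. rewrite !ang_0_l, Rplus_0_r. apply cos_0. Qed.

Lemma char_abs_le_1 n i j x : Rabs (char n i j x) <= 1.
Proof. apply Rabs_le, COS_bound. Qed.

Lemma char_opp n i j x : char n i j (- fst x, - snd x)%Z = char n i j x.
Proof.
  unfold char; simpl. rewrite !ang_opp.
  rewrite <- cos_neg. f_equal. ring.
Qed.

(** * Sums of the inverse symbol *)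

(** Real part of the finite geometric series with ratio [z = r e^(it)], multiplied by
    [|1 - z|^2]. *)
Lemma geometric_cos_sum r t m :
  (1 - 2 * r * cos t + r ^ 2) * bsum m (fun k => r ^ k * cos (INR k * t))
  = 1 - r * cos t - r ^ m * cos (INR m * t) + r ^ S m * cos (INR m * t - t).
Proof.
  induction m as [|m IH].
  - simpl. replace (0 * t - t) with (- t) by ring. rewrite cos_neg, Rmult_0_l, cos_0. ring.
  - change (bsum (S m) ?f) with (bsum m f + f m). rewrite Rmult_plus_distr_l, IH, S_INR.
    replace ((INR m + 1) * t - t) with (INR m * t) by ring.
    replace ((INR m + 1) * t) with (INR m * t + t) by ring.
    rewrite cos_plus, cos_minus. simpl. ring.
Qed.

(* The Poisson kernel of the circle, averaged over the [n]-th roots of unity. *)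
Lemma poisson_kernel_sum n r :
  (0 < n)%nat -> 0 < r < 1 ->
  bsum n (fun j => / ((1 + r ^ 2) / (2 * r) - cos (ang n j 1)))
  = INR n * (2 * r / (1 - r ^ 2)) * ((1 + r ^ n) / (1 - r ^ n)).
Proof.
  intros Hn Hr.
  assert (Hrn : 0 < r ^ n < 1).
  { split; [apply pow_lt; lra|]. apply pow_lt_1_compat; [lra|lia]. }
  (* The Poisson series [2 sum_(k >= 0) r^k cos(kt) - 1], folded modulo [n]: as [t] is a multiple of
     [2 PI / n], the full series is the sum over [k < n] divided by [1 - r^n]. *)
  assert (Hk : forall j, / ((1 + r ^ 2) / (2 * r) - cos (ang n j 1))
     = 2 * r / (1 - r ^ 2) * (2 / (1 - r ^ n) * bsum n (fun k => r ^ k * cos (ang n j (Z.of_nat k))) - 1)).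
  { intros j. set (t := ang n j 1).
    assert (Hden : 0 < 1 - 2 * r * cos t + r ^ 2).
    { pose proof (COS_bound t). nra. }
    pose proof (geometric_cos_sum r t n) as HG.
    assert (Ht : forall k, INR k * t = ang n j (Z.of_nat k)).
    { intros k. unfold t, ang. rewrite <- INR_IZR_INZ. simpl. unfold Rdiv; ring. }
    rewrite (bsum_ext n (fun k => r ^ k * cos (INR k * t))
       (fun k => r ^ k * cos (ang n j (Z.of_nat k)))) in HG by (intros; rewrite Ht; auto).
    set (Sg := bsum n _) in *.
    assert (Hnt : INR n * t = 0 + 2 * INR j * PI).
    { rewrite Ht. unfold ang. rewrite <- INR_IZR_INZ. field. apply not_0_INR; lia. }
    rewrite Hnt in HG.
    replace (0 + 2 * INR j * PI - t) with (- t + 2 * INR j * PI) in HG by ring.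
    rewrite !cos_period, cos_0, cos_neg in HG.
    assert (HS : Sg = (1 - r ^ n) * (1 - r * cos t) / (1 - 2 * r * cos t + r ^ 2)).
    { apply (Rmult_eq_reg_l (1 - 2 * r * cos t + r ^ 2)); [|lra].
      rewrite HG. change (r ^ S n) with (r * r ^ n). field. lra. }
    rewrite HS. field. repeat split; nra. }
  rewrite (bsum_ext n _ _ (fun j _ => Hk j)), bsum_scal, bsum_minus, bsum_scal, bsum_const.
  rewrite bsum_swap, (bsum_single n _ 0); auto.
  - rewrite (bsum_ext n _ (fun _ => 1)).
    + rewrite bsum_const. field. repeat split; nra.
    + intros i _. simpl. unfold ang. simpl.
      replace (2 * PI * INR i * 0 / INR n) with 0 by (unfold Rdiv; ring). rewrite cos_0. ring.
  - intros k Hk1 Hk2. rewrite bsum_scal.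
    destruct (trig_sums_not_divide n (Z.of_nat k) Hn) as [-> _]; [|ring].
    intros [w Hw]. assert (w = 0 \/ w >= 1 \/ w <= -1)%Z by lia. nia.
Qed.

(** Since [2 dd = c - cos] with [c = 1 + 2 s^2], this is the Poisson sum at the [r] with
    [(r + 1/r) / 2 = c]. That root is [1 / rho], where [rho = c + sigma] and
    [sigma = sqrt(c^2 - 1)]. *)
Lemma row_sum n i :
  (0 < i < n)%nat ->
  let s := sn n i in
  let sigma := 2 * s * sqrt (1 + s ^ 2) in
  let rho := 1 + 2 * s ^ 2 + sigma in
  bsum n (fun j => / dd n i j) = 2 * INR n / sigma * (1 + 2 / (rho ^ n - 1)).
Proof.
  intros Hi s sigma rho.
  assert (Hs : 0 < s) by (apply sn_pos; auto).
  assert (Hq : 1 <= sqrt (1 + s ^ 2)) by apply one_le_sqrt.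
  assert (Hq2 : sqrt (1 + s ^ 2) ^ 2 = 1 + s ^ 2) by (apply pow2_sqrt; nra).
  assert (Hsig : 0 < sigma) by (unfold sigma; nra).
  assert (Hsig2 : sigma ^ 2 = (1 + 2 * s ^ 2) ^ 2 - 1).
  { unfold sigma. rewrite !Rpow_mult_distr, Hq2. ring. }
  assert (Hrho : 1 < rho) by (unfold rho; nra).
  set (c := 1 + 2 * s ^ 2) in *.
  assert (Hinv : / rho = c - sigma).
  { apply (Rmult_eq_reg_l rho); [|lra]. rewrite Rinv_r by lra. unfold rho. nra. }
  assert (Hr : 0 < / rho < 1).
  { split; [apply Rinv_0_lt_compat; lra|].
    rewrite <- Rinv_1. apply Rinv_lt_contravar; lra. }
  pose proof (poisson_kernel_sum n (/ rho) ltac:(lia) Hr) as HP.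
  assert (E1 : (1 + (/ rho) ^ 2) / (2 * / rho) = c).
  { rewrite Hinv. assert (c - sigma <> 0) by lra.
    apply (Rmult_eq_reg_r (2 * (c - sigma))); [|lra].
    unfold Rdiv. rewrite Rmult_assoc, Rinv_l by lra. nra. }
  assert (E2 : 2 * / rho / (1 - (/ rho) ^ 2) = / sigma).
  { assert (1 - (/ rho) ^ 2 = 2 * / rho * sigma) by (rewrite Hinv; nra).
    rewrite H. field. lra. }
  rewrite E1, E2 in HP.
  assert (Hpn : 1 < rho ^ n) by (apply Rlt_pow_R1; [auto|lia]).
  rewrite pow_inv in HP.
  transitivity (2 * bsum n (fun j => / (c - cos (ang n j 1)))).
  - rewrite <- bsum_scal. apply bsum_ext. intros j _.
    assert (Hd : dd n i j = (c - cos (ang n j 1)) / 2).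
    { rewrite dd_sn. fold s. rewrite ang_half, cos_2a_sin. unfold sn, c. field. }
    rewrite Hd. unfold Rdiv. rewrite Rinv_mult, Rinv_inv. ring.
  - rewrite HP. field. repeat split; lra.
Qed.

(* Comparable to [/ min(i, n - i)], but additive, hence easy to sum over [i]. *)
Definition imin (n i : nat) : R := / INR i + / INR (n - i).

(** The second bound follows from the first because [t <= PI / 2 <= 2] gives [t^2 / 6 <= 2 / 3]. *)
Lemma sin_ge_third t : 0 <= t <= PI / 2 -> t - t ^ 3 / 6 <= sin t /\ t / 3 <= sin t.
Proof.
  intros Ht. pose proof PI_4.
  assert (H1 : t - t ^ 3 / 6 <= sin t).
  { destruct (sin_bound t 0) as [Hl _]; try lra.
    unfold sin_approx, sin_term in Hl. simpl in Hl. lra. }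
  split; auto. assert (0 <= t * (4 - t ^ 2)) by (apply Rmult_le_pos; nra). nra.
Qed.

Lemma sn_sym n i : (i <= n)%nat -> (0 < n)%nat -> sn n (n - i) = sn n i.
Proof.
  intros Hi Hn. unfold sn. rewrite minus_INR by auto.
  replace (PI * (INR n - INR i) / INR n) with (PI - PI * INR i / INR n)
    by (field; apply not_0_INR; lia).
  apply sin_PI_x.
Qed.

(** The reflection [i -> n - i] reduces statements about [sn] and [imin] to the half where the angle
    is at most [PI / 2]. *)
Lemma half_cases (n : nat) (Q : nat -> Prop) :
  (forall i, (0 < i < n)%nat -> Q (n - i)%nat -> Q i) ->
  (forall i, (0 < i)%nat -> (2 * i <= n)%nat -> Q i) -> forall i, (0 < i < n)%nat -> Q i.
Proof.
  intros Hs H i Hi. destruct (le_lt_dec (2 * i) n); [apply H; lia|].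
  apply Hs; auto. apply H; lia.
Qed.

Lemma half_angle n i : (0 < i)%nat -> (2 * i <= n)%nat ->
  0 < PI * INR i / INR n <= PI / 2 /\ 3 * (INR i / INR n) <= PI * INR i / INR n.
Proof.
  intros H0 H. assert (Hn : 0 < INR n) by (apply lt_0_INR; lia).
  apply lt_0_INR in H0. apply le_INR in H. rewrite mult_INR in H. simpl in H.
  pose proof PI2_3_2. pose proof PI2_1.
  assert (E : INR i / INR n * INR n = INR i) by (field; lra).
  assert (0 < INR i / INR n) by (apply Rdiv_lt_0_compat; lra).
  replace (PI * INR i / INR n) with (PI * (INR i / INR n)) by (field; lra).
  assert (INR i / INR n <= / 2) by nra.
  repeat split; nra.
Qed.

Lemma imin_sym n i : (i <= n)%nat -> imin n (n - i) = imin n i.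
Proof. intros H. unfold imin. replace (n - (n - i))%nat with i by lia. ring. Qed.

Lemma imin_ge n i : (0 < i < n)%nat -> 0 < / INR i <= imin n i.
Proof.
  intros Hi. unfold imin.
  assert (0 < / INR i) by (apply Rinv_0_lt_compat, lt_0_INR; lia).
  assert (0 < / INR (n - i)) by (apply Rinv_0_lt_compat, lt_0_INR; lia). lra.
Qed.

Lemma sn_ge n i : (0 < i)%nat -> (2 * i <= n)%nat -> INR i / INR n <= sn n i.
Proof.
  intros H0 H. destruct (half_angle n i H0 H) as [Ha Hb].
  destruct (sin_ge_third (PI * INR i / INR n)) as [_ Hc]; [lra|]. unfold sn. lra.
Qed.

Lemma inv_sn_le n i : (0 < i < n)%nat -> / sn n i <= INR n * imin n i.
Proof.
  revert i. apply half_cases.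
  - intros i Hi. now rewrite imin_sym, sn_sym by lia.
  - intros i H0 H. assert (Hn : 0 < INR n) by (apply lt_0_INR; lia).
    assert (Hi : 0 < INR i) by (apply lt_0_INR; lia).
    pose proof (sn_ge n i H0 H).
    apply Rle_trans with (/ (INR i / INR n)).
    + apply Rinv_le_contravar; auto. apply Rdiv_lt_0_compat; lra.
    + replace (/ (INR i / INR n)) with (INR n * / INR i) by (field; lra).
      apply Rmult_le_compat_l; [lra|]. apply imin_ge; lia.
Qed.

(** The correction in [row_sum] is controlled by Bernoulli: with [k = min(i, n - i)] one has
    [s >= k / n], so [rho^n >= (1 + 2 s)^n >= 1 + 2 k], and [2 / (rho^n - 1) <= 1 / k]. *)
Lemma row_sum_bounds n i :
  (0 < i < n)%nat ->
  let s := sn n i in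
  let m := INR n / (s * sqrt (1 + s ^ 2)) in
  m <= bsum n (fun j => / dd n i j) <= m * (1 + imin n i)
  /\ bsum n (fun j => / dd n i j) <= 2 * INR n / s.
Proof.
  intros Hi s m. rewrite row_sum by auto. cbv zeta. fold s.
  assert (Hs : 0 < s) by (apply sn_pos; auto).
  assert (Hq : 1 <= sqrt (1 + s ^ 2)) by apply one_le_sqrt.
  assert (Hn : 0 < INR n) by (apply lt_0_INR; lia).
  set (q := sqrt (1 + s ^ 2)) in *.
  set (rho := 1 + 2 * s ^ 2 + 2 * s * q).
  assert (Hrho : forall k, (0 < k)%nat -> (2 * k <= n)%nat -> INR k / INR n <= s ->
      1 + 2 * INR k <= rho ^ n).
  { intros k Hk1 Hk2 Hk3. apply Rle_trans with ((1 + 2 * s) ^ n).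
    - eapply Rle_trans; [|apply poly; lra].
      assert (INR k / INR n * INR n = INR k) by (field; lra). nra.
    - apply pow_incr. unfold rho. nra. }
  assert (Hgap : exists k, (0 < k)%nat /\ 1 + 2 * INR k <= rho ^ n /\ / INR k <= imin n i).
  { destruct (le_lt_dec (2 * i) n).
    - exists i. split; [lia|]. split; [|apply imin_ge; lia].
      apply Hrho; try lia. apply sn_ge; lia.
    - exists (n - i)%nat. split; [lia|]. split.
      + apply Hrho; try lia. unfold s. rewrite <- sn_sym by lia. apply sn_ge; lia.
      + rewrite <- imin_sym by lia. apply imin_ge; lia. }
  destruct Hgap as [k [Hk [Hk1 Hk2]]].
  assert (HK : 1 <= INR k) by (apply (le_INR 1); lia).
  assert (Hm : 2 * INR n / (2 * s * q) = m) by (unfold m; fold q; field; lra).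
  assert (Hm0 : 0 < m) by (unfold m; apply Rdiv_lt_0_compat; nra).
  assert (Hx : 0 < 2 / (rho ^ n - 1) <= / INR k).
  { split; [apply Rdiv_lt_0_compat; lra|].
    replace (/ INR k) with (2 / (2 * INR k)) by (field; lra).
    apply Rmult_le_compat_l; [lra|]. apply Rinv_le_contravar; lra. }
  assert (Hk3 : / INR k <= 1) by (rewrite <- Rinv_1; apply Rinv_le_contravar; lra).
  rewrite Hm. set (x := 2 / (rho ^ n - 1)) in *.
  assert (Hms : m <= INR n / s).
  { unfold m, Rdiv. apply Rmult_le_compat_l; [lra|]. apply Rinv_le_contravar; nra. }
  replace (2 * INR n / s) with (2 * (INR n / s)) by (field; lra).
  repeat split; nra.
Qed.

Lemma ln_le_sub_1 x : 0 < x -> ln x <= x - 1.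
Proof.
  intros Hx. pose proof (exp_ineq1_le (ln x)). rewrite exp_ln in H by auto. lra.
Qed.

Lemma ln_sub_le x y : 0 < x -> 0 < y -> ln x - ln y <= x / y - 1.
Proof.
  intros Hx Hy. assert (0 < / y) by now apply Rinv_0_lt_compat.
  replace (ln x - ln y) with (ln (x / y)).
  - apply ln_le_sub_1. unfold Rdiv; nra.
  - unfold Rdiv. rewrite ln_mult, ln_Rinv by auto. ring.
Qed.

Lemma harmonic_ln m :
  ln (INR (S m)) <= bsum m (fun i => / INR (S i)) <= 1 + ln (INR (S m)).
Proof.
  (* The extra term [- / INR (S m)] makes the upper bound inductive: the logarithm grows by at least
     [1 / (x + 1)] from [x] to [x + 1]. *)
  assert (H : ln (INR (S m)) <= bsum m (fun i => / INR (S i))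
              <= 1 - / INR (S m) + ln (INR (S m))).
  { induction m as [|m IH].
    - simpl. rewrite ln_1. lra.
    - change (bsum (S m) ?f) with (bsum m f + f m).
      cbv beta. rewrite (S_INR (S m)).
      set (x := INR (S m)) in *.
      assert (Hx : 0 < x) by (apply lt_0_INR; lia).
      assert (H1 : ln (x + 1) - ln x <= / x).
      { eapply Rle_trans; [apply ln_sub_le; lra|]. right; field; lra. }
      assert (H2 : ln x - ln (x + 1) <= - / (x + 1)).
      { eapply Rle_trans; [apply ln_sub_le; lra|]. right; field; lra. }
      lra. }
  assert (0 < / INR (S m)) by (apply Rinv_0_lt_compat, lt_0_INR; lia). lra.
Qed.

Lemma inv_sq_sum m : bsum m (fun i => (/ INR (S i)) ^ 2) <= 2.
Proof.
  destruct m as [|m]; [simpl; lra|].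
  assert (H : bsum (S m) (fun i => (/ INR (S i)) ^ 2) <= 2 - / INR (S m)).
  { induction m as [|m IH]; [simpl; lra|].
    change (bsum (S (S m)) ?f) with (bsum (S m) f + f (S m)).
    cbv beta. rewrite (S_INR (S m)). set (x := INR (S m)) in *.
    assert (Hx : 0 < x) by (apply lt_0_INR; lia).
    assert (Hy : (/ (x + 1)) ^ 2 <= / x - / (x + 1)).
    { replace (/ x - / (x + 1)) with (/ (x * (x + 1))) by (field; lra).
      rewrite pow_inv. apply Rinv_le_contravar; nra. }
    lra. }
  assert (0 < / INR (S m)) by (apply Rinv_0_lt_compat, lt_0_INR; lia). lra.
Qed.

Lemma imin_rev m (p : nat) :
  bsum m (fun i => (/ INR (S m - S i)) ^ p) = bsum m (fun i => (/ INR (S i)) ^ p).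
Proof.
  rewrite bsum_rev. apply bsum_ext. intros i Hi.
  replace (S m - S (m - 1 - i))%nat with (S i) by lia. reflexivity.
Qed.

Lemma imin_sum m :
  bsum m (fun i => imin (S m) (S i)) = 2 * bsum m (fun i => / INR (S i)).
Proof.
  unfold imin. rewrite bsum_plus.
  assert (H : bsum m (fun i => / INR (S m - S i)) = bsum m (fun i => / INR (S i))).
  { rewrite bsum_rev. apply bsum_ext. intros i Hi.
    replace (S m - S (m - 1 - i))%nat with (S i) by lia. reflexivity. }
  rewrite H. ring.
Qed.

Lemma imin_sq_sum m : bsum m (fun i => imin (S m) (S i) ^ 2) <= 8.
Proof.
  apply Rle_trans with
    (bsum m (fun i => 2 * ((/ INR (S i)) ^ 2 + (/ INR (S m - S i)) ^ 2))).
  - apply bsum_le. intros i _. unfold imin.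
    assert (H := pow2_ge_0 (/ INR (S i) - / INR (S m - S i))). lra.
  - rewrite bsum_scal, bsum_plus, imin_rev. pose proof (inv_sq_sum m). lra.
Qed.

Lemma imin_bounds n i : (0 < i < n)%nat -> 0 < imin n i <= 2.
Proof.
  intros Hi. pose proof (imin_ge n i Hi). split; [lra|]. unfold imin.
  assert (forall k, (0 < k)%nat -> / INR k <= 1).
  { intros k Hk. rewrite <- Rinv_1. apply Rinv_le_contravar; [lra|]. apply (le_INR 1); lia. }
  assert (/ INR i <= 1) by (apply H0; lia).
  assert (/ INR (n - i) <= 1) by (apply H0; lia). lra.
Qed.

(** Both [sin t] and [sqrt(1 + sin^2 t)] deviate from [t] and [1] only by relative order [t^2], so
    the inverse deviates from [1 / t] by [O(t)], which is bounded on the interval. *)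
Lemma inv_sin_sqrt_bound t :
  0 < t <= PI / 2 -> Rabs (/ (sin t * sqrt (1 + sin t ^ 2)) - / t) <= 2.
Proof.
  intros Ht. pose proof PI_4.
  destruct (sin_ge_third t) as [H1 H2]; [lra|].
  assert (H3 : sin t <= t) by (left; apply sin_lt_x; lra).
  set (s := sin t) in *. assert (Hs : 0 < s) by lra.
  assert (Hq : 1 <= sqrt (1 + s ^ 2)) by apply one_le_sqrt.
  assert (Hq2 : sqrt (1 + s ^ 2) <= 1 + s ^ 2).
  { assert (E : sqrt (1 + s ^ 2) ^ 2 = 1 + s ^ 2) by (apply pow2_sqrt; nra). nra. }
  set (q := sqrt (1 + s ^ 2)) in *.
  assert (Ht2 : t ^ 2 <= 4) by nra.
  apply Rabs_le. split.
  - assert (H4 : / (t * (1 + t ^ 2)) <= / (s * q)).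
    { apply Rinv_le_contravar; [nra|]. apply Rmult_le_compat; nra. }
    assert (H5 : / (t * (1 + t ^ 2)) = / t - t / (1 + t ^ 2)) by (field; nra).
    assert (H6 : t / (1 + t ^ 2) <= t).
    { unfold Rdiv. rewrite <- (Rmult_1_r t) at 3. apply Rmult_le_compat_l; [lra|].
      rewrite <- Rinv_1. apply Rinv_le_contravar; nra. }
    lra.
  - assert (H4 : / (s * q) <= / (t - t ^ 3 / 6)).
    { apply Rinv_le_contravar; nra. }
    assert (H5 : / (t - t ^ 3 / 6) = / t + t / (6 - t ^ 2)) by (field; split; nra).
    assert (H6 : t / (6 - t ^ 2) <= t / 2).
    { unfold Rdiv. apply Rmult_le_compat_l; [lra|]. apply Rinv_le_contravar; nra. }
    lra.
Qed.

Lemma inv_sn_sqrt_bound n i :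
  (0 < i < n)%nat ->
  Rabs (/ (sn n i * sqrt (1 + sn n i ^ 2)) - INR n / PI * imin n i) <= 3.
Proof.
  revert i. apply half_cases.
  - intros i Hi. now rewrite imin_sym, sn_sym by lia.
  - intros i H0 H. destruct (half_angle n i H0 H) as [Ha _].
    pose proof (inv_sin_sqrt_bound _ Ha) as Hb.
    fold (sn n i) in Hb.
    assert (Hn : 0 < INR n) by (apply lt_0_INR; lia).
    assert (Hi : 0 < INR i) by (apply lt_0_INR; lia).
    pose proof PI_RGT_0. pose proof PI2_3_2.
    replace (/ (PI * INR i / INR n)) with (INR n / PI * / INR i) in Hb by (field; lra).
    unfold imin. rewrite Rmult_plus_distr_l.
    (* In this half the second term of [imin] adds at most 1, which turns the bound 2 for the sine
       into 3. *)
    assert (Hk : 0 <= INR n / PI * / INR (n - i) <= 1).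
    { assert (Hni : INR n <= 2 * INR (n - i)).
      { rewrite <- (mult_INR 2). apply le_INR. lia. }
      assert (0 < INR (n - i)) by lra.
      replace (INR n / PI * / INR (n - i)) with (INR n / (PI * INR (n - i))) by (field; lra).
      split.
      - left. apply Rdiv_lt_0_compat; nra.
      - apply Rmult_le_reg_r with (PI * INR (n - i)); [nra|].
        unfold Rdiv. rewrite Rmult_assoc, Rinv_l by nra. nra. }
    apply Rabs_le. apply Rabs_le_inv in Hb. lra.
Qed.

Definition gsum (n : nat) : R := bsum2 n (fun i j => / dd n i j).

Lemma inv_sq_sn_le n i : (0 < i < n)%nat -> (/ sn n i) ^ 2 <= INR n ^ 2 * imin n i ^ 2.
Proof.
  intros Hi. rewrite <- Rpow_mult_distr. apply pow_incr. split; [|now apply inv_sn_le].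
  left. apply Rinv_0_lt_compat, sn_pos. auto.
Qed.

(** Row [i > 0] equals [n^2 / PI] times [imin], up to [3 n + n^2 imin^2]; [imin] sums to twice a
    harmonic number and [imin^2] to at most 8. The constant is 8 for row 0, 3 + 8 for the errors of
    the rows, and 1 for replacing the harmonic number by the logarithm. *)
Lemma gsum_asymptotics n :
  (0 < n)%nat -> Rabs (gsum n - 2 / PI * INR n ^ 2 * ln (INR n)) <= 20 * INR n ^ 2.
Proof.
  intros Hn. destruct n as [|m]; [lia|].
  set (N := INR (S m)). assert (HN : 1 <= N) by (apply (le_INR 1); lia).
  unfold gsum, bsum2. rewrite bsum_S_l.
  assert (H0 : 0 <= bsum (S m) (fun j => / dd (S m) 0 j) <= 8 * N ^ 2).
  { split; [apply bsum_nonneg; intros; apply inv_dd_nonneg|].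
    rewrite bsum_S_l, dd_00, Rinv_0, Rplus_0_l.
    apply Rle_trans with (bsum m (fun j => N ^ 2 * imin (S m) (S j) ^ 2)).
    - apply bsum_le. intros j Hj. rewrite dd_sn, sn_0.
      replace (0 ^ 2 + sn (S m) (S j) ^ 2) with (sn (S m) (S j) ^ 2) by ring.
      rewrite <- pow_inv. apply inv_sq_sn_le. lia.
    - rewrite bsum_scal. pose proof (imin_sq_sum m). nra. }
  assert (HR : Rabs (bsum m (fun i => bsum (S m) (fun j => / dd (S m) (S i) j))
                - N ^ 2 / PI * bsum m (fun i => imin (S m) (S i))) <= 11 * N ^ 2).
  { rewrite <- bsum_scal, <- bsum_minus.
    eapply Rle_trans; [apply bsum_abs|].
    apply Rle_trans with (bsum m (fun i => 3 * N + N ^ 2 * imin (S m) (S i) ^ 2)).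
    - apply bsum_le. intros i Hi.
      destruct (row_sum_bounds (S m) (S i)) as [[Hl Hu] _]; [lia|].
      pose proof (inv_sn_sqrt_bound (S m) (S i) ltac:(lia)) as Hb.
      pose proof (inv_sn_le (S m) (S i) ltac:(lia)) as Hc.
      pose proof (imin_bounds (S m) (S i) ltac:(lia)) as Hd.
      assert (Hs : 0 < sn (S m) (S i)) by (apply sn_pos; lia).
      fold N in Hl, Hu, Hb, Hc. set (s := sn (S m) (S i)) in *.
      set (I := imin (S m) (S i)) in *.
      assert (Hq : 1 <= sqrt (1 + s ^ 2)) by apply one_le_sqrt.
      set (q := sqrt (1 + s ^ 2)) in *.
      assert (He : / (s * q) <= N * I).
      { eapply Rle_trans; [|exact Hc]. apply Rinv_le_contravar; nra. }
      assert (Hf : 0 < / (s * q)) by (apply Rinv_0_lt_compat; nra).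
      unfold Rdiv in Hl, Hu. apply Rabs_le_inv in Hb.
      set (r := bsum (S m) _) in *. set (v := / (s * q)) in *.
      replace (N ^ 2 / PI * I) with (N * (N / PI * I)) by (unfold Rdiv; ring).
      set (w := N / PI * I) in *.
      apply Rabs_le. split; nra.
    - rewrite bsum_plus, bsum_const, bsum_scal. pose proof (imin_sq_sum m).
      assert (INR m <= N) by (apply le_INR; lia). pose proof (pos_INR m). nra. }
  rewrite imin_sum in HR. pose proof (harmonic_ln m) as HH. fold N in HH.
  set (L := ln N) in *. set (h := bsum m (fun i => / INR (S i))) in *.
  pose proof PI2_3_2.
  assert (Hp : 0 < / PI <= / 3).
  { split; [apply Rinv_0_lt_compat; lra|apply Rinv_le_contravar; lra]. }
  assert (HD : 0 <= N ^ 2 / PI * (2 * h) - 2 / PI * N ^ 2 * L <= N ^ 2).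
  { replace (N ^ 2 / PI * (2 * h) - 2 / PI * N ^ 2 * L) with (N ^ 2 * (2 * / PI * (h - L)))
      by (unfold Rdiv; ring).
    assert (0 <= 2 * / PI * (h - L) <= 1) by nra. nra. }
  apply Rabs_le_inv in HR. apply Rabs_le. lra.
Qed.

(** In each row [i > 0] one factor [/ dd] is bounded by [1 / s^2] and the other is summed by
    [row_sum_bounds]; row 0 is estimated termwise. Either way the bound is a sum of
    [4 n^4 imin^2]. *)
Lemma gsum_sq_le n : bsum2 n (fun i j => (/ dd n i j) ^ 2) <= 64 * INR n ^ 4.
Proof.
  destruct n as [|m]; [unfold bsum2; simpl; lra|].
  set (N := INR (S m)). assert (HN : 1 <= N) by (apply (le_INR 1); lia).
  assert (HN4 : 0 < N ^ 4) by (apply pow_lt; lra).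
  unfold bsum2. rewrite bsum_S_l.
  assert (H0 : bsum (S m) (fun j => (/ dd (S m) 0 j) ^ 2) <= 32 * N ^ 4).
  { rewrite bsum_S_l, dd_00, Rinv_0.
    replace (0 ^ 2 + _) with (bsum m (fun j => (/ dd (S m) 0 (S j)) ^ 2)) by ring.
    apply Rle_trans with (bsum m (fun j => 4 * N ^ 4 * imin (S m) (S j) ^ 2)).
    - apply bsum_le. intros j Hj. rewrite dd_sn, sn_0.
      replace (0 ^ 2 + sn (S m) (S j) ^ 2) with (sn (S m) (S j) ^ 2) by ring.
      rewrite <- pow_inv.
      pose proof (inv_sq_sn_le (S m) (S j) ltac:(lia)) as Ha. fold N in Ha.
      pose proof (imin_bounds (S m) (S j) ltac:(lia)) as Hd.
      set (I := imin (S m) (S j)) in *.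
      assert (Hx : 0 <= (/ sn (S m) (S j)) ^ 2) by apply pow2_ge_0.
      apply Rle_trans with ((N ^ 2 * I ^ 2) ^ 2); [apply pow_incr; lra|].
      replace ((N ^ 2 * I ^ 2) ^ 2) with (N ^ 4 * (I ^ 2 * I ^ 2)) by ring.
      assert (I ^ 2 <= 4) by nra. assert (0 <= I ^ 2) by nra.
      replace (4 * N ^ 4 * I ^ 2) with (N ^ 4 * (4 * I ^ 2)) by ring.
      apply Rmult_le_compat_l; nra.
    - rewrite bsum_scal. pose proof (imin_sq_sum m). nra. }
  assert (H1 : bsum m (fun i => bsum (S m) (fun j => (/ dd (S m) (S i) j) ^ 2)) <= 32 * N ^ 4).
  { apply Rle_trans with (bsum m (fun i => 4 * N ^ 4 * imin (S m) (S i) ^ 2)).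
    - apply bsum_le. intros i Hi.
      destruct (row_sum_bounds (S m) (S i)) as [_ Hu]; [lia|]. fold N in Hu.
      pose proof (inv_sn_le (S m) (S i) ltac:(lia)) as Hc. fold N in Hc.
      pose proof (inv_sq_sn_le (S m) (S i) ltac:(lia)) as Ha. fold N in Ha.
      pose proof (imin_bounds (S m) (S i) ltac:(lia)) as Hd.
      assert (Hs : 0 < sn (S m) (S i)) by (apply sn_pos; lia).
      set (s := sn (S m) (S i)) in *. set (I := imin (S m) (S i)) in *.
      assert (Hv : 0 < / s) by (apply Rinv_0_lt_compat; auto).
      apply Rle_trans with (bsum (S m) (fun j => (/ s) ^ 2 * / dd (S m) (S i) j)).
      + apply bsum_le. intros j Hj.
        replace ((/ dd (S m) (S i) j) ^ 2) with (/ dd (S m) (S i) j * / dd (S m) (S i) j) by ring.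
        apply Rmult_le_compat_r; [apply inv_dd_nonneg|].
        rewrite pow_inv. apply Rinv_le_contravar; [nra|].
        rewrite dd_sn. fold s. nra.
      + rewrite bsum_scal.
        apply Rle_trans with ((N ^ 2 * I ^ 2) * (2 * N * (N * I))).
        * apply Rmult_le_compat; [nra| |exact Ha|].
          -- apply bsum_nonneg; intros; apply inv_dd_nonneg.
          -- eapply Rle_trans; [exact Hu|]. unfold Rdiv. apply Rmult_le_compat_l; lra.
        * replace (N ^ 2 * I ^ 2 * (2 * N * (N * I))) with (N ^ 4 * (2 * (I ^ 2 * I))) by ring.
          replace (4 * N ^ 4 * I ^ 2) with (N ^ 4 * (4 * I ^ 2)) by ring.
          apply Rmult_le_compat_l; nra.
    - rewrite bsum_scal. pose proof (imin_sq_sum m). nra. }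
  lra.
Qed.

(** * Heat kernel, Green function and potential kernel *)

Notation orig := (0%Z, 0%Z) (only parsing).

Definition l1 (x : pt) : Z := (Z.abs (fst x) + Z.abs (snd x))%Z.

(** Convolution inverse of [I - Pop] on periodic functions of mean zero. *)
Definition green (n : nat) (x : pt) : R :=
  / INR n ^ 2 * bsum2 n (fun i j => / dd n i j * char n i j x).

(** Torus analogue of [pot_kernel], to which it converges in [apot_cv]. *)
Definition apot (n : nat) (x : pt) : R := green n orig - green n x.

(** Heat kernel of the torus, by spectral decomposition. *)
Definition qker (n k : nat) (x : pt) : R :=
  / INR n ^ 2 * bsum2 n (fun i j => phi n i j ^ k * char n i j x).

Lemma dd_inv_dd n i j :
  (i < n)%nat -> (j < n)%nat ->
  dd n i j * / dd n i j = if (Nat.eqb i 0 && Nat.eqb j 0)%bool then 0 else 1.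
Proof.
  intros Hi Hj. destruct i as [|i], j as [|j]; simpl.
  - rewrite dd_00. ring.
  - rewrite Rinv_r; auto. apply Rgt_not_eq, dd_pos; auto; congruence.
  - rewrite Rinv_r; auto. apply Rgt_not_eq, dd_pos; auto; congruence.
  - rewrite Rinv_r; auto. apply Rgt_not_eq, dd_pos; auto; congruence.
Qed.

Lemma bsum2_skip_origin n F :
  (0 < n)%nat ->
  bsum2 n (fun i j => (if (Nat.eqb i 0 && Nat.eqb j 0)%bool then 0 else 1) * F i j)
  = bsum2 n F - F 0%nat 0%nat.
Proof.
  intros Hn.
  assert (H : bsum2 n F - bsum2 n (fun i j =>
     (if (Nat.eqb i 0 && Nat.eqb j 0)%bool then 0 else 1) * F i j) = F 0%nat 0%nat).
  { rewrite <- bsum2_minus. rewrite (bsum2_single n _ 0 0); auto; [simpl; ring|].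
    intros i j Hi Hj Hne. destruct i, j; simpl; try ring. congruence. }
  lra.
Qed.

Lemma INR_sq_neq_0 n : (0 < n)%nat -> INR n ^ 2 <> 0.
Proof. intros H. apply pow_nonzero, not_0_INR. lia. Qed.

Lemma inv_INR_sq_pos n : (0 < n)%nat -> 0 < / INR n ^ 2.
Proof. intros H. apply Rinv_0_lt_compat, pow_lt, lt_0_INR, H. Qed.

Lemma green_equation n x :
  (0 < n)%nat ->
  green n x - Pop (green n) x = (if at_origin n x then 1 else 0) - / INR n ^ 2.
Proof.
  intros Hn. unfold green. rewrite Pop_scal, Pop_bsum2, <- Rmult_minus_distr_l, <- bsum2_minus.
  rewrite (bsum2_ext n _ (fun i j =>
    (if (Nat.eqb i 0 && Nat.eqb j 0)%bool then 0 else 1) * char n i j x)).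
  - rewrite bsum2_skip_origin by auto. rewrite sum_char_frequencies, char_00 by auto.
    assert (INR n <> 0) by (apply not_0_INR; lia). destruct (at_origin n x); field; auto.
  - intros i j Hi Hj. rewrite Pop_scal, Pop_char, <- (dd_inv_dd n i j) by auto.
    generalize (/ dd n i j). intros w. unfold dd. ring.
Qed.

Lemma qker_S n k x : qker n (S k) x = Pop (qker n k) x.
Proof.
  unfold qker. rewrite Pop_scal, Pop_bsum2. f_equal. apply bsum2_ext; intros.
  rewrite Pop_scal, Pop_char. simpl. ring.
Qed.

Lemma nbrs_l1 x y : In y (nbrs x) -> (l1 y <= l1 x + 1)%Z.
Proof.
  unfold nbrs, l1. simpl. intros [<-|[<-|[<-|[<-|[]]]]]; simpl; lia.
Qed.

Lemma at_origin_small n x :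
  (l1 x < Z.of_nat n)%Z -> at_origin n x = pt_eqb x orig.
Proof.
  intros H. unfold at_origin, pt_eqb, l1 in *. simpl.
  assert (forall z, (Z.abs z < Z.of_nat n)%Z -> (z mod Z.of_nat n =? 0)%Z = (z =? 0)%Z).
  { intros z Hz. apply Bool.eq_true_iff_eq. rewrite !Z.eqb_eq, Z.mod_divide by lia. split.
    - intros [w ->]. assert (w = 0 \/ w >= 1 \/ w <= -1)%Z by lia. nia.
    - intros ->. apply Z.divide_0_r. }
  rewrite !H0 by lia. reflexivity.
Qed.

Lemma srw_p_S k x y : srw_p (S k) x y = Pop (fun z => srw_p k z y) x.
Proof. reflexivity. Qed.

(** Both kernels obey the same recursion, and a walk started at [x] cannot tell the torus from the
    plane before it could reach a nonzero multiple of the period. *)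
Lemma qker_srw n k x :
  (l1 x + Z.of_nat k < Z.of_nat n)%Z -> qker n k x = srw_p k x orig.
Proof.
  revert x. induction k as [|k IH]; intros x H.
  - unfold qker. simpl srw_p.
    rewrite (bsum2_ext n _ (fun i j => char n i j x)) by (intros; simpl; ring).
    assert (Hn : (0 < n)%nat) by (unfold l1 in H; lia).
    rewrite sum_char_frequencies by auto. rewrite at_origin_small by lia.
    assert (INR n <> 0) by (apply not_0_INR; lia). destruct (pt_eqb x orig); field; auto.
  - rewrite qker_S, srw_p_S. apply Pop_ext_in. intros y Hy. apply IH.
    apply nbrs_l1 in Hy. lia.
Qed.

Lemma srw_p_nonneg k x y : 0 <= srw_p k x y.
Proof.
  revert x. induction k as [|k IH]; intros x.
  - simpl. destruct (pt_eqb x y); lra.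
  - rewrite srw_p_S, <- (Pop_const 0 x). apply Pop_le. intros; apply IH.
Qed.

Lemma srw_p_far k x : (Z.of_nat k < l1 x)%Z -> srw_p k x orig = 0.
Proof.
  revert x. induction k as [|k IH]; intros x H.
  - simpl. unfold pt_eqb, l1 in *. simpl.
    destruct (fst x =? 0)%Z eqn:E1, (snd x =? 0)%Z eqn:E2; simpl; auto.
    apply Z.eqb_eq in E1, E2. rewrite E1, E2 in H. simpl in H. lia.
  - rewrite srw_p_S, <- (Pop_const 0 x). apply Pop_ext_in. intros y Hy. apply IH.
    unfold nbrs, l1 in *. simpl in Hy. destruct Hy as [<-|[<-|[<-|[<-|[]]]]]; simpl; lia.
Qed.

Lemma pt_eqb_spec x y : pt_eqb x y = true <-> x = y.
Proof.
  unfold pt_eqb. rewrite Bool.andb_true_iff, !Z.eqb_eq. destruct x, y; simpl.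
  split; [intros [-> ->]; auto|intros [=]; auto].
Qed.

Lemma srw_p_translate k x y : srw_p k x y = srw_p k (psub x y) orig.
Proof.
  revert x. induction k as [|k IH]; intros x.
  - simpl. assert (E : pt_eqb x y = pt_eqb (psub x y) orig).
    { apply Bool.eq_true_iff_eq. rewrite !pt_eqb_spec. unfold psub. destruct x, y; simpl.
      split; [intros [= -> ->]; f_equal; lia|intros [= ? ?]; f_equal; lia]. }
    now rewrite E.
  - rewrite !srw_p_S, <- (Pop_shift (fun z => srw_p k z orig)). apply Pop_ext; auto.
Qed.

(** Odd return probabilities vanish, so estimates by a return probability use the last even time up
    to [k]. *)
Definition even_part (k : nat) : nat := (2 * (k / 2))%nat.

Lemma even_part_bounds k : (k - 1 <= even_part k <= k)%nat.
Proof.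
  unfold even_part. pose proof (Nat.div_mod k 2). pose proof (Nat.mod_upper_bound k 2). lia.
Qed.

Lemma pow_even_abs x l : x ^ (2 * l) = Rabs x ^ (2 * l).
Proof. rewrite !pow_mult, <- (pow2_abs x). reflexivity. Qed.

Lemma pow_abs_le x k l : Rabs x <= 1 -> (k <= l)%nat -> Rabs x ^ l <= Rabs x ^ k.
Proof.
  intros Hx H. pose proof (Rabs_pos x). replace l with (k + (l - k))%nat by lia.
  rewrite pow_add. rewrite <- (Rmult_1_r (Rabs x ^ k)) at 2.
  apply Rmult_le_compat_l; [now apply pow_le|].
  rewrite <- (pow1 (l - k)). apply pow_incr. lra.
Qed.

(** At an even exponent the absolute values disappear, and the sum is a return probability of the
    torus, hence of the plane as fewer than [n] steps are made. *)
Lemma phi_pow_sum n k :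
  (k < n)%nat ->
  / INR n ^ 2 * bsum2 n (fun i j => Rabs (phi n i j) ^ k) <= srw_p (even_part k) orig orig.
Proof.
  intros H. pose proof (even_part_bounds k).
  rewrite <- (qker_srw n) by (unfold l1; simpl; lia). unfold qker.
  apply Rmult_le_compat_l; [left; apply inv_INR_sq_pos; lia|].
  apply bsum2_le. intros i j _ _. rewrite char_origin, Rmult_1_r.
  unfold even_part at 1. rewrite pow_even_abs. apply pow_abs_le; [apply phi_abs_le_1|].
  fold (even_part k). lia.
Qed.

Lemma srw_p_le_even k x : srw_p k x orig <= srw_p (even_part k) orig orig.
Proof.
  set (n := S (k + Z.to_nat (l1 x))). assert (0 <= l1 x)%Z by (unfold l1; lia).
  rewrite <- (qker_srw n) by (unfold n; lia).
  eapply Rle_trans; [|apply (phi_pow_sum n); unfold n; lia].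
  unfold qker. apply Rmult_le_compat_l; [left; apply inv_INR_sq_pos; unfold n; lia|].
  apply bsum2_le. intros i j _ _.
  eapply Rle_trans; [apply Rle_abs|]. rewrite Rabs_mult, <- RPow_abs.
  rewrite <- (Rmult_1_r (Rabs _ ^ k)) at 2.
  apply Rmult_le_compat_l; [apply pow_le, Rabs_pos|apply char_abs_le_1].
Qed.

Lemma geometric_dd n i j K :
  dd n i j * bsum K (fun k => phi n i j ^ k) = 1 - phi n i j ^ K.
Proof. unfold dd. induction K as [|K IH]; simpl; [ring|]. rewrite Rmult_plus_distr_l, IH. ring. Qed.

Lemma even_return_decreasing k l :
  (k <= l)%nat -> srw_p (2 * l) orig orig <= srw_p (2 * k) orig orig.
Proof.
  intros H. set (n := S (2 * l)).
  rewrite <- !(qker_srw n) by (unfold l1, n; simpl Z.abs; lia).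
  unfold qker. apply Rmult_le_compat_l; [left; apply inv_INR_sq_pos; unfold n; lia|].
  apply bsum2_le. intros i j _ _. rewrite char_origin, (pow_even_abs _ l), (pow_even_abs _ k).
  apply Rmult_le_compat_r; [lra|]. apply pow_abs_le; [apply phi_abs_le_1|lia].
Qed.

Lemma green_origin n : green n orig = / INR n ^ 2 * gsum n.
Proof.
  unfold green, gsum. f_equal. apply bsum2_ext. intros. rewrite char_origin. ring.
Qed.

Lemma green_origin_le n : (0 < n)%nat -> green n orig <= 20 + ln (INR n).
Proof.
  intros Hn. rewrite green_origin. pose proof (gsum_asymptotics n Hn) as H.
  apply Rabs_le_inv in H. pose proof PI2_3_2.
  assert (HN : 1 <= INR n) by (apply (le_INR 1); lia).
  assert (HL : 0 <= ln (INR n)).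
  { rewrite <- ln_1. destruct HN as [HN|<-]; [left; apply ln_increasing; lra|lra]. }
  assert (HP : 2 / PI <= 1).
  { apply Rmult_le_reg_r with PI; [lra|]. unfold Rdiv. rewrite Rmult_assoc, Rinv_l; lra. }
  apply Rmult_le_reg_l with (INR n ^ 2); [nra|].
  rewrite <- Rmult_assoc, Rinv_r, Rmult_1_l by (apply INR_sq_neq_0; auto).
  assert (0 <= INR n ^ 2 * ln (INR n)) by (apply Rmult_le_pos; nra).
  replace (2 / PI * INR n ^ 2 * ln (INR n)) with (2 / PI * (INR n ^ 2 * ln (INR n))) in H by ring.
  nra.
Qed.

(** Even return probabilities decrease, so the left side is at most the expected number of returns
    before time [2 l]. On a torus of side [2 l + 1] the zero frequency contributes at most 1 to it,
    and every other one at most [2 / dd]; hence [41 = 1 + 2 * 20] by [green_origin_le]. *)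
Lemma return_sum_bound l :
  INR l * srw_p (2 * l) orig orig <= 41 + 2 * ln (INR (S (2 * l))).
Proof.
  set (n := S (2 * l)). assert (Hn : (0 < n)%nat) by (unfold n; lia).
  assert (H1 : INR l * srw_p (2 * l) orig orig <= bsum (2 * l) (fun k => srw_p k orig orig)).
  { rewrite <- bsum_const.
    apply Rle_trans with (bsum l (fun k => srw_p (2 * k) orig orig)).
    - apply bsum_le. intros i Hi. apply even_return_decreasing. lia.
    - clear. induction l as [|l IH]; [simpl; lra|].
      replace (2 * S l)%nat with (S (S (2 * l))) by lia.
      cbn [bsum]. pose proof (srw_p_nonneg (S (2 * l)) orig orig). lra. }
  assert (H2 : bsum (2 * l) (fun k => srw_p k orig orig)
     = / INR n ^ 2 * bsum2 n (fun i j => bsum (2 * l) (fun k => phi n i j ^ k))).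
  { rewrite bsum2_bsum, <- bsum_scal. apply bsum_ext. intros k Hk.
    rewrite <- (qker_srw n) by (unfold l1, n; simpl Z.abs; lia). unfold qker. f_equal.
    apply bsum2_ext. intros. rewrite char_origin. ring. }
  rewrite H2 in H1. eapply Rle_trans; [exact H1|].
  apply Rle_trans with (/ INR n ^ 2 * (INR (2 * l) + bsum2 n (fun i j => 2 * / dd n i j))).
  - apply Rmult_le_compat_l; [left; now apply inv_INR_sq_pos|].
    pose proof (bsum2_skip_origin n (fun i j => bsum (2 * l) (fun k => phi n i j ^ k)) Hn) as E.
    cbv beta in E. rewrite phi_00 in E.
    rewrite (bsum_ext (2 * l) (fun k => 1 ^ k) (fun _ => 1)) in E by (intros; apply pow1).
    rewrite bsum_const in E.
    enough (bsum2 n (fun i j => (if (Nat.eqb i 0 && Nat.eqb j 0)%bool then 0 else 1)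
       * bsum (2 * l) (fun k => phi n i j ^ k)) <= bsum2 n (fun i j => 2 * / dd n i j)) by lra.
    apply bsum2_le. intros i j Hi Hj. rewrite <- (dd_inv_dd n i j) by auto.
    replace (dd n i j * / dd n i j * bsum (2 * l) (fun k => phi n i j ^ k))
      with ((dd n i j * bsum (2 * l) (fun k => phi n i j ^ k)) * / dd n i j) by ring.
    rewrite geometric_dd. apply Rmult_le_compat_r; [apply inv_dd_nonneg|].
    rewrite pow_even_abs. pose proof (pow_le (Rabs (phi n i j)) (2 * l) (Rabs_pos _)). lra.
  - rewrite bsum2_scal. fold (gsum n). pose proof (green_origin_le n Hn) as H3.
    rewrite green_origin in H3.
    assert (H4 : / INR n ^ 2 * INR (2 * l) <= 1).
    { apply Rmult_le_reg_l with (INR n ^ 2); [apply pow_lt, lt_0_INR; lia|].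
      rewrite <- Rmult_assoc, Rinv_r, Rmult_1_l by (apply INR_sq_neq_0; auto).
      assert (1 <= INR n) by (apply (le_INR 1); lia).
      assert (INR (2 * l) <= INR n) by (apply le_INR; unfold n; lia). nra. }
    lra.
Qed.

Lemma ln_le_2_sqrt x : 0 < x -> ln x <= 2 * sqrt x.
Proof.
  intros Hx. rewrite <- (sqrt_sqrt x) at 1 by lra.
  assert (0 < sqrt x) by now apply sqrt_lt_R0.
  rewrite ln_mult by auto. pose proof (ln_le_sub_1 (sqrt x) H). lra.
Qed.

Lemma return_probability_to_0 :
  forall eps, 0 < eps -> exists K0, forall K, (K0 <= K)%nat ->
    srw_p (even_part K) orig orig < eps.
Proof.
  intros eps He.
  (* From [ln n <= 2 sqrt n] and [sqrt n <= 2 sqrt l], the bound [41 + 2 ln n] is at most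
     [49 sqrt l], so the return probability is at most [49 / sqrt l]. *)
  destruct (INR_archimed 1 ((49 / eps) ^ 2) ltac:(lra)) as [L HL].
  exists (2 * (S L))%nat. intros K HK. unfold even_part.
  apply Rle_lt_trans with (srw_p (2 * S L) orig orig).
  - apply even_return_decreasing.
    apply Nat.div_le_lower_bound; lia.
  - pose proof (return_sum_bound (S L)) as H.
    set (n := INR (S (2 * S L))) in *.
    assert (Hn : n <= 3 * INR (S L)).
    { assert (H0 : n <= INR (3 * S L)) by (apply le_INR; lia).
      rewrite mult_INR in H0. simpl (INR 3) in H0. lra. }
    set (l := INR (S L)) in *.
    assert (Hl : (49 / eps) ^ 2 < l) by (unfold l; rewrite S_INR; lra).
    assert (Hl1 : 1 <= l) by (apply (le_INR 1); lia).
    assert (Hn0 : 0 < n) by (apply lt_0_INR; lia).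
    pose proof (ln_le_2_sqrt n Hn0) as Hs.
    assert (Hs2 : sqrt n <= 2 * sqrt l).
    { replace 2 with (sqrt (2 ^ 2)) by (apply sqrt_pow2; lra).
      rewrite <- sqrt_mult by lra. apply sqrt_le_1; lra. }
    set (q := sqrt l) in *.
    assert (Hq : q * q = l) by (apply sqrt_sqrt; lra).
    assert (Hq1 : 1 <= q) by (unfold q; rewrite <- sqrt_1 at 1; apply sqrt_le_1; lra).
    set (p := srw_p (2 * S L) orig orig) in *.
    assert (H1 : l * p <= 49 * q) by lra.
    assert (H2 : 49 / eps < q).
    { apply Rsqr_incrst_0; [unfold Rsqr in *; nra| |lra].
      left. apply Rdiv_lt_0_compat; lra. }
    assert (H3 : q * p <= 49) by (apply Rmult_le_reg_l with q; nra).
    assert (H4 : 49 < q * eps).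
    { replace 49 with (49 / eps * eps) by (field; lra). nra. }
    apply Rmult_lt_reg_l with q; lra.
Qed.

(** * The potential kernel as a limit of torus kernels *)

Definition partial_pot (K : nat) (x : pt) : R :=
  bsum K (fun k => srw_p k orig orig - srw_p k x orig).

Lemma Rabs_sin_INR_le k t : Rabs (sin (INR k * t)) <= INR k * Rabs (sin t).
Proof.
  induction k as [|k IH].
  - simpl. rewrite Rmult_0_l, sin_0, Rabs_R0. lra.
  - rewrite S_INR. replace ((INR k + 1) * t) with (INR k * t + t) by ring.
    rewrite sin_plus. eapply Rle_trans; [apply Rabs_triang|]. rewrite !Rabs_mult.
    assert (Rabs (cos t) <= 1) by apply Rabs_le, COS_bound.
    assert (Rabs (cos (INR k * t)) <= 1) by apply Rabs_le, COS_bound.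
    pose proof (Rabs_pos (sin t)). pose proof (Rabs_pos (sin (INR k * t))). nra.
Qed.

Lemma Rabs_sin_IZR_le z t : Rabs (sin (IZR z * t)) <= Rabs (IZR z) * Rabs (sin t).
Proof.
  destruct (Z.le_gt_cases 0 z) as [H|H].
  - rewrite <- (Z2Nat.id z) by auto. rewrite <- INR_IZR_INZ.
    rewrite (Rabs_pos_eq (INR _)) by apply pos_INR. apply Rabs_sin_INR_le.
  - replace z with (- Z.of_nat (Z.to_nat (- z)))%Z by lia.
    rewrite opp_IZR, <- INR_IZR_INZ, Rabs_Ropp, (Rabs_pos_eq (INR _)) by apply pos_INR.
    rewrite Ropp_mult_distr_l_reverse, sin_neg, Rabs_Ropp. apply Rabs_sin_INR_le.
Qed.

Definition sqn (x : pt) : R := IZR (fst x) ^ 2 + IZR (snd x) ^ 2.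

Lemma sqn_nonneg x : 0 <= sqn x.
Proof. unfold sqn. nra. Qed.

(** Double angle: [1 - cos(2(u + v)) = 2 sin^2(u + v) <= 4 (sin^2 u + sin^2 v)], and
    [|sin(z t)| <= |z| |sin t|] for integer [z]. The factor [dd] cancels the singularity of [/ dd]
    at low frequency. *)
Lemma one_minus_char_bounds n i j x : 0 <= 1 - char n i j x <= 4 * sqn x * dd n i j.
Proof.
  split; [unfold char; pose proof (COS_bound (ang n i (fst x) + ang n j (snd x))); lra|].
  unfold char.
  set (u := IZR (fst x) * (PI * INR i / INR n)).
  set (v := IZR (snd x) * (PI * INR j / INR n)).
  replace (ang n i (fst x) + ang n j (snd x)) with (2 * (u + v))
    by (unfold u, v, ang, Rdiv; ring).
  rewrite cos_2a_sin, sin_plus, dd_sn.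
  pose proof (Rabs_sin_IZR_le (fst x) (PI * INR i / INR n)) as Hu. fold u (sn n i) in Hu.
  pose proof (Rabs_sin_IZR_le (snd x) (PI * INR j / INR n)) as Hv. fold v (sn n j) in Hv.
  assert (Hu2 : sin u ^ 2 <= IZR (fst x) ^ 2 * sn n i ^ 2).
  { rewrite <- (pow2_abs (sin u)), <- (pow2_abs (sn n i)), <- (pow2_abs (IZR (fst x))), <- Rpow_mult_distr.
    apply pow_incr. split; [apply Rabs_pos|auto]. }
  assert (Hv2 : sin v ^ 2 <= IZR (snd x) ^ 2 * sn n j ^ 2).
  { rewrite <- (pow2_abs (sin v)), <- (pow2_abs (sn n j)), <- (pow2_abs (IZR (snd x))), <- Rpow_mult_distr.
    apply pow_incr. split; [apply Rabs_pos|auto]. }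
  assert (Hc : (sin u * cos v + cos u * sin v) ^ 2 <= 2 * (sin u ^ 2 + sin v ^ 2)).
  { pose proof (COS_bound u). pose proof (COS_bound v).
    assert (cos u ^ 2 <= 1) by nra. assert (cos v ^ 2 <= 1) by nra.
    pose proof (pow2_ge_0 (sin u * cos v - cos u * sin v)).
    pose proof (pow2_ge_0 (sin u)). pose proof (pow2_ge_0 (sin v)). nra. }
  unfold sqn. pose proof (pow2_ge_0 (sn n i)). pose proof (pow2_ge_0 (sn n j)).
  pose proof (pow2_ge_0 (IZR (fst x))). pose proof (pow2_ge_0 (IZR (snd x))). nra.
Qed.

Lemma partial_pot_fourier n K x :
  (l1 x + Z.of_nat K < Z.of_nat n)%Z ->
  partial_pot K x
  = / INR n ^ 2 * bsum2 n (fun i j => (1 - phi n i j ^ K) * / dd n i j * (1 - char n i j x)).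
Proof.
  intros H. unfold partial_pot. assert (0 <= l1 x)%Z by (unfold l1; lia).
  rewrite (bsum_ext K _ (fun k => / INR n ^ 2 *
     bsum2 n (fun i j => phi n i j ^ k * (1 - char n i j x)))).
  - rewrite bsum_scal, <- bsum2_bsum. f_equal. apply bsum2_ext. intros i j Hi Hj.
    rewrite (bsum_ext K _ (fun k => (1 - char n i j x) * phi n i j ^ k)) by (intros; ring).
    rewrite (bsum_scal K _ (fun k => phi n i j ^ k)), <- geometric_dd.
    replace (dd n i j * bsum K (fun k => phi n i j ^ k) * / dd n i j)
      with (dd n i j * / dd n i j * bsum K (fun k => phi n i j ^ k)) by ring.
    rewrite dd_inv_dd by auto. destruct i, j; cbn [Nat.eqb andb]; rewrite ?char_00; ring.
  - intros k Hk. rewrite <- !(qker_srw n) by (unfold l1 in *; simpl Z.abs; lia).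
    unfold qker. rewrite <- Rmult_minus_distr_l, <- bsum2_minus. f_equal.
    apply bsum2_ext. intros. rewrite char_origin. ring.
Qed.

Lemma apot_eq n x :
  apot n x = / INR n ^ 2 * bsum2 n (fun i j => / dd n i j * (1 - char n i j x)).
Proof.
  unfold apot, green. rewrite <- Rmult_minus_distr_l, <- bsum2_minus. f_equal.
  apply bsum2_ext. intros. rewrite char_origin. ring.
Qed.

Lemma apot_partial n K x :
  (l1 x + Z.of_nat K < Z.of_nat n)%Z ->
  apot n x - partial_pot K x
  = / INR n ^ 2 * bsum2 n (fun i j => phi n i j ^ K * / dd n i j * (1 - char n i j x)).
Proof.
  intros H. rewrite (partial_pot_fourier n) by auto. rewrite apot_eq.
  rewrite <- Rmult_minus_distr_l, <- bsum2_minus. f_equal. apply bsum2_ext. intros. ring.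
Qed.

Lemma inv_dd_char_bound n i j x :
  (i < n)%nat -> (j < n)%nat -> 0 <= / dd n i j * (1 - char n i j x) <= 4 * sqn x.
Proof.
  intros Hi Hj. destruct (one_minus_char_bounds n i j x) as [H0 H1].
  pose proof (inv_dd_nonneg n i j). pose proof (sqn_nonneg x). split; [nra|].
  apply Rle_trans with (/ dd n i j * (4 * sqn x * dd n i j)); [nra|].
  replace (/ dd n i j * (4 * sqn x * dd n i j)) with (dd n i j * / dd n i j * (4 * sqn x)) by ring.
  rewrite dd_inv_dd by auto. destruct (_ && _)%bool; lra.
Qed.

(** Stopping the geometric series after [K] terms leaves a factor [phi^K] at each frequency, while
    [/ dd] times [1 - char] stays bounded. The sum of [|phi|^K] is a return probability, so the
    bound does not depend on [n]. *)
Lemma apot_partial_le n K x :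
  (l1 x + Z.of_nat K < Z.of_nat n)%Z ->
  Rabs (apot n x - partial_pot K x) <= 4 * sqn x * srw_p (even_part K) orig orig.
Proof.
  intros H. rewrite apot_partial by auto. assert (0 <= l1 x)%Z by (unfold l1; lia).
  rewrite Rabs_mult, Rabs_pos_eq by (left; apply inv_INR_sq_pos; lia).
  eapply Rle_trans; [|apply Rmult_le_compat_l; [pose proof (sqn_nonneg x); lra|]; apply (phi_pow_sum n); lia].
  rewrite <- Rmult_assoc, (Rmult_comm (4 * sqn x)), Rmult_assoc.
  apply Rmult_le_compat_l; [left; apply inv_INR_sq_pos; lia|].
  eapply Rle_trans; [apply bsum2_abs|]. rewrite <- bsum2_scal. apply bsum2_le. intros i j Hi Hj.
  rewrite Rmult_assoc, Rabs_mult, <- RPow_abs, Rmult_comm.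
  apply Rmult_le_compat_r; [apply pow_le, Rabs_pos|].
  pose proof (inv_dd_char_bound n i j x Hi Hj). rewrite Rabs_pos_eq; lra.
Qed.

Lemma sum_f_R0_bsum u n : sum_f_R0 u n = bsum (S n) u.
Proof. induction n as [|n IH]; simpl in *; [ring|]. rewrite IH. ring. Qed.

Lemma series_value_eq u l : infinite_sum u l -> series_value u = l.
Proof.
  intros H. unfold series_value. eapply uniqueness_sum; [|exact H].
  apply (epsilon_spec (inhabits 0) (fun l => infinite_sum u l)). now exists l.
Qed.

Lemma pot_kernel_series x :
  infinite_sum (fun k => srw_p k orig orig - srw_p k x orig) (pot_kernel x).
Proof.
  enough (exists l, infinite_sum (fun k => srw_p k orig orig - srw_p k x orig) l) as [l Hl].
  { unfold pot_kernel. now rewrite (series_value_eq _ _ Hl). }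
  assert (HC : Cauchy_crit (fun n => sum_f_R0 (fun k => srw_p k orig orig - srw_p k x orig) n)).
  { intros eps He. pose proof (sqn_nonneg x) as Hx.
    destruct (return_probability_to_0 (eps / (8 * sqn x + 1))) as [K0 HK].
    { apply Rdiv_lt_0_compat; lra. }
    exists K0. intros p q Hp Hq. unfold Rdist. rewrite !sum_f_R0_bsum.
    (* Both partial sums are compared with [apot n x] on one torus, large enough for neither walk to
       wrap around it. *)
    set (n := (S (Z.to_nat (l1 x) + S p + S q))).
    assert (0 <= l1 x)%Z by (unfold l1; lia).
    pose proof (apot_partial_le n (S p) x ltac:(unfold n; lia)) as H1.
    pose proof (apot_partial_le n (S q) x ltac:(unfold n; lia)) as H2.
    fold (partial_pot (S p) x). fold (partial_pot (S q) x).
    pose proof (HK (S p) ltac:(lia)) as H3. pose proof (HK (S q) ltac:(lia)) as H4.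
    apply Rabs_le_inv in H1, H2.
    set (d := eps / (8 * sqn x + 1)) in *.
    assert (Hd : d * (8 * sqn x + 1) = eps) by (unfold d; field; lra).
    apply Rle_lt_trans with (8 * sqn x * d); [|nra].
    apply Rabs_le. nra. }
  destruct (R_complete _ HC) as [l Hl]. exists l. exact Hl.
Qed.

Lemma partial_pot_cv x : Un_cv (fun K => partial_pot K x) (pot_kernel x).
Proof.
  intros eps He. destruct (pot_kernel_series x eps He) as [N HN].
  exists (S N). intros K HK. destruct K as [|K]; [lia|].
  specialize (HN K ltac:(lia)). now rewrite sum_f_R0_bsum in HN.
Qed.

(** The uniformity in [n] of [apot_partial_le] allows fixing [K] before letting [n] grow. *)
Lemma apot_cv x : Un_cv (fun n => apot n x) (pot_kernel x).
Proof.
  intros eps He. pose proof (sqn_nonneg x) as Hx.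
  destruct (return_probability_to_0 (eps / 2 / (4 * sqn x + 1))) as [K0 HK].
  { apply Rdiv_lt_0_compat; lra. }
  destruct (partial_pot_cv x (eps / 2) ltac:(lra)) as [K1 HK1].
  set (K := max K0 K1). exists (S (Z.to_nat (l1 x) + K))%nat. intros n Hn.
  assert (0 <= l1 x)%Z by (unfold l1; lia).
  pose proof (apot_partial_le n K x ltac:(lia)) as H1.
  specialize (HK K ltac:(unfold K; lia)). specialize (HK1 K ltac:(unfold K; lia)).
  unfold Rdist in *. apply Rabs_le_inv in H1. apply Rabs_def2 in HK1.
  set (d := eps / 2 / (4 * sqn x + 1)) in *.
  assert (Hd : d * (4 * sqn x + 1) = eps / 2) by (unfold d; field; lra).
  apply Rabs_def1; nra.
Qed.

Lemma apot_neg n x : apot n (psub orig x) = apot n x.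
Proof.
  unfold apot, green. do 2 f_equal. apply bsum2_ext. intros. f_equal.
  unfold psub; cbn [fst snd]. rewrite !Z.sub_0_l. apply char_opp.
Qed.

Lemma pot_kernel_neg x : pot_kernel (psub orig x) = pot_kernel x.
Proof.
  apply (UL_sequence (fun n => apot n x)); [|apply apot_cv].
  intros eps He. destruct (apot_cv (psub orig x) eps He) as [N HN].
  exists N. intros n Hn. rewrite <- apot_neg. auto.
Qed.

Definition pswap (x : pt) : pt := (snd x, fst x).

Lemma srw_p_swap k x : srw_p k (pswap x) orig = srw_p k x orig.
Proof.
  revert x. induction k as [|k IH]; intros x.
  - simpl. unfold pt_eqb, pswap. simpl. now rewrite Bool.andb_comm.
  - rewrite !srw_p_S, !Pop_eq. unfold pswap in *. cbn [fst snd].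
    rewrite <- (IH (fst x, _)), <- (IH (fst x, _)), <- (IH (_, snd x)), <- (IH (_, snd x)).
    cbn [fst snd]. field.
Qed.

Lemma pot_kernel_swap x : pot_kernel (pswap x) = pot_kernel x.
Proof.
  apply (UL_sequence (fun K => partial_pot K x)); [|apply partial_pot_cv].
  intros eps He. destruct (partial_pot_cv (pswap x) eps He) as [N HN].
  exists N. intros K HK. specialize (HN K HK).
  replace (partial_pot K x) with (partial_pot K (pswap x)); auto.
  apply bsum_ext. intros. now rewrite srw_p_swap.
Qed.

Lemma apot_orig n : apot n orig = 0.
Proof. unfold apot. ring. Qed.

Lemma pot_kernel_orig : pot_kernel orig = 0.
Proof.
  apply (UL_sequence (fun n => apot n orig)); [apply apot_cv|].
  intros eps He. exists 0%nat. intros n _. rewrite apot_orig.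
  unfold Rdist. rewrite Rminus_0_r, Rabs_R0. auto.
Qed.

Lemma apot_nonneg n x : 0 <= apot n x.
Proof.
  rewrite apot_eq. destruct n as [|n]; [unfold bsum2; simpl; lra|].
  apply Rmult_le_pos; [left; apply inv_INR_sq_pos; lia|].
  apply bsum2_nonneg. intros. apply inv_dd_char_bound; auto.
Qed.

Lemma apot_equation n x :
  (0 < n)%nat -> Pop (apot n) x - apot n x = (if at_origin n x then 1 else 0) - / INR n ^ 2.
Proof.
  intros Hn. rewrite <- green_equation by auto. unfold apot.
  rewrite Pop_minus, Pop_const. ring.
Qed.

Lemma CV_Pop (f : nat -> pt -> R) (g : pt -> R) x :
  (forall y, Un_cv (fun n => f n y) (g y)) -> Un_cv (fun n => Pop (f n) x) (Pop g x).
Proof.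
  intros H eps He.
  destruct (H ((fst x + 1)%Z, snd x) eps He) as [N1 H1].
  destruct (H ((fst x - 1)%Z, snd x) eps He) as [N2 H2].
  destruct (H (fst x, (snd x + 1)%Z) eps He) as [N3 H3].
  destruct (H (fst x, (snd x - 1)%Z) eps He) as [N4 H4].
  exists (N1 + N2 + N3 + N4)%nat. intros n Hn.
  specialize (H1 n ltac:(lia)). specialize (H2 n ltac:(lia)).
  specialize (H3 n ltac:(lia)). specialize (H4 n ltac:(lia)).
  rewrite !Pop_eq. unfold Rdist in *.
  apply Rabs_def2 in H1, H2, H3, H4. apply Rabs_def1; lra.
Qed.

(** Limit of the torus equation, whose uniform background charge [/ INR n ^ 2] disappears. *)
Lemma pot_kernel_equation x :
  Pop pot_kernel x - pot_kernel x = if pt_eqb x orig then 1 else 0.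
Proof.
  apply (UL_sequence (fun n => Pop (apot n) x - apot n x)).
  - apply CV_minus; [apply CV_Pop|]; intros; apply apot_cv.
  - intros eps He. destruct (INR_archimed 1 (/ eps) ltac:(lra)) as [N HN].
    exists (S (N + Z.to_nat (l1 x))). intros n Hn.
    assert (0 <= l1 x)%Z by (unfold l1; lia).
    rewrite apot_equation, at_origin_small by lia. unfold Rdist.
    replace (_ - _ - _) with (- / INR n ^ 2) by ring.
    assert (Hn1 : 1 <= INR n) by (apply (le_INR 1); lia).
    assert (HNn : INR N <= INR n) by (apply le_INR; lia).
    rewrite Rabs_Ropp, Rabs_pos_eq by (left; apply inv_INR_sq_pos; lia).
    rewrite <- (Rinv_inv eps). apply Rinv_lt_contravar.
    + apply Rmult_lt_0_compat; [now apply Rinv_0_lt_compat|nra].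
    + nra.
Qed.

(** * Increments of the potential kernel at infinity *)

Definition indicator_lt (x y : R) : R := if Rlt_dec x y then 1 else 0.

Lemma count_lt n x : 0 <= x -> bsum n (fun i => indicator_lt (INR i) x) <= x + 1.
Proof.
  intros Hx.
  enough (bsum n (fun i => indicator_lt (INR i) x) <= x + 1
          /\ bsum n (fun i => indicator_lt (INR i) x) <= INR n) by tauto.
  induction n as [|n IH]; [simpl; lra|]. rewrite S_INR. cbn [bsum].
  unfold indicator_lt at 2 4. destruct (Rlt_dec (INR n) x); lra.
Qed.

Lemma count_lt_rev n x : 0 <= x -> bsum n (fun i => indicator_lt (INR (n - i)) x) <= x + 1.
Proof.
  intros Hx. rewrite bsum_rev.
  eapply Rle_trans; [|apply (count_lt (S n) x Hx)].
  rewrite bsum_S_l. rewrite (bsum_ext n _ (fun i => indicator_lt (INR (S i)) x)).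
  - unfold indicator_lt at 2. destruct (Rlt_dec _ _); lra.
  - intros i Hi. replace (n - (n - 1 - i))%nat with (S i) by lia. reflexivity.
Qed.

Lemma indicator_nonneg x y : 0 <= indicator_lt x y.
Proof. unfold indicator_lt. destruct (Rlt_dec x y); lra. Qed.

Lemma char_gradient n i j x :
  (i < n)%nat ->
  Rabs (char n i j ((fst x + 1)%Z, snd x) - char n i j x) <= 2 * sn n i.
Proof.
  intros Hi. unfold char. cbn [fst snd]. rewrite ang_plus.
  set (a := ang n i (fst x) + ang n j (snd x)).
  replace (ang n i (fst x) + ang n i 1 + ang n j (snd x)) with (a + ang n i 1)
    by (unfold a; ring).
  rewrite form2, ang_half.
  replace ((a + 2 * (PI * INR i / INR n) - a) / 2) with (PI * INR i / INR n) by lra.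
  fold (sn n i). rewrite !Rabs_mult, (Rabs_left (-2)), (Rabs_pos_eq (sn n i))
    by (try apply sn_nonneg; auto; lra).
  pose proof (sn_nonneg n i Hi).
  assert (Rabs (sin ((a + 2 * (PI * INR i / INR n) + a) / 2)) <= 1) by apply Rabs_le, SIN_bound.
  nra.
Qed.

(* Low frequencies are few, and on the others [s / d <= 1 / s <= 1 / delta]. *)
Lemma gradient_sum n K delta :
  (K < n)%nat -> 0 < delta ->
  / INR n ^ 2 * bsum2 n (fun i j => Rabs (phi n i j) ^ K * (2 * sn n i * / dd n i j))
  <= 8 * delta + 8 * / INR n + 2 / delta * srw_p (even_part K) orig orig.
Proof.
  intros HK Hd. set (N := INR n). assert (HN : 1 <= N) by (apply (le_INR 1); lia).
  (* A low row costs at most [2 s] times the row sum [2 n / s], that is [4 n]; the indicators mark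
     the low rows at both ends of the range. *)
  set (c := fun i => 4 * N * (indicator_lt (INR i) (delta * N) + indicator_lt (INR (n - i)) (delta * N))).
  assert (H : bsum2 n (fun i j => Rabs (phi n i j) ^ K * (2 * sn n i * / dd n i j))
     <= bsum n (fun i => c i + 2 / delta * bsum n (fun j => Rabs (phi n i j) ^ K))).
  { unfold bsum2. apply bsum_le. intros i Hi.
    assert (HR : 0 <= bsum n (fun j => Rabs (phi n i j) ^ K))
      by (apply bsum_nonneg; intros; apply pow_le, Rabs_pos).
    assert (Hd2 : 0 < 2 / delta) by (apply Rdiv_lt_0_compat; lra).
    assert (Hc0 : 0 <= c i).
    { unfold c. pose proof (indicator_nonneg (INR i) (delta * N)).
      pose proof (indicator_nonneg (INR (n - i)) (delta * N)). nra. }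
    destruct (Nat.eq_dec i 0) as [->|Hi0].
    { rewrite bsum_zero; [nra|]. intros. rewrite sn_0. ring. }
    assert (Hs : 0 < sn n i) by (apply sn_pos; lia).
    destruct (Rlt_dec (sn n i) delta) as [Hlow|Hhigh].
    - apply Rle_trans with (4 * N).
      + apply Rle_trans with (bsum n (fun j => 2 * sn n i * / dd n i j)).
        * apply bsum_le. intros j Hj. rewrite <- (Rmult_1_l (2 * sn n i * / dd n i j)) at 2.
          apply Rmult_le_compat_r.
          -- apply Rmult_le_pos; [lra|apply inv_dd_nonneg].
          -- rewrite <- (pow1 K). apply pow_incr. split; [apply Rabs_pos|apply phi_abs_le_1].
        * rewrite bsum_scal. destruct (row_sum_bounds n i) as [_ Hu]; [lia|]. fold N in Hu.
          apply Rle_trans with (2 * sn n i * (2 * N / sn n i)); [apply Rmult_le_compat_l; lra|].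
          right. field. lra.
      + assert (1 <= indicator_lt (INR i) (delta * N) + indicator_lt (INR (n - i)) (delta * N)).
        { pose proof (indicator_nonneg (INR i) (delta * N)).
          pose proof (indicator_nonneg (INR (n - i)) (delta * N)).
          assert (Hx : forall k, INR k / N <= sn n i -> indicator_lt (INR k) (delta * N) = 1).
          { intros k Hk. unfold indicator_lt. destruct (Rlt_dec (INR k) (delta * N)) as [|Hx]; auto.
            exfalso. apply Hx. assert (INR k / N * N = INR k) by (field; lra). nra. }
          destruct (le_lt_dec (2 * i) n).
          - rewrite (Hx i); [lra|]. apply sn_ge; lia.
          - rewrite (Hx (n - i)%nat); [lra|]. rewrite <- sn_sym by lia. apply sn_ge; lia. }
        unfold c. nra.
    - apply Rle_trans with (2 / delta * bsum n (fun j => Rabs (phi n i j) ^ K)); [|lra].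
      rewrite <- bsum_scal. apply bsum_le. intros j Hj. rewrite Rmult_comm.
      apply Rmult_le_compat_r; [apply pow_le, Rabs_pos|].
      apply Rle_trans with (2 / sn n i).
      + unfold Rdiv. rewrite Rmult_assoc. apply Rmult_le_compat_l; [lra|].
        apply Rmult_le_reg_l with (/ sn n i); [now apply Rinv_0_lt_compat|].
        rewrite <- Rmult_assoc, Rinv_l, Rmult_1_l by lra.
        rewrite <- Rinv_mult. apply Rinv_le_contravar; [nra|].
        rewrite dd_sn. pose proof (pow2_ge_0 (sn n j)). nra.
      + unfold Rdiv. apply Rmult_le_compat_l; [lra|]. apply Rinv_le_contravar; lra. }
  assert (Hp : 0 < / N ^ 2) by (apply inv_INR_sq_pos; lia).
  apply Rle_trans with (/ N ^ 2 * bsum n (fun i => c i + 2 / delta * bsum n (fun j => Rabs (phi n i j) ^ K))).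
  { apply Rmult_le_compat_l; [lra|exact H]. }
  rewrite bsum_plus, bsum_scal. fold (bsum2 n (fun i j => Rabs (phi n i j) ^ K)).
  rewrite Rmult_plus_distr_l. apply Rplus_le_compat.
  - unfold c. rewrite bsum_scal, bsum_plus.
    assert (Hx : 0 <= delta * N) by nra.
    pose proof (count_lt n _ Hx). pose proof (count_lt_rev n _ Hx).
    apply Rle_trans with (/ N ^ 2 * (4 * N * (2 * (delta * N + 1)))).
    + apply Rmult_le_compat_l; [lra|]. apply Rmult_le_compat_l; lra.
    + right. field. lra.
  - pose proof (phi_pow_sum n K HK) as Hq. fold N in Hq.
    rewrite <- Rmult_assoc, (Rmult_comm (/ N ^ 2)), Rmult_assoc.
    apply Rmult_le_compat_l; [left; apply Rdiv_lt_0_compat; lra|exact Hq].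
Qed.

(** Limits are taken along the integer norm [l1], which suits [lia]; [far_lim_lim_at_infinity]
    returns to the Euclidean norm. *)
Definition far_lim (f : pt -> R) (c : R) : Prop :=
  forall eps, 0 < eps -> exists M, forall x, (M < l1 x)%Z -> Rabs (f x - c) < eps.

Lemma far_lim_ext f g c : (forall x, f x = g x) -> far_lim f c -> far_lim g c.
Proof.
  intros E H eps He. destruct (H eps He) as [M HM]. exists M. intros x Hx. rewrite <- E. auto.
Qed.

Lemma far_lim_const c : far_lim (fun _ => c) c.
Proof. intros eps He. exists 0%Z. intros. rewrite Rminus_diag, Rabs_R0. auto. Qed.

Lemma far_lim_plus f g c d : far_lim f c -> far_lim g d -> far_lim (fun x => f x + g x) (c + d).
Proof.
  intros Hf Hg eps He. destruct (Hf (eps / 2) ltac:(lra)) as [M HM].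
  destruct (Hg (eps / 2) ltac:(lra)) as [M' HM']. exists (Z.max M M'). intros x Hx.
  specialize (HM x ltac:(lia)). specialize (HM' x ltac:(lia)).
  apply Rabs_def2 in HM, HM'. apply Rabs_def1; lra.
Qed.

Lemma far_lim_scal f c k : far_lim f c -> far_lim (fun x => k * f x) (k * c).
Proof.
  intros H eps He. pose proof (Rabs_pos k).
  destruct (H (eps / (Rabs k + 1))) as [M HM]; [apply Rdiv_lt_0_compat; lra|].
  exists M. intros x Hx. specialize (HM x Hx).
  rewrite <- Rmult_minus_distr_l, Rabs_mult.
  pose proof (Rabs_pos (f x - c)).
  assert (E : eps / (Rabs k + 1) * (Rabs k + 1) = eps) by (field; lra). nra.
Qed.

Lemma far_lim_shift f c z : far_lim f c -> far_lim (fun x => f (psub x z)) c.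
Proof.
  intros H eps He. destruct (H eps He) as [M HM]. exists (M + l1 z)%Z. intros x Hx.
  apply HM. unfold l1, psub in *. cbn [fst snd]. lia.
Qed.

Lemma far_lim_pswap f c : far_lim f c -> far_lim (fun x => f (pswap x)) c.
Proof.
  intros H eps He. destruct (H eps He) as [M HM]. exists M. intros x Hx.
  apply HM. unfold l1, pswap in *. cbn [fst snd]. lia.
Qed.

(** Far from the origin neither point can reach it in fewer than [K] steps, so the partial sums
    coincide and only tails differ. These are bounded by [gradient_sum]: [delta] is chosen first,
    then [K] to make the return probability small against [delta], and last the torus size. *)
Lemma pot_kernel_gradient_1 :
  far_lim (fun x => pot_kernel ((fst x + 1)%Z, snd x) - pot_kernel x) 0.
Proof.
  intros eps He. set (delta := eps / 64). assert (Hd : 0 < delta) by (unfold delta; lra).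
  destruct (return_probability_to_0 (eps / 8 * delta)) as [K HK]; [nra|].
  specialize (HK K (le_n K)).
  exists (Z.of_nat K + 1)%Z. intros x Hx. set (y := ((fst x + 1)%Z, snd x)).
  assert (Hy : (l1 x - 1 <= l1 y <= l1 x + 1)%Z) by (unfold y, l1; cbn [fst snd]; lia).
  rewrite Rminus_0_r.
  destruct (apot_cv x (eps / 8) ltac:(lra)) as [N1 H1].
  destruct (apot_cv y (eps / 8) ltac:(lra)) as [N2 H2].
  destruct (INR_archimed 1 (64 / eps) ltac:(lra)) as [N3 H3].
  set (n := S (N1 + N2 + N3 + K + Z.to_nat (l1 x) + 1)).
  specialize (H1 n ltac:(unfold n; lia)). specialize (H2 n ltac:(unfold n; lia)).
  assert (E : apot n y - apot n x = - (/ INR n ^ 2 *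
     bsum2 n (fun i j => phi n i j ^ K * (/ dd n i j * (char n i j y - char n i j x))))).
  { assert (Hfar : partial_pot K y = partial_pot K x).
    { apply bsum_ext. intros k Hk. rewrite (srw_p_far k y), (srw_p_far k x) by lia. ring. }
    replace (apot n y - apot n x) with ((apot n y - partial_pot K y) - (apot n x - partial_pot K x))
      by (rewrite Hfar; ring).
    rewrite !apot_partial by (unfold n; lia).
    rewrite <- Rmult_minus_distr_l, <- bsum2_minus, Ropp_mult_distr_r.
    f_equal. rewrite <- (Rmult_1_l (bsum2 _ _)) at 1.
    replace 1 with (-1 * -1) at 1 by ring. rewrite Rmult_assoc, <- (bsum2_scal n (-1)).
    replace (- bsum2 n _) with (-1 * bsum2 n (fun i j =>
      phi n i j ^ K * (/ dd n i j * (char n i j y - char n i j x)))) by ring.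
    f_equal. apply bsum2_ext. intros. ring. }
  assert (HG : Rabs (apot n y - apot n x) <= 8 * delta + 8 * / INR n
                + 2 / delta * srw_p (even_part K) orig orig).
  { eapply Rle_trans; [|apply (gradient_sum n K delta); auto; unfold n; lia].
    rewrite E, Rabs_Ropp, Rabs_mult, Rabs_pos_eq by (left; apply inv_INR_sq_pos; unfold n; lia).
    apply Rmult_le_compat_l; [left; apply inv_INR_sq_pos; unfold n; lia|].
    eapply Rle_trans; [apply bsum2_abs|]. apply bsum2_le. intros i j Hi Hj.
    rewrite !Rabs_mult, <- RPow_abs.
    apply Rmult_le_compat_l; [apply pow_le, Rabs_pos|].
    rewrite Rabs_pos_eq, Rmult_comm by apply inv_dd_nonneg.
    apply Rmult_le_compat_r; [apply inv_dd_nonneg|]. now apply char_gradient. }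
  assert (Hn : / INR n <= eps / 64).
  { replace (eps / 64) with (/ (64 / eps)) by (field; lra).
    apply Rinv_le_contravar; [apply Rdiv_lt_0_compat; lra|].
    assert (INR N3 <= INR n) by (apply le_INR; unfold n; lia). lra. }
  assert (Hp : 2 / delta * srw_p (even_part K) orig orig <= eps / 4).
  { apply Rle_trans with (2 / delta * (eps / 8 * delta)).
    - apply Rmult_le_compat_l; [left; apply Rdiv_lt_0_compat; lra|lra].
    - right; field; lra. }
  unfold Rdist in H1, H2. unfold delta in HG at 1. apply Rabs_le_inv in HG.
  apply Rabs_def2 in H1, H2. apply Rabs_def1; lra.
Qed.

Definition pot_flat (z : pt) : Prop :=
  far_lim (fun x => pot_kernel (psub x z) - pot_kernel x) 0.

Lemma pot_flat_add z w : pot_flat z -> pot_flat w -> pot_flat (fst z + fst w, snd z + snd w)%Z.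
Proof.
  intros Hz Hw. unfold pot_flat.
  pose proof (far_lim_plus _ _ _ _ (far_lim_shift _ _ w Hz) Hw) as H.
  rewrite Rplus_0_r in H. eapply far_lim_ext; [|exact H]. intros x. cbn beta.
  replace (psub (psub x w) z) with (psub x (fst z + fst w, snd z + snd w)%Z); [ring|].
  unfold psub; cbn [fst snd]. f_equal; ring.
Qed.

Lemma pot_flat_opp z : pot_flat z -> pot_flat (psub orig z).
Proof.
  intros Hz. pose proof (far_lim_scal _ _ (-1) (far_lim_shift _ _ (psub orig z) Hz)) as H.
  rewrite Rmult_0_r in H. eapply far_lim_ext; [|exact H]. intros x. cbn beta.
  replace (psub (psub x (psub orig z)) z) with x; [ring|].
  unfold psub; destruct x, z; cbn [fst snd]. f_equal; ring.
Qed.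

Lemma pot_flat_orig : pot_flat orig.
Proof.
  eapply far_lim_ext; [|apply (far_lim_const 0)]. intros [x y]. unfold psub; cbn [fst snd].
  rewrite !Z.sub_0_r. ring.
Qed.

Lemma pot_flat_multiple z k : pot_flat z -> pot_flat (k * fst z, k * snd z)%Z.
Proof.
  intros H.
  assert (HN : forall n : nat, pot_flat (Z.of_nat n * fst z, Z.of_nat n * snd z)%Z).
  { induction n as [|n IH]; [apply pot_flat_orig|].
    pose proof (pot_flat_add _ _ H IH) as Ha. cbn [fst snd] in Ha.
    rewrite Nat2Z.inj_succ, !Z.mul_succ_l, !(Z.add_comm (_ * _)). exact Ha. }
  destruct (Z.le_gt_cases 0 k).
  - specialize (HN (Z.to_nat k)). now rewrite Z2Nat.id in HN.
  - specialize (HN (Z.to_nat (- k))). rewrite Z2Nat.id in HN by lia.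
    apply pot_flat_opp in HN. unfold psub in HN. cbn [fst snd] in HN.
    replace (k * fst z)%Z with (0 - - k * fst z)%Z by ring.
    replace (k * snd z)%Z with (0 - - k * snd z)%Z by ring. exact HN.
Qed.

(** The flat shifts form a subgroup of the lattice, containing one unit vector by the gradient
    estimate and the other by the symmetry of the kernel under [pswap]. *)
Lemma pot_kernel_flat z : pot_flat z.
Proof.
  assert (H1 : pot_flat (-1, 0)%Z).
  { eapply far_lim_ext; [|apply pot_kernel_gradient_1]. intros [x y].
    unfold psub; cbn [fst snd]. now rewrite Z.sub_0_r. }
  assert (H2 : pot_flat (0, -1)%Z).
  { eapply far_lim_ext; [|apply (far_lim_pswap _ _ H1)]. intros [x y]. cbn beta.
    rewrite <- (pot_kernel_swap (psub (x, y) _)), <- (pot_kernel_swap (x, y)). reflexivity. }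
  pose proof (pot_flat_add _ _ (pot_flat_multiple _ (- fst z) H1) (pot_flat_multiple _ (- snd z) H2)) as H.
  cbn [fst snd] in H. destruct z as [a b]; cbn [fst snd] in H.
  replace (- a * -1 + - b * 0)%Z with a in H by ring.
  replace (- a * 0 + - b * -1)%Z with b in H by ring. exact H.
Qed.

(** * Recurrence and harmonic measure *)

(* [P_y[tau_1(A) > k]] in the plane: [A] is tested from time [1] on. *)
Fixpoint surv (A : list pt) (k : nat) (y : pt) : R :=
  match k with
  | O => 1
  | S k' => Pop (fun z => if memb A z then 0 else surv A k' z) y
  end.

(* Off the origin this is [63 (2 |x|^2 - 1)]; the factor [63] balances the value [1] at the
   origin, with equality at its neighbours in [lyap_int_superharmonic]. *)
Definition lyap_int (x : pt) : Z :=
  if pt_eqb x orig then 1%Z else (126 * (fst x * fst x + snd x * snd x) - 63)%Z.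

(** The logarithm of an integer function turns superharmonicity into an inequality between products
    of integers. *)
Definition lyap (x : pt) : R := ln (IZR (lyap_int x)).

Lemma pt_eqb_neq x y : pt_eqb x y = false <-> x <> y.
Proof.
  rewrite <- pt_eqb_spec. destruct (pt_eqb x y); split; congruence.
Qed.

Lemma lyap_int_pos x : (1 <= lyap_int x)%Z.
Proof.
  unfold lyap_int. destruct (pt_eqb x orig) eqn:E; [lia|].
  apply pt_eqb_neq in E. destruct x as [a b]. cbn [fst snd].
  assert (a <> 0 \/ b <> 0)%Z by (destruct (Z.eq_dec a 0), (Z.eq_dec b 0); subst; auto).
  nia.
Qed.

Lemma lyap_nonneg x : 0 <= lyap x.
Proof.
  unfold lyap. rewrite <- ln_1. pose proof (IZR_le _ _ (lyap_int_pos x)) as [H|H].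
  - left. apply ln_increasing; lra.
  - rewrite <- H. lra.
Qed.

(* With [s = 2 |x|^2 - 1], the product over the four neighbours of [2 |y|^2 - 1]
   is [s^4 - 64 (a^2 - b^2)^2]. *)
Lemma lyap_int_superharmonic x :
  x <> orig ->
  (lyap_int (fst x + 1, snd x) * lyap_int (fst x - 1, snd x)
   * lyap_int (fst x, snd x + 1) * lyap_int (fst x, snd x - 1) <= lyap_int x ^ 4)%Z.
Proof.
  intros Hx. destruct x as [a b]. cbn [fst snd]. unfold lyap_int.
  destruct (pt_eqb (a + 1, b)%Z orig) eqn:E1;
    [apply pt_eqb_spec in E1; injection E1 as Ha Hb; replace a with (-1)%Z by lia;
     subst b; vm_compute; congruence|].
  destruct (pt_eqb (a - 1, b)%Z orig) eqn:E2;
    [apply pt_eqb_spec in E2; injection E2 as Ha Hb; replace a with 1%Z by lia;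
     subst b; vm_compute; congruence|].
  destruct (pt_eqb (a, b + 1)%Z orig) eqn:E3;
    [apply pt_eqb_spec in E3; injection E3 as Ha Hb; replace b with (-1)%Z by lia;
     subst a; vm_compute; congruence|].
  destruct (pt_eqb (a, b - 1)%Z orig) eqn:E4;
    [apply pt_eqb_spec in E4; injection E4 as Ha Hb; replace b with 1%Z by lia;
     subst a; vm_compute; congruence|].
  apply pt_eqb_neq in Hx. rewrite Hx. cbn [fst snd].
  assert (0 <= 64 * 63 ^ 4 * ((a * a - b * b) * (a * a - b * b)))%Z.
  { apply Z.mul_nonneg_nonneg; [lia|]. apply Z.square_nonneg. }
  lia.
Qed.

Lemma lyap_superharmonic x : x <> orig -> Pop lyap x <= lyap x.
Proof.
  intros Hx. pose proof (IZR_le _ _ (lyap_int_superharmonic x Hx)) as H.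
  assert (HP : forall y, 0 < IZR (lyap_int y)).
  { intros y. apply IZR_lt. pose proof (lyap_int_pos y). lia. }
  rewrite Pop_eq. unfold lyap.
  rewrite <- !ln_mult by (repeat apply Rmult_lt_0_compat; apply HP).
  apply Rmult_le_reg_r with 4; [lra|]. unfold Rdiv. rewrite Rmult_assoc, Rinv_l, Rmult_1_r by lra.
  replace (ln (IZR (lyap_int x)) * 4) with (ln (IZR (lyap_int x) ^ 4)).
  - rewrite <- !mult_IZR. rewrite pow_IZR.
    destruct H as [H|H]; [left; apply ln_increasing; auto|right; f_equal; exact H].
    rewrite !mult_IZR. repeat apply Rmult_lt_0_compat; apply HP.
  - rewrite ln_pow by apply HP. simpl. ring.
Qed.

Definition ball (M : nat) : list pt :=
  let r := map (fun k => (Z.of_nat k - Z.of_nat M)%Z) (seq 0 (2 * M + 1)) in list_prod r r.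

Lemma in_ball M x : ~ In x (ball M) -> (Z.of_nat M < Z.abs (fst x) \/ Z.of_nat M < Z.abs (snd x))%Z.
Proof.
  intros H.
  destruct (Z_lt_le_dec (Z.of_nat M) (Z.abs (fst x))); [tauto|].
  destruct (Z_lt_le_dec (Z.of_nat M) (Z.abs (snd x))); [tauto|].
  exfalso. apply H. destruct x as [a b]. cbn [fst snd] in *. unfold ball.
  apply in_prod; apply in_map_iff.
  - exists (Z.to_nat (a + Z.of_nat M)). rewrite in_seq. lia.
  - exists (Z.to_nat (b + Z.of_nat M)). rewrite in_seq. lia.
Qed.

Lemma lyap_large r : exists l, forall x, ~ In x l -> r <= lyap x.
Proof.
  destruct (INR_archimed 1 (exp r) ltac:(lra)) as [M HM].
  exists (ball M). intros x Hx. apply in_ball in Hx.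
  assert (HZ : (Z.of_nat M <= lyap_int x)%Z).
  { unfold lyap_int. destruct (pt_eqb x orig) eqn:E.
    - apply pt_eqb_spec in E. subst x. cbn [fst snd] in Hx. lia.
    - nia. }
  unfold lyap. apply IZR_le in HZ. rewrite <- INR_IZR_INZ in HZ.
  rewrite <- (ln_exp r). pose proof (exp_pos r).
  left. apply ln_increasing; lra.
Qed.

Lemma memb_In A x : memb A x = true <-> In x A.
Proof.
  unfold memb. rewrite existsb_exists. split.
  - intros [y [Hy E]]. apply pt_eqb_spec in E. now subst.
  - intros H. exists x. split; auto. now apply pt_eqb_spec.
Qed.

Lemma memb_not_In A x : memb A x = false <-> ~ In x A.
Proof. rewrite <- memb_In. destruct (memb A x); split; congruence. Qed.

Lemma sumR_nonneg {T} (f : T -> R) l : (forall x, In x l -> 0 <= f x) -> 0 <= sumR (map f l).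
Proof.
  induction l as [|x l IH]; intros H; simpl; [lra|].
  assert (0 <= f x) by (apply H; simpl; auto).
  assert (0 <= sumR (map f l)) by (apply IH; intros; apply H; simpl; auto).
  unfold sumR in *. lra.
Qed.

Lemma sumR_ge_term {T} (f : T -> R) l x :
  (forall y, In y l -> 0 <= f y) -> In x l -> f x <= sumR (map f l).
Proof.
  induction l as [|y l IH]; intros H Hx; [contradiction|].
  assert (H0 : 0 <= sumR (map f l)) by (apply sumR_nonneg; intros; apply H; simpl; auto).
  assert (H1 : 0 <= f y) by (apply H; simpl; auto).
  cbn [map]. unfold sumR in *. cbn [fold_right]. destruct Hx as [->|Hx]; [lra|].
  assert (f x <= fold_right Rplus 0 (map f l)) by (apply IH; auto; intros; apply H; simpl; auto).
  lra.
Qed.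

Lemma sumR_ext {T} (f g : T -> R) l :
  (forall x, In x l -> f x = g x) -> sumR (map f l) = sumR (map g l).
Proof.
  induction l as [|x l IH]; intros H; simpl; auto. rewrite H by (simpl; auto).
  f_equal. apply IH. intros; apply H; simpl; auto.
Qed.

Lemma sumR_le {T} (f g : T -> R) l :
  (forall x, In x l -> f x <= g x) -> sumR (map f l) <= sumR (map g l).
Proof.
  induction l as [|x l IH]; intros H; simpl; [lra|].
  apply Rplus_le_compat; [apply H; simpl; auto|]. apply IH. intros; apply H; simpl; auto.
Qed.

Lemma sumR_plus {T} (f g : T -> R) l :
  sumR (map (fun x => f x + g x) l) = sumR (map f l) + sumR (map g l).
Proof. induction l as [|x l IH]; simpl; [ring|]. unfold sumR in *. rewrite IH. ring. Qed.

Lemma sumR_scal {T} k (f : T -> R) l :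
  sumR (map (fun x => k * f x) l) = k * sumR (map f l).
Proof. induction l as [|x l IH]; simpl; [ring|]. unfold sumR in *. rewrite IH. ring. Qed.

Lemma sumR_const {T} c (l : list T) : sumR (map (fun _ => c) l) = INR (length l) * c.
Proof.
  induction l as [|x l IH]; [simpl; ring|]. cbn [map length]. rewrite S_INR.
  unfold sumR in *. cbn [fold_right]. rewrite IH. ring.
Qed.

Lemma Pop_sumR {T} (F : T -> pt -> R) l x :
  Pop (fun y => sumR (map (fun t => F t y) l)) x = sumR (map (fun t => Pop (F t) x) l).
Proof.
  induction l as [|t l IH]; [apply Pop_const|].
  cbn [map]. unfold sumR in *. cbn [fold_right]. now rewrite Pop_plus, IH.
Qed.

(** A walk that has survived to time [k] is either in [l] or at a point where [lyap >= r]. The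
    second event is bounded by Markov's inequality for the supermartingale [lyap], stopped at [A],
    which contains the only exceptional point. *)
Lemma surv_bound A r l k y :
  In orig A -> 0 < r -> (forall x, ~ In x l -> r <= lyap x) -> memb A y = false ->
  surv A k y <= lyap y / r + sumR (map (fun p => srw_p k y p) l).
Proof.
  intros HA Hr Hl. revert y. induction k as [|k IH]; intros y Hy.
  - simpl surv. assert (Hr' : 0 < / r) by now apply Rinv_0_lt_compat.
    pose proof (lyap_nonneg y) as Hly.
    destruct (memb l y) eqn:Hin.
    + apply memb_In in Hin.
      pose proof (sumR_ge_term (fun p => srw_p 0 y p) l y (fun p _ => srw_p_nonneg 0 y p) Hin) as H1.
      assert (E : srw_p 0 y y = 1).
      { simpl. replace (pt_eqb y y) with true by (symmetry; now apply pt_eqb_spec). reflexivity. }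
      cbv beta in H1. rewrite E in H1. apply Rle_trans with (0 + 1); [lra|]. apply Rplus_le_compat; auto.
      unfold Rdiv. apply Rmult_le_pos; lra.
    + pose proof (sumR_nonneg (fun p => srw_p 0 y p) l (fun p _ => srw_p_nonneg 0 y p)).
      apply memb_not_In in Hin. specialize (Hl y Hin). assert (1 <= lyap y / r).
      { apply Rmult_le_reg_r with r; auto. unfold Rdiv. rewrite Rmult_assoc, Rinv_l by lra. lra. }
      lra.
  - change (surv A (S k) y) with (Pop (fun z => if memb A z then 0 else surv A k z) y).
    apply Rle_trans with (Pop (fun z => / r * lyap z + sumR (map (fun p => srw_p k z p) l)) y).
    + apply Pop_le. intros z _. destruct (memb A z) eqn:E.
      * pose proof (sumR_nonneg (fun p => srw_p k z p) l (fun p _ => srw_p_nonneg k z p)).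
        pose proof (lyap_nonneg z). assert (0 < / r) by now apply Rinv_0_lt_compat. nra.
      * rewrite Rmult_comm. now apply IH.
    + rewrite Pop_plus, Pop_scal, Pop_sumR. unfold Rdiv. rewrite Rmult_comm.
      apply Rplus_le_compat_r. apply Rmult_le_compat_r; [left; now apply Rinv_0_lt_compat|].
      apply lyap_superharmonic. intros ->. apply memb_not_In in Hy. contradiction.
Qed.

(** Choosing [r] large makes the Lyapunov term small; this fixes the finite set [l], and each of its
    points has occupation probability tending to 0. *)
Lemma recurrence A y :
  In orig A -> memb A y = false ->
  forall eps, 0 < eps -> exists k, surv A k y < eps.
Proof.
  intros HA Hy eps He. pose proof (lyap_nonneg y).
  set (r := (lyap y + 1) * 2 / eps).
  assert (Hr : 0 < r) by (unfold r; apply Rdiv_lt_0_compat; lra).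
  destruct (lyap_large r) as [l Hl].
  set (n := INR (length l)). assert (Hn : 0 <= n) by apply pos_INR.
  destruct (return_probability_to_0 (eps / 2 / (n + 1))) as [K HK].
  { apply Rdiv_lt_0_compat; lra. }
  exists K. eapply Rle_lt_trans; [apply (surv_bound A r l K y); auto|].
  assert (H1 : lyap y / r < eps / 2).
  { unfold r. replace (lyap y / ((lyap y + 1) * 2 / eps)) with (eps / 2 * (lyap y / (lyap y + 1)))
      by (field; lra).
    rewrite <- (Rmult_1_r (eps / 2)) at 2. apply Rmult_lt_compat_l; [lra|].
    apply Rmult_lt_reg_r with (lyap y + 1); [lra|]. unfold Rdiv.
    rewrite Rmult_assoc, Rinv_l; lra. }
  assert (H2 : sumR (map (fun p => srw_p K y p) l) <= eps / 2).
  { apply Rle_trans with (sumR (map (fun _ => eps / 2 / (n + 1)) l)).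
    - apply sumR_le. intros p _. rewrite srw_p_translate.
      eapply Rle_trans; [apply srw_p_le_even|]. left. apply HK. lia.
    - rewrite sumR_const. fold n.
      replace (n * (eps / 2 / (n + 1))) with (eps / 2 * (n / (n + 1))) by (field; lra).
      rewrite <- (Rmult_1_r (eps / 2)) at 2. apply Rmult_le_compat_l; [lra|].
      apply Rmult_le_reg_r with (n + 1); [lra|]. unfold Rdiv. rewrite Rmult_assoc, Rinv_l; lra. }
  lra.
Qed.

Lemma surv_bounds A k y : 0 <= surv A k y <= 1.
Proof.
  revert y. induction k as [|k IH]; intros y; [simpl; lra|].
  change (surv A (S k) y) with (Pop (fun z => if memb A z then 0 else surv A k z) y).
  split.
  - rewrite <- (Pop_const 0 y) at 1. apply Pop_le. intros z _. destruct (memb A z); [lra|apply IH].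
  - rewrite <- (Pop_const 1 y). apply Pop_le. intros z _. destruct (memb A z); [lra|apply IH].
Qed.

Lemma surv_decreasing A k y : surv A (S k) y <= surv A k y.
Proof.
  revert y. induction k as [|k IH]; intros y; [apply surv_bounds|].
  change (surv A (S (S k)) y) with (Pop (fun z => if memb A z then 0 else surv A (S k) z) y).
  change (surv A (S k) y) with (Pop (fun z => if memb A z then 0 else surv A k z) y).
  apply Pop_le. intros z _. destruct (memb A z); [lra|apply IH].
Qed.

Lemma recurrence_eventually A y :
  In orig A -> memb A y = false ->
  forall eps, 0 < eps -> exists K, forall k, (K <= k)%nat -> surv A k y < eps.
Proof.
  intros HA Hy eps He. destruct (recurrence A y HA Hy eps He) as [K HK].
  exists K. intros k Hk. eapply Rle_lt_trans; [|exact HK].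
  induction Hk; [lra|]. pose proof (surv_decreasing A m y). lra.
Qed.

(* [E_y[f(S_tau); tau <= k]] for [tau = tau_1(A)]. *)
Fixpoint hit_exp (A : list pt) (f : pt -> R) (k : nat) (y : pt) : R :=
  match k with
  | O => 0
  | S k' => Pop (fun z => if memb A z then f z else hit_exp A f k' z) y
  end.

Definition harmonic_off (A : list pt) (w : pt -> R) : Prop :=
  forall y, memb A y = false -> Pop w y = w y.

(** The stopped expectation reproduces a harmonic [w] except on the event of survival, where the
    discrepancy is at most the bound [B]. *)
Lemma optional_stopping A w B k y :
  harmonic_off A w -> (forall x, Rabs (w x) <= B) -> memb A y = false ->
  Rabs (hit_exp A w k y - w y) <= B * surv A k y.
Proof.
  intros Hw HB. revert y. induction k as [|k IH]; intros y Hy.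
  - simpl. replace (0 - w y) with (- w y) by ring. rewrite Rabs_Ropp. specialize (HB y). lra.
  - rewrite <- (Hw y Hy). change (hit_exp A w (S k) y) with
      (Pop (fun z => if memb A z then w z else hit_exp A w k z) y).
    change (surv A (S k) y) with (Pop (fun z => if memb A z then 0 else surv A k z) y).
    rewrite <- Pop_minus, <- Pop_scal. eapply Rle_trans; [apply Pop_abs|].
    apply Pop_le. intros z _. destruct (memb A z) eqn:E.
    + rewrite Rminus_diag, Rabs_R0. lra.
    + now apply IH.
Qed.

Definition harmonic_limit (A : list pt) (w : pt -> R) (c : R) : Prop :=
  harmonic_off A w /\ far_lim w c.

Lemma far_lim_bounded f c : far_lim f c -> exists B, forall x, Rabs (f x) <= B.
Proof.
  intros H. destruct (H 1 ltac:(lra)) as [M HM].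
  exists (Rabs c + 1 + sumR (map (fun x => Rabs (f x)) (ball (Z.to_nat M)))). intros x.
  pose proof (Rabs_pos c).
  pose proof (sumR_nonneg (fun x => Rabs (f x)) (ball (Z.to_nat M)) (fun x _ => Rabs_pos _)).
  destruct (memb (ball (Z.to_nat M)) x) eqn:E.
  - apply memb_In in E.
    pose proof (sumR_ge_term (fun x => Rabs (f x)) _ x (fun x _ => Rabs_pos _) E) as H2.
    cbv beta in H2. lra.
  - apply memb_not_In, in_ball in E. specialize (HM x ltac:(unfold l1; lia)).
    pose proof (Rabs_triang (f x - c) c) as H2.
    replace (f x - c + c) with (f x) in H2 by ring. lra.
Qed.

Lemma hit_exp_cv A w c y :
  In orig A -> harmonic_limit A w c -> memb A y = false ->
  Un_cv (fun k => hit_exp A w k y) (w y).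
Proof.
  intros HA [Hw Hc] Hy eps He. destruct (far_lim_bounded _ _ Hc) as [B HB].
  assert (HB0 : 0 <= B) by (pose proof (HB orig); pose proof (Rabs_pos (w orig)); lra).
  destruct (recurrence_eventually A y HA Hy (eps / (B + 1))) as [K HK].
  { apply Rdiv_lt_0_compat; lra. }
  exists K. intros k Hk. specialize (HK k ltac:(lia)). unfold Rdist.
  eapply Rle_lt_trans; [apply (optional_stopping A w B); auto|].
  assert (E : eps / (B + 1) * (B + 1) = eps) by (field; lra).
  pose proof (surv_bounds A k y). nra.
Qed.

Lemma hit_exp_ext A f g k y :
  (forall x, In x A -> f x = g x) -> hit_exp A f k y = hit_exp A g k y.
Proof.
  intros H. revert y. induction k as [|k IH]; intros y; simpl; auto.
  apply Pop_ext. intros z. destruct (memb A z) eqn:E; auto. apply H. now apply memb_In.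
Qed.

Lemma hit_exp_zero A k y : hit_exp A (fun _ => 0) k y = 0.
Proof.
  revert y. induction k as [|k IH]; intros y; simpl; auto.
  transitivity (Pop (fun _ => 0) y); [|apply Pop_const].
  apply Pop_ext. intros z. destruct (memb A z); auto.
Qed.

(** By recurrence [w] is the limit of the expectations of its values at the hitting point, all of
    which are 0. *)
Lemma harmonic_limit_unique A w c :
  In orig A -> harmonic_limit A w c -> (forall x, In x A -> w x = 0) -> forall y, w y = 0.
Proof.
  intros HA Hw H0 y. destruct (memb A y) eqn:E; [now apply H0, memb_In|].
  apply (UL_sequence (fun k => hit_exp A w k y)); [now apply (hit_exp_cv A w c)|].
  intros eps He. exists 0%nat. intros k _.
  rewrite (hit_exp_ext A w (fun _ => 0)), hit_exp_zero by auto.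
  unfold Rdist. rewrite Rminus_diag, Rabs_R0. auto.
Qed.

Lemma harmonic_limit_combine A v w c d k :
  harmonic_limit A v c -> harmonic_limit A w d ->
  harmonic_limit A (fun x => v x + k * w x) (c + k * d).
Proof.
  intros [H1 H2] [H3 H4]. split.
  - intros y Hy. rewrite Pop_plus, Pop_scal, H1, H3; auto.
  - apply far_lim_plus; auto. now apply far_lim_scal.
Qed.

Lemma harmonic_limit_incl A A' w c :
  (forall x, In x A -> In x A') -> harmonic_limit A w c -> harmonic_limit A' w c.
Proof.
  intros H [H1 H2]. split; auto. intros y Hy. apply H1.
  apply memb_not_In. apply memb_not_In in Hy. auto.
Qed.

Lemma Pop_pot_shift z x :
  Pop (fun y => pot_kernel (psub y z)) x - pot_kernel (psub x z) = if pt_eqb x z then 1 else 0.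
Proof.
  rewrite Pop_shift, pot_kernel_equation.
  replace (pt_eqb (psub x z) orig) with (pt_eqb x z); auto.
  apply Bool.eq_true_iff_eq. rewrite !pt_eqb_spec. unfold psub. destruct x, z; cbn [fst snd].
  split; intros [= ? ?]; f_equal; lia.
Qed.

Lemma pot_difference_harmonic A z :
  In orig A -> In z A -> harmonic_limit A (fun y => pot_kernel (psub y z) - pot_kernel y) 0.
Proof.
  intros HA Hz. split; [|apply pot_kernel_flat].
  intros y Hy. apply memb_not_In in Hy. rewrite Pop_minus.
  pose proof (Pop_pot_shift z y) as H1. pose proof (pot_kernel_equation y) as H2.
  replace (pt_eqb y z) with false in H1 by (symmetry; apply pt_eqb_neq; intros ->; contradiction).
  replace (pt_eqb y orig) with false in H2 by (symmetry; apply pt_eqb_neq; intros ->; contradiction).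
  lra.
Qed.

(* One point [x0] at a time: the charge at [x0] of [psi] is [1], so [psi] cannot
   vanish at [x0], and a multiple of it adjusts the value there. *)
Lemma harmonic_extension l f :
  exists w c, harmonic_limit (orig :: l) w c /\ forall x, In x (orig :: l) -> w x = f x.
Proof.
  revert f. induction l as [|x0 l IH]; intros f.
  - exists (fun _ => f orig), (f orig). split.
    + split; [intros y _; apply Pop_const|apply far_lim_const].
    + intros x [<-|[]]. reflexivity.
  - set (A := orig :: x0 :: l).
    assert (HI : forall x, In x (orig :: l) -> In x A) by (unfold A; simpl; tauto).
    destruct (IH f) as (w & c & Hw & Hf).
    destruct (memb (orig :: l) x0) eqn:Ex0.
    { exists w, c. split; [exact (harmonic_limit_incl _ _ _ _ HI Hw)|].
      apply memb_In in Ex0. intros x Hx. apply Hf. unfold A in Hx. simpl in *.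
      destruct Hx as [|[<-|]]; tauto. }
    destruct (IH (fun y => pot_kernel (psub y x0) - pot_kernel y)) as (v & d & Hv & Hg).
    pose proof (pot_difference_harmonic A x0 ltac:(unfold A; simpl; auto)
                  ltac:(unfold A; simpl; auto)) as Hp.
    set (psi := fun y => (pot_kernel (psub y x0) - pot_kernel y) + -1 * v y).
    assert (Hpsi : harmonic_limit A psi (0 + -1 * d)).
    { apply harmonic_limit_combine; auto. exact (harmonic_limit_incl _ _ _ _ HI Hv). }
    assert (Hnz : psi x0 <> 0).
    { intros E. assert (Hz : forall y, psi y = 0).
      { apply (harmonic_limit_unique A psi (0 + -1 * d)); [unfold A; simpl; auto|auto|].
        intros x [<-|[<-|Hx]]; auto; unfold psi; rewrite Hg by (simpl; auto); ring. }
      assert (Hc : Pop psi x0 - psi x0 = 1).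
      { unfold psi. rewrite Pop_plus, Pop_scal, Pop_minus, (proj1 Hv) by auto.
        pose proof (Pop_pot_shift x0 x0) as H1. pose proof (pot_kernel_equation x0) as H2.
        replace (pt_eqb x0 x0) with true in H1 by (symmetry; now apply pt_eqb_spec).
        replace (pt_eqb x0 orig) with false in H2; [lra|].
        symmetry. apply pt_eqb_neq. intros ->. apply memb_not_In in Ex0. simpl in Ex0. tauto. }
      rewrite Hz, (Pop_ext psi (fun _ => 0)), Pop_const in Hc by auto. lra. }
    exists (fun y => w y + (f x0 - w x0) / psi x0 * psi y),
           (c + (f x0 - w x0) / psi x0 * (0 + -1 * d)). split.
    + apply harmonic_limit_combine; auto. exact (harmonic_limit_incl _ _ _ _ HI Hw).
    + assert (H0 : forall x, In x (orig :: l) -> w x + (f x0 - w x0) / psi x0 * psi x = f x).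
      { intros x Hx. replace (psi x) with 0; [rewrite Hf by auto; ring|].
        unfold psi. rewrite Hg by auto. ring. }
      intros x [<-|[<-|Hx]]; try (apply H0; simpl; tauto). field. auto.
Qed.

(** * Harmonic measure from infinity *)

Definition delta (x z : pt) : R := if pt_eqb z x then 1 else 0.

(** The index 0 contributes nothing, so [S k] terms account for the hits up to time [k]. *)
Lemma first_hit_sum A x k y :
  bsum (S k) (fun i => first_hit A i y x) = hit_exp A (delta x) k y.
Proof.
  revert y. induction k as [|k IH]; intros y; [simpl; ring|].
  rewrite bsum_S_l. cbn [first_hit]. rewrite Rplus_0_l.
  change (hit_exp A (delta x) (S k) y) with
    (Pop (fun z => if memb A z then delta x z else hit_exp A (delta x) k z) y).
  rewrite (Pop_ext _ (fun z => bsum (S k) (fun i => if memb A z then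
      match i with O => delta x z | S _ => 0 end else first_hit A i z x))).
  - rewrite Pop_bsum. reflexivity.
  - intros z. destruct (memb A z); [|now rewrite <- IH].
    rewrite bsum_S_l, bsum_zero by auto. ring.
Qed.

Lemma hit_dist_harmonic A x w c y :
  In orig A -> harmonic_limit A w c -> (forall z, In z A -> w z = delta x z) ->
  memb A y = false -> hit_dist A y x = w y.
Proof.
  intros HA Hw HE Hy. apply series_value_eq. intros eps He.
  destruct (hit_exp_cv A w c y HA Hw Hy eps He) as [N HN]. exists N. intros n Hn.
  specialize (HN n Hn). now rewrite sum_f_R0_bsum, first_hit_sum, (hit_exp_ext A _ w) by (symmetry; auto).
Qed.

Lemma far_outside A : exists M, forall y, (M < l1 y)%Z -> memb A y = false.
Proof.
  induction A as [|x A [M HM]]; [exists 0%Z; auto|].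
  exists (Z.max M (l1 x)). intros y Hy. apply memb_not_In. intros [->|H]; [lia|].
  specialize (HM y ltac:(lia)). apply memb_not_In in HM. contradiction.
Qed.

Lemma norm_pt_le_l1 y : norm_pt y <= IZR (l1 y).
Proof.
  unfold norm_pt, l1. rewrite plus_IZR, !abs_IZR.
  pose proof (Rabs_pos (IZR (fst y))). pose proof (Rabs_pos (IZR (snd y))).
  rewrite <- (sqrt_pow2 (Rabs (IZR (fst y)) + Rabs (IZR (snd y)))) by lra.
  apply sqrt_le_1_alt. rewrite <- (pow2_abs (IZR (fst y))), <- (pow2_abs (IZR (snd y))). nra.
Qed.

Lemma far_lim_lim_at_infinity f c : far_lim f c -> lim_at_infinity f c.
Proof.
  intros H eps He. destruct (H eps He) as [M HM]. exists (IZR M). intros y Hy.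
  apply HM. apply lt_IZR. pose proof (norm_pt_le_l1 y). lra.
Qed.

Lemma lim_at_infinity_unique f c d : lim_at_infinity f c -> lim_at_infinity f d -> c = d.
Proof.
  intros Hc Hd. apply cond_eq. intros eps He.
  destruct (Hc (eps / 2) ltac:(lra)) as [M1 H1]. destruct (Hd (eps / 2) ltac:(lra)) as [M2 H2].
  destruct (INR_archimed 1 (Rmax M1 M2) ltac:(lra)) as [n Hn].
  assert (Hy : norm_pt (Z.of_nat n, 0%Z) = INR n).
  { unfold norm_pt. cbn [fst snd]. rewrite <- INR_IZR_INZ.
    replace (INR n ^ 2 + 0 ^ 2) with (INR n ^ 2) by ring. apply sqrt_pow2, pos_INR. }
  pose proof (Rmax_l M1 M2). pose proof (Rmax_r M1 M2).
  specialize (H1 (Z.of_nat n, 0%Z) ltac:(rewrite Hy; lra)).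
  specialize (H2 (Z.of_nat n, 0%Z) ltac:(rewrite Hy; lra)).
  apply Rabs_def2 in H1, H2. apply Rabs_def1; lra.
Qed.

(** Existence of harmonic measure: off [A] the hitting probability of [x] is the harmonic function
    with boundary values [delta x], and [harmonic_extension] provides one with a limit at infinity.
    Uniqueness of limits then identifies the value picked by [epsilon]. *)
Lemma hit_dist_far_lim A x : In orig A -> far_lim (fun y => hit_dist A y x) (harm_meas A x).
Proof.
  intros HA. destruct (harmonic_extension A (delta x)) as (w & c & Hw & HE).
  assert (Hw' : harmonic_limit A w c).
  { eapply harmonic_limit_incl; [|exact Hw]. intros z [<-|]; auto. }
  assert (HL : far_lim (fun y => hit_dist A y x) c).
  { intros eps He. destruct (proj2 Hw eps He) as [M HM]. destruct (far_outside A) as [M' HM'].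
    exists (Z.max M M'). intros y Hy. rewrite (hit_dist_harmonic A x w c); auto.
    - apply HM; lia.
    - intros; apply HE; simpl; auto.
    - apply HM'; lia. }
  replace (harm_meas A x) with c; auto.
  unfold harm_meas, limit_at_infinity. eapply lim_at_infinity_unique.
  - apply far_lim_lim_at_infinity; exact HL.
  - apply (epsilon_spec (inhabits 0) (fun l => lim_at_infinity (fun y => hit_dist A y x) l)).
    exists c. now apply far_lim_lim_at_infinity.
Qed.

Lemma hit_dist_series A x y :
  In orig A -> memb A y = false ->
  Un_cv (fun k => hit_exp A (delta x) k y) (hit_dist A y x).
Proof.
  intros HA Hy. destruct (harmonic_extension A (delta x)) as (w & c & Hw & HE).
  assert (Hw' : harmonic_limit A w c).
  { eapply harmonic_limit_incl; [|exact Hw]. intros z [<-|]; auto. }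
  rewrite (hit_dist_harmonic A x w c) by (auto; intros; apply HE; simpl; auto).
  intros eps He. destruct (hit_exp_cv A w c y HA Hw' Hy eps He) as [N HN].
  exists N. intros k Hk. rewrite <- (hit_exp_ext A w) by (intros; apply HE; simpl; auto). auto.
Qed.

Lemma sum_delta A f z :
  NoDup A -> sumR (map (fun x => f x * delta x z) A) = if memb A z then f z else 0.
Proof.
  induction A as [|a A IH]; intros HN; [reflexivity|].
  inversion HN as [|? ? Ha HN' E]; subst. cbn [map]. unfold sumR in *. cbn [fold_right].
  rewrite IH by auto. unfold memb. cbn [existsb]. fold (memb A z). unfold delta.
  destruct (pt_eqb z a) eqn:Ez; cbn [orb]; [|ring].
  apply pt_eqb_spec in Ez. subst z. apply memb_not_In in Ha. rewrite Ha. ring.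
Qed.

Lemma hit_exp_decompose A f k y :
  NoDup A -> hit_exp A f k y = sumR (map (fun x => f x * hit_exp A (delta x) k y) A).
Proof.
  intros HN. revert y. induction k as [|k IH]; intros y.
  - simpl. rewrite (sumR_ext _ (fun _ => 0)), sumR_const; intros; ring.
  - cbn [hit_exp].
    rewrite (sumR_ext _ (fun x => Pop (fun z => f x * (if memb A z then delta x z else hit_exp A (delta x) k z)) y))
      by (intros; now rewrite Pop_scal).
    rewrite <- (Pop_sumR (fun x z => f x * (if memb A z then delta x z else hit_exp A (delta x) k z))).
    apply Pop_ext. intros z. destruct (memb A z) eqn:E.
    + rewrite sum_delta by auto. now rewrite E.
    + apply IH.
Qed.

Lemma CV_const c : Un_cv (fun _ => c) c.
Proof. intros eps He. exists 0%nat. intros. unfold Rdist. now rewrite Rminus_diag, Rabs_R0. Qed.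

Lemma CV_sumR {T} (F : nat -> T -> R) (G : T -> R) l :
  (forall t, In t l -> Un_cv (fun n => F n t) (G t)) ->
  Un_cv (fun n => sumR (map (F n) l)) (sumR (map G l)).
Proof.
  induction l as [|t l IH]; intros H.
  - exact (CV_const 0).
  - apply (CV_plus (fun n => F n t) (fun n => sumR (map (F n) l))).
    + apply H; simpl; auto.
    + apply IH. intros; apply H; simpl; auto.
Qed.

Lemma far_lim_sumR {T} (F : T -> pt -> R) (G : T -> R) l :
  (forall t, In t l -> far_lim (F t) (G t)) ->
  far_lim (fun y => sumR (map (fun t => F t y) l)) (sumR (map G l)).
Proof.
  induction l as [|t l IH]; intros H; [exact (far_lim_const 0)|].
  apply (far_lim_plus (F t) (fun y => sumR (map (fun t => F t y) l))).
  - apply H; simpl; auto.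
  - apply IH. intros; apply H; simpl; auto.
Qed.

(** Off [A], [w] is the integral of its values on [A] against the hitting distribution; the starting
    point is sent to infinity. *)
Lemma harmonic_measure_integral A w c :
  In orig A -> NoDup A -> harmonic_limit A w c ->
  sumR (map (fun x => w x * harm_meas A x) A) = c.
Proof.
  intros HA HN Hw.
  assert (H1 : far_lim (fun y => sumR (map (fun x => w x * hit_dist A y x) A))
                 (sumR (map (fun x => w x * harm_meas A x) A))).
  { apply (far_lim_sumR (fun x y => w x * hit_dist A y x)). intros x _.
    apply far_lim_scal. now apply hit_dist_far_lim. }
  assert (H2 : far_lim (fun y => sumR (map (fun x => w x * hit_dist A y x) A)) c).
  { intros eps He. destruct (proj2 Hw eps He) as [M HM]. destruct (far_outside A) as [M' HM'].
    exists (Z.max M M'). intros y Hy. specialize (HM y ltac:(lia)).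
    specialize (HM' y ltac:(lia)).
    replace (sumR _) with (w y); auto.
    apply (UL_sequence (fun k => hit_exp A w k y)); [now apply (hit_exp_cv A w c)|].
    assert (HC : Un_cv (fun k => sumR (map (fun x => w x * hit_exp A (delta x) k y) A))
              (sumR (map (fun x => w x * hit_dist A y x) A))).
    { apply (CV_sumR (fun k x => w x * hit_exp A (delta x) k y)). intros x _.
      apply CV_mult; [apply CV_const|now apply hit_dist_series]. }
    intros e Hee. destruct (HC e Hee) as [N HNN]. exists N. intros k Hk.
    rewrite hit_exp_decompose by auto. auto. }
  eapply lim_at_infinity_unique; apply far_lim_lim_at_infinity; eassumption.
Qed.

Lemma harm_meas_total A : In orig A -> NoDup A -> sumR (map (harm_meas A) A) = 1.
Proof.
  intros HA HN.
  rewrite <- (harmonic_measure_integral A (fun _ => 1) 1 HA HN).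
  - apply sumR_ext. intros; ring.
  - split; [intros y _; apply Pop_const|apply far_lim_const].
Qed.

(** The potential of harmonic measure is constant on [A]: the difference of the potentials at [z]
    and at the origin integrates a harmonic function with limit 0 at infinity, and at the origin the
    potential is [cap A] by definition. *)
Lemma equilibrium_potential A z :
  In orig A -> NoDup A -> In z A ->
  sumR (map (fun x => pot_kernel (psub x z) * harm_meas A x) A) = cap A.
Proof.
  intros HA HN Hz. unfold cap.
  pose proof (harmonic_measure_integral _ _ _ HA HN (pot_difference_harmonic A z HA Hz)) as H.
  cbv beta in H.
  rewrite (sumR_ext _ (fun x => pot_kernel (psub x z) * harm_meas A x
              + -1 * (pot_kernel x * harm_meas A x))) in H by (intros; ring).
  rewrite sumR_plus, sumR_scal in H. lra.
Qed.

(** * Periodic functions *)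

Definition gpt (i j : nat) : pt := (Z.of_nat i, Z.of_nat j).

Definition box (n : nat) (f : pt -> R) : R := bsum2 n (fun i j => f (gpt i j)).

Definition avg (n : nat) (f : pt -> R) : R := / INR n ^ 2 * box n f.

(** Functions on the torus are encoded as periodic functions on the plane, so that no quotient type
    appears. *)
Definition periodic {T} (n : nat) (f : pt -> T) : Prop :=
  forall x, f ((fst x + Z.of_nat n)%Z, snd x) = f x /\ f (fst x, (snd x + Z.of_nat n)%Z) = f x.

Lemma periodic_multiple {T} n (f : pt -> T) a b x y :
  periodic n f -> f ((x + a * Z.of_nat n)%Z, (y + b * Z.of_nat n)%Z) = f (x, y).
Proof.
  intros H.
  assert (H1 : forall (k : nat) x y, f ((x + Z.of_nat k * Z.of_nat n)%Z, y) = f (x, y)).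
  { intros k. induction k as [|k IH]; intros x' y'.
    - now rewrite Z.mul_0_l, Z.add_0_r.
    - rewrite Nat2Z.inj_succ, Z.mul_succ_l, Z.add_assoc.
      rewrite <- (IH x' y'). apply (proj1 (H (_, y'))). }
  assert (H2 : forall (k : nat) x y, f (x, (y + Z.of_nat k * Z.of_nat n)%Z) = f (x, y)).
  { intros k. induction k as [|k IH]; intros x' y'.
    - now rewrite Z.mul_0_l, Z.add_0_r.
    - rewrite Nat2Z.inj_succ, Z.mul_succ_l, Z.add_assoc.
      rewrite <- (IH x' y'). apply (proj2 (H (x', _))). }
  transitivity (f (x, (y + b * Z.of_nat n)%Z)).
  - destruct (Z.le_gt_cases 0 a).
    + rewrite <- (Z2Nat.id a) by auto. apply H1.
    + rewrite <- (H1 (Z.to_nat (- a))). f_equal. f_equal. rewrite Z2Nat.id by lia. ring.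
  - destruct (Z.le_gt_cases 0 b).
    + rewrite <- (Z2Nat.id b) by auto. apply H2.
    + rewrite <- (H2 (Z.to_nat (- b))). f_equal. f_equal. rewrite Z2Nat.id by lia. ring.
Qed.

Lemma periodic_proj {T} n (f : pt -> T) x :
  (0 < n)%nat -> periodic n f -> f (proj (Z.of_nat n) x) = f x.
Proof.
  intros Hn H. destruct x as [a b]. unfold proj. cbn [fst snd].
  rewrite <- (periodic_multiple n f (a / Z.of_nat n) (b / Z.of_nat n)) by auto.
  f_equal. f_equal.
  - rewrite (Z.div_mod a (Z.of_nat n)) at 3 by lia. ring.
  - rewrite (Z.div_mod b (Z.of_nat n)) at 3 by lia. ring.
Qed.

Lemma periodic_Pop n f : periodic n f -> periodic n (Pop f).
Proof.
  intros H x. rewrite !Pop_eq. cbn [fst snd]. split.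
  - rewrite <- (proj1 (H ((fst x + 1)%Z, snd x))), <- (proj1 (H ((fst x - 1)%Z, snd x))),
      <- (proj1 (H (fst x, (snd x + 1)%Z))), <- (proj1 (H (fst x, (snd x - 1)%Z))).
    cbn [fst snd]. rewrite (Z.add_shuffle0 (fst x) 1), <- (Z.add_sub_swap (fst x)). reflexivity.
  - rewrite <- (proj2 (H ((fst x + 1)%Z, snd x))), <- (proj2 (H ((fst x - 1)%Z, snd x))),
      <- (proj2 (H (fst x, (snd x + 1)%Z))), <- (proj2 (H (fst x, (snd x - 1)%Z))).
    cbn [fst snd]. rewrite (Z.add_shuffle0 (snd x) 1), <- (Z.add_sub_swap (snd x)). reflexivity.
Qed.

Lemma periodic_shift {T} n (f : pt -> T) z : periodic n f -> periodic n (fun x => f (psub x z)).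
Proof.
  intros H x. unfold psub. cbn [fst snd].
  rewrite !Z.add_sub_swap. apply (H ((fst x - fst z)%Z, (snd x - snd z)%Z)).
Qed.

Lemma periodic_map {T U} n (op : T -> U) f : periodic n f -> periodic n (fun x => op (f x)).
Proof. intros H x. destruct (H x) as [-> ->]. auto. Qed.

Lemma periodic_map2 {T U V} n (op : T -> U -> V) f g :
  periodic n f -> periodic n g -> periodic n (fun x => op (f x) (g x)).
Proof. intros Hf Hg x. destruct (Hf x) as [-> ->], (Hg x) as [-> ->]. auto. Qed.

Lemma periodic_ext {T} n (f g : pt -> T) : (forall x, f x = g x) -> periodic n f -> periodic n g.
Proof. intros E H x. rewrite <- !E. apply H. Qed.

Lemma box_ext n f g : (forall x, f x = g x) -> box n f = box n g.
Proof. intros H. apply bsum2_ext. auto. Qed.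

Lemma avg_ext n f g : (forall x, f x = g x) -> avg n f = avg n g.
Proof. intros H. unfold avg. f_equal. now apply box_ext. Qed.

Lemma box_plus n f g : box n (fun x => f x + g x) = box n f + box n g.
Proof. apply (bsum2_plus n (fun i j => f (gpt i j)) (fun i j => g (gpt i j))). Qed.

Lemma box_minus n f g : box n (fun x => f x - g x) = box n f - box n g.
Proof. apply (bsum2_minus n (fun i j => f (gpt i j)) (fun i j => g (gpt i j))). Qed.

Lemma box_scal n c f : box n (fun x => c * f x) = c * box n f.
Proof. apply (bsum2_scal n c (fun i j => f (gpt i j))). Qed.

Lemma avg_plus n f g : avg n (fun x => f x + g x) = avg n f + avg n g.
Proof. unfold avg. rewrite box_plus. ring. Qed.

Lemma avg_minus n f g : avg n (fun x => f x - g x) = avg n f - avg n g.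
Proof. unfold avg. rewrite box_minus. ring. Qed.

Lemma avg_scal n c f : avg n (fun x => c * f x) = c * avg n f.
Proof. unfold avg. rewrite box_scal. ring. Qed.

Lemma avg_const n c : (0 < n)%nat -> avg n (fun _ => c) = c.
Proof.
  intros Hn. unfold avg, box. rewrite bsum2_const. field. apply not_0_INR. lia.
Qed.

Lemma avg_le n f g : (0 < n)%nat -> (forall x, f x <= g x) -> avg n f <= avg n g.
Proof.
  intros Hn H. apply Rmult_le_compat_l; [left; now apply inv_INR_sq_pos|].
  apply bsum2_le. auto.
Qed.

Lemma avg_nonneg n f : (0 < n)%nat -> (forall x, 0 <= f x) -> 0 <= avg n f.
Proof. intros Hn H. rewrite <- (avg_const n 0 Hn). now apply avg_le. Qed.

Lemma bsum_cyclic_shift n (f : nat -> R) : f n = f 0%nat -> bsum n (fun i => f (S i)) = bsum n f.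
Proof. intros H. pose proof (bsum_S_l n f) as E. cbn [bsum] in E. lra. Qed.

Lemma box_shift_1 n f : periodic n f -> box n (fun x => f ((fst x + 1)%Z, snd x)) = box n f.
Proof.
  intros H. unfold box, bsum2.
  rewrite <- (bsum_cyclic_shift n (fun i => bsum n (fun j => f (gpt i j)))).
  - apply bsum_ext. intros i _. apply bsum_ext. intros j _. unfold gpt. cbn [fst snd].
    do 2 f_equal. lia.
  - apply bsum_ext. intros j _. apply (proj1 (H (gpt 0 j))).
Qed.

Lemma box_shift_2 n f : periodic n f -> box n (fun x => f (fst x, (snd x + 1)%Z)) = box n f.
Proof.
  intros H. unfold box, bsum2. apply bsum_ext. intros i _.
  rewrite <- (bsum_cyclic_shift n (fun j => f (gpt i j))).
  - apply bsum_ext. intros j _. unfold gpt. cbn [fst snd]. do 2 f_equal. lia.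
  - apply (proj2 (H (gpt i 0))).
Qed.

Lemma box_shift n f i j : periodic n f -> box n (fun x => f (psub x (gpt i j))) = box n f.
Proof.
  intros H. transitivity (box n (fun x => f (psub x (gpt 0 j)))).
  - induction i as [|i IH]; auto. rewrite <- IH.
    rewrite <- (box_shift_1 n (fun x => f (psub x (gpt (S i) j)))) by now apply periodic_shift.
    apply box_ext. intros x. unfold psub, gpt. cbn [fst snd]. do 2 f_equal. lia.
  - induction j as [|j IH].
    + apply box_ext. intros [x y]. unfold psub, gpt. cbn [fst snd]. do 2 f_equal; lia.
    + rewrite <- IH.
      rewrite <- (box_shift_2 n (fun x => f (psub x (gpt 0 (S j))))) by now apply periodic_shift.
      apply box_ext. intros x. unfold psub, gpt. cbn [fst snd]. do 2 f_equal. lia.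
Qed.

(** Reversibility: moving a unit shift from one factor to the other turns it into the opposite
    shift, and the four directions are closed under this. *)
Lemma box_Pop_sym n f g :
  periodic n f -> periodic n g ->
  box n (fun x => Pop f x * g x) = box n (fun x => f x * Pop g x).
Proof.
  intros Hf Hg.
  rewrite (box_ext n _ (fun x => / 4 * ((f ((fst x + 1)%Z, snd x) * g x + f ((fst x - 1)%Z, snd x) * g x)
     + (f (fst x, (snd x + 1)%Z) * g x + f (fst x, (snd x - 1)%Z) * g x))))
    by (intros; rewrite Pop_eq; field).
  rewrite (box_ext n (fun x => f x * Pop g x) (fun x => / 4 *
     ((f x * g ((fst x - 1)%Z, snd x) + f x * g ((fst x + 1)%Z, snd x))
     + (f x * g (fst x, (snd x - 1)%Z) + f x * g (fst x, (snd x + 1)%Z)))))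
    by (intros; rewrite Pop_eq; field).
  rewrite !box_scal, !box_plus.
  assert (HS : forall z f g, periodic n f -> periodic n g -> periodic n (fun x => f x * g (psub x z))).
  { intros z f' g' H1 H2. apply (periodic_map2 n Rmult); auto. now apply periodic_shift. }
  assert (E1 : forall f g, periodic n f -> periodic n g ->
     box n (fun x => f ((fst x + 1)%Z, snd x) * g x) = box n (fun x => f x * g ((fst x - 1)%Z, snd x))).
  { intros f' g' H1 H2. rewrite <- (box_shift_1 n (fun x => f' x * g' ((fst x - 1)%Z, snd x))).
    - apply box_ext. intros [a b]. cbn [fst snd]. now rewrite Z.add_simpl_r.
    - eapply periodic_ext; [|exact (HS (1, 0)%Z f' g' H1 H2)].
      intros x. cbn beta. unfold psub. cbn [fst snd]. now rewrite Z.sub_0_r. }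
  assert (E2 : forall f g, periodic n f -> periodic n g ->
     box n (fun x => f (fst x, (snd x + 1)%Z) * g x) = box n (fun x => f x * g (fst x, (snd x - 1)%Z))).
  { intros f' g' H1 H2. rewrite <- (box_shift_2 n (fun x => f' x * g' (fst x, (snd x - 1)%Z))).
    - apply box_ext. intros [a b]. cbn [fst snd]. now rewrite Z.add_simpl_r.
    - eapply periodic_ext; [|exact (HS (0, 1)%Z f' g' H1 H2)].
      intros x. cbn beta. unfold psub. cbn [fst snd]. now rewrite Z.sub_0_r. }
  rewrite (E1 f g), (E2 f g) by auto.
  pose proof (E1 g f Hg Hf) as E3. pose proof (E2 g f Hg Hf) as E4.
  rewrite (box_ext n (fun x => f x * g ((fst x + 1)%Z, snd x)) (fun x => g ((fst x + 1)%Z, snd x) * f x))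
    by (intros; ring).
  rewrite (box_ext n (fun x => f x * g (fst x, (snd x + 1)%Z)) (fun x => g (fst x, (snd x + 1)%Z) * f x))
    by (intros; ring).
  rewrite E3, E4.
  rewrite (box_ext n (fun x => g x * f ((fst x - 1)%Z, snd x)) (fun x => f ((fst x - 1)%Z, snd x) * g x))
    by (intros; ring).
  rewrite (box_ext n (fun x => g x * f (fst x, (snd x - 1)%Z)) (fun x => f (fst x, (snd x - 1)%Z) * g x))
    by (intros; ring).
  reflexivity.
Qed.

Lemma avg_Pop_sym n f g :
  periodic n f -> periodic n g ->
  avg n (fun x => Pop f x * g x) = avg n (fun x => f x * Pop g x).
Proof. intros. unfold avg. f_equal. now apply box_Pop_sym. Qed.

Lemma box_Pop n f : periodic n f -> box n (Pop f) = box n f.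
Proof.
  intros H. pose proof (box_Pop_sym n f (fun _ => 1) H) as E.
  rewrite (box_ext n (Pop f) (fun x => Pop f x * 1)) by (intros; ring).
  rewrite E by (intros x; auto). apply box_ext. intros. rewrite Pop_const. ring.
Qed.

Lemma periodic_char n i j : (0 < n)%nat -> periodic n (char n i j).
Proof.
  intros Hn x. unfold char. cbn [fst snd]. rewrite !ang_period by auto. split.
  - rewrite <- (cos_period (ang n i (fst x) + ang n j (snd x)) i). f_equal. ring.
  - rewrite <- (cos_period (ang n i (fst x) + ang n j (snd x)) j). f_equal. ring.
Qed.

Lemma periodic_green n : (0 < n)%nat -> periodic n (green n).
Proof.
  intros Hn x. unfold green. split; f_equal; apply bsum2_ext; intros i j _ _; f_equal;
    apply (periodic_char n i j Hn x).
Qed.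

Lemma box_char n i j :
  (i < n)%nat -> (j < n)%nat ->
  box n (char n i j) = if (Nat.eqb i 0 && Nat.eqb j 0)%bool then INR n ^ 2 else 0.
Proof.
  intros Hi Hj. unfold box.
  rewrite (bsum2_ext n _ (fun k l => char n k l (gpt i j))).
  - rewrite sum_char_frequencies by lia. unfold at_origin, gpt. cbn [fst snd].
    rewrite !Z.mod_small by lia. destruct i, j; reflexivity.
  - intros k l _ _. unfold char, gpt. cbn [fst snd]. now rewrite !(ang_sym n i), !(ang_sym n j).
Qed.

Lemma box_char_sum n (c : nat -> nat -> R) :
  c 0%nat 0%nat = 0 -> box n (fun x => / INR n ^ 2 * bsum2 n (fun i j => c i j * char n i j x)) = 0.
Proof.
  intros Hc. rewrite box_scal. unfold box at 1. rewrite bsum2_bsum2.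
  rewrite (bsum2_ext n _ (fun _ _ => 0)), bsum2_const; [ring|].
  intros i j Hi Hj. rewrite bsum2_scal. fold (box n (char n i j)). rewrite box_char by auto.
  destruct i, j; simpl; rewrite ?Hc; ring.
Qed.

Lemma box_green n : box n (green n) = 0.
Proof. apply (box_char_sum n (fun i j => / dd n i j)). now rewrite dd_00, Rinv_0. Qed.

Lemma box_at_origin n f z :
  (0 < n)%nat -> periodic n f ->
  box n (fun x => f x * (if at_origin n (psub x z) then 1 else 0)) = f z.
Proof.
  intros Hn Hf. set (N := Z.of_nat n).
  assert (Ha : (0 <= fst z mod N < N)%Z) by (apply Z.mod_pos_bound; lia).
  assert (Hb : (0 <= snd z mod N < N)%Z) by (apply Z.mod_pos_bound; lia).
  assert (HO : forall x, at_origin n (psub x z) = true <-> (fst x mod N = fst z mod N /\ snd x mod N = snd z mod N)%Z).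
  { intros x. unfold at_origin, psub. cbn [fst snd]. rewrite Bool.andb_true_iff, !Z.eqb_eq. fold N.
    assert (HE : forall a b, ((a - b) mod N = 0 <-> a mod N = b mod N)%Z).
    { intros a b. split; intros E.
      - apply Z.mod_divide in E; [|lia]. destruct E as [k Hk].
        replace a with (b + k * N)%Z by lia. now rewrite Z_mod_plus_full.
      - rewrite Zminus_mod, E, Z.sub_diag. apply Z.mod_0_l. lia. }
    now rewrite !HE. }
  unfold box. rewrite (bsum2_single n _ (Z.to_nat (fst z mod N)) (Z.to_nat (snd z mod N))); try lia.
  - unfold gpt. rewrite !Z2Nat.id by lia.
    replace (at_origin n _) with true.
    + rewrite Rmult_1_r. apply (periodic_proj n f z Hn Hf).
    + symmetry. apply HO. cbn [fst snd]. rewrite !Z.mod_mod by lia. auto.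
  - intros i j Hi Hj Hne. destruct (at_origin n _) eqn:E; [|ring].
    apply HO in E. unfold gpt in E. cbn [fst snd] in E.
    rewrite (Z.mod_small (Z.of_nat i)), (Z.mod_small (Z.of_nat j)) in E by lia.
    exfalso. apply Hne. rewrite <- (proj1 E), <- (proj2 E), !Nat2Z.id. reflexivity.
Qed.

(** Summation by parts moves [I - Pop] onto the Green function, which becomes a point mass minus the
    uniform measure. *)
Lemma box_green_equation n f z :
  (0 < n)%nat -> periodic n f ->
  box n (fun x => (f x - Pop f x) * green n (psub x z)) = f z - avg n f.
Proof.
  intros Hn Hf. pose proof (periodic_green n Hn) as Hg.
  rewrite (box_ext n _ (fun x => f x * green n (psub x z) - Pop f x * green n (psub x z)))
    by (intros; ring).
  rewrite box_minus, box_Pop_sym by (auto; now apply periodic_shift).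
  rewrite <- box_minus.
  rewrite (box_ext n _ (fun x => f x * (if at_origin n (psub x z) then 1 else 0) - / INR n ^ 2 * f x)).
  - rewrite box_minus, box_scal, box_at_origin by auto. reflexivity.
  - intros x. rewrite Pop_shift.
    replace (if at_origin n (psub x z) then 1 else 0)
      with (green n (psub x z) - Pop (green n) (psub x z) + / INR n ^ 2)
      by (rewrite green_equation by auto; ring). ring.
Qed.

(** Parseval in disguise: [g2] has coefficients [(/ dd)^2], hence [(I - Pop) g2 = green], and
    pairing this with [green] gives the square norm of [green] as the value of [g2] at the
    origin. *)
Lemma avg_green_sq n : (0 < n)%nat -> avg n (fun x => green n x ^ 2) <= 64.
Proof.
  intros Hn.
  set (g2 := fun x => / INR n ^ 2 * bsum2 n (fun i j => (/ dd n i j) ^ 2 * char n i j x)).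
  assert (Hp : periodic n g2).
  { intros x. unfold g2. split; f_equal; apply bsum2_ext; intros i j _ _; f_equal;
    apply (periodic_char n i j Hn x). }
  assert (E : forall x, g2 x - Pop g2 x = green n x).
  { intros x. unfold g2, green. rewrite Pop_scal, Pop_bsum2, <- Rmult_minus_distr_l, <- bsum2_minus.
    f_equal. apply bsum2_ext. intros i j Hi Hj. rewrite Pop_scal, Pop_char.
    replace ((/ dd n i j) ^ 2 * char n i j x - (/ dd n i j) ^ 2 * (phi n i j * char n i j x))
      with ((dd n i j * / dd n i j) * / dd n i j * char n i j x) by (unfold dd at 1; ring).
    rewrite dd_inv_dd by auto. destruct i, j; simpl; rewrite ?dd_00, ?Rinv_0; ring. }
  pose proof (box_green_equation n g2 orig Hn Hp) as H.
  assert (H0 : avg n g2 = 0).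
  { unfold avg. unfold g2. rewrite box_char_sum; [ring|]. rewrite dd_00, Rinv_0. ring. }
  rewrite H0, Rminus_0_r in H.
  unfold avg. rewrite (box_ext n _ (fun x => (g2 x - Pop g2 x) * green n (psub x orig))).
  - rewrite H. unfold g2.
    rewrite (bsum2_ext n _ (fun i j => (/ dd n i j) ^ 2)) by (intros; rewrite char_origin; ring).
    pose proof (gsum_sq_le n) as HG. pose proof (inv_INR_sq_pos n Hn).
    apply Rle_trans with (/ INR n ^ 2 * (/ INR n ^ 2 * (64 * INR n ^ 4))).
    + apply Rmult_le_compat_l; [lra|]. apply Rmult_le_compat_l; lra.
    + right. field. apply not_0_INR. lia.
  - intros x. rewrite E. unfold psub. cbn [fst snd]. rewrite !Z.sub_0_r.
    destruct x; cbn [fst snd]; ring.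
Qed.

(** * Jensen and Poincare inequalities *)

Lemma jensen_square n w f :
  (forall i j, (i < n)%nat -> (j < n)%nat -> 0 <= w i j) -> bsum2 n w = 1 ->
  bsum2 n (fun i j => w i j * f i j) ^ 2 <= bsum2 n (fun i j => w i j * f i j ^ 2).
Proof.
  intros Hw H1. set (m := bsum2 n (fun i j => w i j * f i j)).
  assert (H : 0 <= bsum2 n (fun i j => w i j * (f i j - m) ^ 2)).
  { apply bsum2_nonneg. intros. apply Rmult_le_pos; auto. apply pow2_ge_0. }
  rewrite (bsum2_ext n _ (fun i j => w i j * f i j ^ 2 + (m ^ 2 * w i j - 2 * m * (w i j * f i j)))) in H
    by (intros; ring).
  rewrite bsum2_plus, bsum2_minus, !bsum2_scal, H1 in H. fold m in H. lra.
Qed.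

Lemma bsum_sq_le n f : bsum n f ^ 2 <= INR n * bsum n (fun i => f i ^ 2).
Proof.
  rewrite Rmult_comm.
  assert (H : forall t, 0 <= bsum n (fun i => f i ^ 2) + 2 * t * bsum n f + t ^ 2 * INR n).
  { intros t.
    replace (bsum n (fun i => f i ^ 2) + 2 * t * bsum n f + t ^ 2 * INR n)
      with (bsum n (fun i => (f i + t) ^ 2)).
    - apply bsum_nonneg. intros; apply pow2_ge_0.
    - rewrite (bsum_ext n _ (fun i => f i ^ 2 + (2 * t * f i + t ^ 2))) by (intros; ring).
      rewrite !bsum_plus, bsum_scal, bsum_const. ring. }
  apply discriminant_le; auto. apply pos_INR.
Qed.

(** Cauchy-Schwarz along the path from 0 to [i] bounds [g i - g 0]; replacing [g 0] by the mean only
    decreases the sum of squares. *)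
Lemma poincare_1d n (g : nat -> R) :
  (0 < n)%nat ->
  bsum n (fun i => (g i - / INR n * bsum n g) ^ 2)
  <= INR n ^ 2 * bsum n (fun i => (g (S i) - g i) ^ 2).
Proof.
  intros Hn. assert (HN : 0 < INR n) by (apply lt_0_INR; auto).
  set (D := bsum n (fun i => (g (S i) - g i) ^ 2)).
  assert (H1 : forall i, (i < n)%nat -> (g i - g 0%nat) ^ 2 <= INR n * D).
  { intros i Hi. rewrite <- (bsum_telescope i g).
    eapply Rle_trans; [apply bsum_sq_le|]. apply Rmult_le_compat.
    - apply pos_INR.
    - apply bsum_nonneg; intros; apply pow2_ge_0.
    - apply le_INR; lia.
    - apply (bsum_le_mono i n (fun i => (g (S i) - g i) ^ 2)); [lia|].
      intros; apply pow2_ge_0. }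
  set (m := / INR n * bsum n g).
  apply Rle_trans with (bsum n (fun i => (g i - g 0%nat) ^ 2)).
  - assert (E : bsum n (fun i => (g i - g 0%nat) ^ 2) =
       bsum n (fun i => (g i - m) ^ 2) + INR n * (m - g 0%nat) ^ 2).
    { rewrite (bsum_ext n _ (fun i => (g i - m) ^ 2
        + (2 * (m - g 0%nat) * g i + ((m - g 0%nat) ^ 2 - 2 * (m - g 0%nat) * m)))) by (intros; ring).
      rewrite !bsum_plus, bsum_scal, bsum_const.
      replace (bsum n g) with (INR n * m) by (unfold m; field; lra). ring. }
    rewrite E. pose proof (pow2_ge_0 (m - g 0%nat)). nra.
  - apply Rle_trans with (bsum n (fun _ => INR n * D)).
    + apply bsum_le. auto.
    + rewrite bsum_const. right; ring.
Qed.

Lemma dirichlet_form n f :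
  periodic n f ->
  box n (fun x => f x ^ 2) - box n (fun x => f x * Pop f x)
  = / 4 * (box n (fun x => (f ((fst x + 1)%Z, snd x) - f x) ^ 2)
           + box n (fun x => (f (fst x, (snd x + 1)%Z) - f x) ^ 2)).
Proof.
  intros H.
  assert (Hsq : periodic n (fun x => f x ^ 2)) by now apply (periodic_map n (fun t => t ^ 2)).
  pose proof (box_shift_1 n _ Hsq) as E1. pose proof (box_shift_2 n _ Hsq) as E2. cbv beta in E1, E2.
  assert (H1 : periodic n (fun x => f x * f ((fst x - 1)%Z, snd x))).
  { eapply periodic_ext; [|apply (periodic_map2 n Rmult _ _ H (periodic_shift n f (1, 0)%Z H))].
    intros x. cbn beta. unfold psub. cbn [fst snd]. now rewrite Z.sub_0_r. }
  assert (H2 : periodic n (fun x => f x * f (fst x, (snd x - 1)%Z))).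
  { eapply periodic_ext; [|apply (periodic_map2 n Rmult _ _ H (periodic_shift n f (0, 1)%Z H))].
    intros x. cbn beta. unfold psub. cbn [fst snd]. now rewrite Z.sub_0_r. }
  pose proof (box_shift_1 n _ H1) as E3. pose proof (box_shift_2 n _ H2) as E4. cbn [fst snd] in E3, E4.
  rewrite (box_ext n _ (fun x => f ((fst x + 1)%Z, snd x) * f x)) in E3
    by (intros [a b]; cbn [fst snd]; now rewrite Z.add_simpl_r).
  rewrite (box_ext n _ (fun x => f (fst x, (snd x + 1)%Z) * f x)) in E4
    by (intros [a b]; cbn [fst snd]; now rewrite Z.add_simpl_r).
  rewrite (box_ext n (fun x => f x * Pop f x) (fun x => / 4 *
     ((f ((fst x + 1)%Z, snd x) * f x + f x * f ((fst x - 1)%Z, snd x))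
     + (f (fst x, (snd x + 1)%Z) * f x + f x * f (fst x, (snd x - 1)%Z)))))
    by (intros; rewrite Pop_eq; field).
  rewrite (box_ext n (fun x => (f ((fst x + 1)%Z, snd x) - f x) ^ 2)
    (fun x => f ((fst x + 1)%Z, snd x) ^ 2 + (f x ^ 2 - 2 * (f ((fst x + 1)%Z, snd x) * f x))))
    by (intros; ring).
  rewrite (box_ext n (fun x => (f (fst x, (snd x + 1)%Z) - f x) ^ 2)
    (fun x => f (fst x, (snd x + 1)%Z) ^ 2 + (f x ^ 2 - 2 * (f (fst x, (snd x + 1)%Z) * f x))))
    by (intros; ring).
  rewrite !box_scal, !box_plus, !box_minus, !box_scal, E1, E2. rewrite E3, E4. field.
Qed.

(** The deviation from the mean is split through the mean [r i] of a row, and each part is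
    one-dimensional. The constant 8 is 2 from the square of a sum, times 4 from the factor [/ 4] in
    the Dirichlet form. *)
Lemma poincare n f :
  (0 < n)%nat -> periodic n f ->
  avg n (fun x => (f x - avg n f) ^ 2)
  <= 8 * INR n ^ 2 * (avg n (fun x => f x ^ 2) - avg n (fun x => f x * Pop f x)).
Proof.
  intros Hn Hf. assert (HN : 0 < INR n) by (apply lt_0_INR; auto).
  unfold avg at 1 3 4. rewrite <- Rmult_minus_distr_l, dirichlet_form by auto.
  rewrite <- !Rmult_assoc, (Rmult_comm _ (/ INR n ^ 2)), !Rmult_assoc.
  apply Rmult_le_compat_l; [left; now apply inv_INR_sq_pos|].
  set (D1 := box n (fun x => (f ((fst x + 1)%Z, snd x) - f x) ^ 2)).
  set (D2 := box n (fun x => (f (fst x, (snd x + 1)%Z) - f x) ^ 2)).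
  set (r := fun i => / INR n * bsum n (fun j => f (gpt i j))).
  assert (Hr : avg n f = / INR n * bsum n r).
  { unfold avg, box, bsum2, r. rewrite bsum_scal. field. lra. }
  assert (HA : box n (fun x => (f x - avg n f) ^ 2)
    <= 2 * bsum n (fun i => bsum n (fun j => (f (gpt i j) - r i) ^ 2))
       + 2 * (INR n * bsum n (fun i => (r i - avg n f) ^ 2))).
  { unfold box, bsum2.
    apply Rle_trans with (bsum n (fun i => 2 * bsum n (fun j => (f (gpt i j) - r i) ^ 2)
        + 2 * (INR n * (r i - avg n f) ^ 2))).
    - apply bsum_le. intros i _.
      apply Rle_trans with (bsum n (fun j => 2 * (f (gpt i j) - r i) ^ 2 + 2 * (r i - avg n f) ^ 2)).
      + apply bsum_le. intros j _. pose proof (pow2_ge_0 ((f (gpt i j) - r i) - (r i - avg n f))). lra.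
      + rewrite bsum_plus, bsum_scal, bsum_const. right; ring.
    - rewrite bsum_plus, !bsum_scal. right; ring. }
  assert (HB : bsum n (fun i => bsum n (fun j => (f (gpt i j) - r i) ^ 2)) <= INR n ^ 2 * D2).
  { unfold D2, box, bsum2. rewrite <- bsum_scal. apply bsum_le. intros i _.
    eapply Rle_trans; [apply (poincare_1d n (fun j => f (gpt i j)) Hn)|].
    right. f_equal. apply bsum_ext. intros j _. unfold gpt. cbn [fst snd].
    replace (Z.of_nat (S j)) with (Z.of_nat j + 1)%Z by lia. reflexivity. }
  assert (HC : INR n * bsum n (fun i => (r i - avg n f) ^ 2) <= INR n ^ 2 * D1).
  { rewrite Hr. apply Rle_trans with (INR n * (INR n ^ 2 * bsum n (fun i => (r (S i) - r i) ^ 2))).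
    - apply Rmult_le_compat_l; [lra|]. now apply poincare_1d.
    - apply Rle_trans with (INR n * (INR n ^ 2 * (/ INR n * D1))); [|right; field; lra].
      apply Rmult_le_compat_l; [lra|]. apply Rmult_le_compat_l; [apply pow2_ge_0|].
      unfold D1, box, bsum2. rewrite <- bsum_scal. apply bsum_le. intros i _.
      unfold r. rewrite <- Rmult_minus_distr_l, <- bsum_minus, Rpow_mult_distr.
      apply Rle_trans with ((/ INR n) ^ 2 * (INR n * bsum n (fun j => (f (gpt (S i) j) - f (gpt i j)) ^ 2))).
      + apply Rmult_le_compat_l; [apply pow2_ge_0|apply bsum_sq_le].
      + right. replace ((/ INR n) ^ 2 * (INR n * _)) with
          (/ INR n * bsum n (fun j => (f (gpt (S i) j) - f (gpt i j)) ^ 2)) by (field; lra).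
        f_equal. apply bsum_ext. intros j _. unfold gpt. cbn [fst snd].
        replace (Z.of_nat (S i)) with (Z.of_nat i + 1)%Z by lia. reflexivity. }
  lra.
Qed.

(** * The killed walk on the torus *)

(* [P_x[X_k not in B for k <= m]]: as in [avoid], and unlike in [surv], time [0] counts. *)
Fixpoint kwalk (B : pt -> bool) (m : nat) (x : pt) : R :=
  if B x then 0 else match m with O => 1 | S m' => Pop (kwalk B m') x end.

Definition kill_set (n : nat) (B : pt -> bool) : Prop :=
  (0 < n)%nat /\ periodic n B /\ B orig = true.

Definition usurv (n : nat) (B : pt -> bool) (m : nat) : R := avg n (kwalk B m).

Lemma kwalk_S B m x : kwalk B (S m) x = if B x then 0 else Pop (kwalk B m) x.
Proof. reflexivity. Qed.

Lemma kwalk_on B m x : B x = true -> kwalk B m x = 0.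
Proof. intros H. destruct m; simpl; now rewrite H. Qed.

Lemma kwalk_bounds B m x : 0 <= kwalk B m x <= 1.
Proof.
  revert x. induction m as [|m IH]; intros x; [simpl; destruct (B x); lra|].
  rewrite kwalk_S. destruct (B x); [lra|]. split.
  - rewrite <- (Pop_const 0 x) at 1. apply Pop_le. intros; apply IH.
  - rewrite <- (Pop_const 1 x). apply Pop_le. intros; apply IH.
Qed.

Lemma kwalk_decreasing B m x : kwalk B (S m) x <= kwalk B m x.
Proof.
  revert x. induction m as [|m IH]; intros x.
  - pose proof (kwalk_bounds B 1 x). simpl in *. destruct (B x); lra.
  - rewrite kwalk_S, (kwalk_S B m). destruct (B x); [lra|]. apply Pop_le. auto.
Qed.

Lemma periodic_kwalk n B m : periodic n B -> periodic n (kwalk B m).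
Proof.
  intros HB. induction m as [|m IH].
  - apply (periodic_map n (fun b : bool => if b then 0 else 1) B HB).
  - apply (periodic_map2 n (fun (b : bool) r => if b then 0 else r) B (Pop (kwalk B m)) HB).
    now apply periodic_Pop.
Qed.

(** The killed transition operator is symmetric, so steps may be moved from one factor to the other.
    Norms and scalar products of survival functions thereby become survival probabilities. *)
Lemma kwalk_inner n B i j :
  kill_set n B -> avg n (fun x => kwalk B i x * kwalk B j x) = usurv n B (i + j).
Proof.
  intros (Hn & HB & _). revert j. induction i as [|i IH]; intros j.
  - apply avg_ext. intros x. destruct (B x) eqn:E.
    + rewrite !(kwalk_on B _ x E). ring.
    + simpl kwalk at 1. rewrite E. simpl. ring.
  - replace (S i + j)%nat with (i + S j)%nat by lia. rewrite <- IH.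
    transitivity (avg n (fun x => Pop (kwalk B i) x * kwalk B j x)).
    + apply avg_ext. intros x. rewrite kwalk_S. destruct (B x) eqn:E; auto.
      rewrite (kwalk_on B j x E). ring.
    + rewrite avg_Pop_sym by now apply periodic_kwalk.
      apply avg_ext. intros x. rewrite kwalk_S. destruct (B x) eqn:E; auto.
      rewrite (kwalk_on B i x E). ring.
Qed.

Lemma usurv_bounds n B m : (0 < n)%nat -> 0 <= usurv n B m <= 1.
Proof.
  intros Hn. split.
  - apply avg_nonneg; auto. intros; apply kwalk_bounds.
  - rewrite <- (avg_const n 1 Hn). apply avg_le; auto. intros; apply kwalk_bounds.
Qed.

Lemma usurv_decreasing n B i j : (0 < n)%nat -> (i <= j)%nat -> usurv n B j <= usurv n B i.
Proof.
  intros Hn H. induction H as [|j _ IH]; [lra|]. eapply Rle_trans; [|exact IH].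
  apply avg_le; auto. intros; apply kwalk_decreasing.
Qed.

(** * Mean hitting time and equilibrium measure *)

Lemma periodic_apot n : (0 < n)%nat -> periodic n (apot n).
Proof. intros Hn. apply (periodic_map n (fun t => green n orig - t) (green n)). now apply periodic_green. Qed.

Lemma apot_le n x : (0 < n)%nat -> INR n ^ 2 * apot n x <= 2 * gsum n.
Proof.
  intros Hn. rewrite apot_eq, <- Rmult_assoc, Rinv_r, Rmult_1_l by now apply INR_sq_neq_0.
  unfold gsum. rewrite <- bsum2_scal. apply bsum2_le. intros i j _ _.
  pose proof (Rabs_le_inv _ _ (char_abs_le_1 n i j x)). pose proof (inv_dd_nonneg n i j). nra.
Qed.

Lemma at_origin_kill n B x : kill_set n B -> at_origin n x = true -> B x = true.
Proof.
  intros (Hn & HB & H0) E. rewrite <- H0, <- (periodic_proj n B x Hn HB). f_equal.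
  unfold at_origin in E. apply Bool.andb_true_iff in E. destruct E as [E1 E2].
  apply Z.eqb_eq in E1, E2. unfold proj. now rewrite E1, E2.
Qed.

Definition hit_partial (B : pt -> bool) (K : nat) (x : pt) : R := bsum K (fun k => kwalk B k x).

Lemma hit_partial_S B K x :
  hit_partial B (S K) x = if B x then 0 else 1 + Pop (hit_partial B K) x.
Proof.
  unfold hit_partial. destruct (B x) eqn:E.
  - apply bsum_zero. intros. now apply kwalk_on.
  - rewrite bsum_S_l, Pop_bsum. simpl kwalk at 1. rewrite E. f_equal.
    apply bsum_ext. intros k _. now rewrite kwalk_S, E.
Qed.

(** The function [n^2 apot] is nonnegative and satisfies [h = 1 + Pop h] away from the lattice of
    copies of the origin, all of which lie in [B]; so it dominates the iteration. *)
Lemma hit_partial_le n B K x : kill_set n B -> hit_partial B K x <= INR n ^ 2 * apot n x.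
Proof.
  intros HB. pose proof HB as (Hn & _ & _).
  assert (HN : 0 < INR n ^ 2) by (apply pow_lt, lt_0_INR; auto).
  revert x. induction K as [|K IH]; intros x.
  - pose proof (apot_nonneg n x). unfold hit_partial. simpl bsum. nra.
  - rewrite hit_partial_S. destruct (B x) eqn:E.
    + pose proof (apot_nonneg n x). nra.
    + apply Rle_trans with (1 + Pop (fun y => INR n ^ 2 * apot n y) x).
      * apply Rplus_le_compat_l, Pop_le. auto.
      * rewrite Pop_scal. pose proof (apot_equation n x Hn) as H.
        destruct (at_origin n x) eqn:E'; [rewrite (at_origin_kill n B x HB E') in E; discriminate|].
        replace (Pop (apot n) x) with (apot n x - / INR n ^ 2) by lra. right. field.
        apply not_0_INR. lia.
Qed.

(** The series of [P_x[T > k]] over [k >= 0], hence [E_x[T]]; for a kill set it converges by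
    [hit_partial_le]. *)
Definition hit_mean (B : pt -> bool) (x : pt) : R :=
  epsilon (inhabits 0) (fun l => Un_cv (fun K => hit_partial B K x) l).

Lemma hit_mean_cv n B x :
  kill_set n B -> Un_cv (fun K => hit_partial B K x) (hit_mean B x).
Proof.
  intros HB. apply (epsilon_spec (inhabits 0) (fun l => Un_cv (fun K => hit_partial B K x) l)).
  destruct (growing_cv (fun K => hit_partial B K x)) as [l Hl].
  - intros K. unfold hit_partial. cbn [bsum]. pose proof (kwalk_bounds B K x). lra.
  - exists (INR n ^ 2 * apot n x). intros y [K ->]. now apply hit_partial_le.
  - now exists l.
Qed.

Lemma hit_mean_equation n B x :
  kill_set n B -> hit_mean B x = if B x then 0 else 1 + Pop (hit_mean B) x.
Proof.
  intros HB. apply (UL_sequence (fun K => hit_partial B (S K) x)).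
  - intros eps He. destruct (hit_mean_cv n B x HB eps He) as [N HN]. exists N.
    intros K HK. apply HN. lia.
  - destruct (B x) eqn:E.
    + intros eps He. exists 0%nat. intros. rewrite hit_partial_S, E.
      unfold Rdist. now rewrite Rminus_diag, Rabs_R0.
    + assert (H : Un_cv (fun K => Pop (hit_partial B K) x) (Pop (hit_mean B) x))
        by (apply CV_Pop; intros; now apply (hit_mean_cv n)).
      intros eps He. destruct (H eps He) as [N HN]. exists N. intros K HK.
      rewrite hit_partial_S, E. unfold Rdist in *.
      replace (1 + Pop (hit_partial B K) x - (1 + Pop (hit_mean B) x))
        with (Pop (hit_partial B K) x - Pop (hit_mean B) x) by ring. auto.
Qed.

Lemma hit_mean_bounds n B x : kill_set n B -> 0 <= hit_mean B x <= 2 * gsum n.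
Proof.
  intros HB. pose proof HB as (Hn & _ & _). pose proof (hit_mean_cv n B x HB) as H.
  assert (H0 : forall K, 0 <= hit_partial B K x <= 2 * gsum n).
  { intros K. split.
    - apply bsum_nonneg. intros; apply kwalk_bounds.
    - eapply Rle_trans; [now apply (hit_partial_le n)|]. now apply apot_le. }
  split.
  - destruct (Rle_lt_dec 0 (hit_mean B x)) as [|Hx]; auto. exfalso.
    destruct (H (- hit_mean B x) ltac:(lra)) as [N HN]. specialize (HN N (le_n N)).
    specialize (H0 N). unfold Rdist in HN. apply Rabs_def2 in HN. lra.
  - destruct (Rle_lt_dec (hit_mean B x) (2 * gsum n)) as [|Hx]; auto. exfalso.
    destruct (H (hit_mean B x - 2 * gsum n) ltac:(lra)) as [N HN]. specialize (HN N (le_n N)).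
    specialize (H0 N). unfold Rdist in HN. apply Rabs_def2 in HN. lra.
Qed.

Lemma periodic_hit_mean n B : kill_set n B -> periodic n (hit_mean B).
Proof.
  intros HB.
  assert (HP : forall K, periodic n (hit_partial B K)).
  { intros K x. unfold hit_partial. split; apply bsum_ext; intros;
      apply (periodic_kwalk n B i (proj1 (proj2 HB)) x). }
  intros x. split; eapply UL_sequence; try (now apply (hit_mean_cv n));
    intros eps He; destruct (hit_mean_cv n B x HB eps He) as [N HN]; exists N; intros K HK.
  - rewrite (proj1 (HP K x)). auto.
  - rewrite (proj2 (HP K x)). auto.
Qed.

Definition mean_hit (n : nat) (B : pt -> bool) : R := avg n (hit_mean B).

(* By Kac's formula [n^2 * equil] is the mean return time to [B]; [equil] is the harmonic
   measure of [B] on the torus. *)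
Definition equil (n : nat) (B : pt -> bool) (x : pt) : R :=
  if B x then / INR n ^ 2 * (1 + Pop (hit_mean B) x) else 0.

Lemma equil_equation n B x :
  kill_set n B -> hit_mean B x - Pop (hit_mean B) x = 1 - INR n ^ 2 * equil n B x.
Proof.
  intros HB. pose proof HB as (Hn & _ & _).
  rewrite (hit_mean_equation n B x HB). unfold equil. destruct (B x); [|ring].
  field. apply not_0_INR. lia.
Qed.

Lemma equil_nonneg n B x : kill_set n B -> 0 <= equil n B x.
Proof.
  intros HB. pose proof HB as (Hn & _ & _). unfold equil. destruct (B x); [|lra].
  apply Rmult_le_pos; [left; now apply inv_INR_sq_pos|].
  assert (0 <= Pop (hit_mean B) x); [|lra].
  rewrite <- (Pop_const 0 x) at 1. apply Pop_le. intros; now apply (hit_mean_bounds n).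
Qed.

Lemma equil_total n B : kill_set n B -> box n (equil n B) = 1.
Proof.
  intros HB. pose proof HB as (Hn & _ & _).
  pose proof (periodic_hit_mean n B HB) as HP.
  assert (H : box n (fun x => hit_mean B x - Pop (hit_mean B) x) = 0)
    by (rewrite box_minus, box_Pop by auto; ring).
  rewrite (box_ext n _ (fun x => 1 - INR n ^ 2 * equil n B x)) in H
    by (intros; now apply equil_equation).
  rewrite box_minus, box_scal in H. unfold box at 1 in H. rewrite bsum2_const in H.
  pose proof (INR_sq_neq_0 n Hn). apply (Rmult_eq_reg_l (INR n ^ 2)); auto. lra.
Qed.

Lemma box_green_shift n z : (0 < n)%nat -> box n (fun x => green n (psub x z)) = 0.
Proof.
  intros Hn. rewrite <- (box_green n). pose proof (periodic_green n Hn) as HP.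
  rewrite <- (box_shift n (green n) (Z.to_nat (fst z mod Z.of_nat n))
                (Z.to_nat (snd z mod Z.of_nat n)) HP).
  apply box_ext. intros x. unfold psub, gpt. cbn [fst snd].
  pose proof (Z.mod_pos_bound (fst z) (Z.of_nat n) ltac:(lia)).
  pose proof (Z.mod_pos_bound (snd z) (Z.of_nat n) ltac:(lia)).
  rewrite !Z2Nat.id by lia.
  rewrite <- (periodic_multiple n (green n) (fst z / Z.of_nat n) (snd z / Z.of_nat n)
     (fst x - fst z) (snd x - snd z) HP).
  f_equal. f_equal.
  - rewrite (Z.div_mod (fst z) (Z.of_nat n)) at 1 by lia. ring.
  - rewrite (Z.div_mod (snd z) (Z.of_nat n)) at 1 by lia. ring.
Qed.

(** The charge of [hit_mean] is [1 - n^2 equil], and its constant part integrates to 0 against the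
    mean-zero Green function. *)
Lemma mean_hit_potential n B z :
  kill_set n B ->
  mean_hit n B - hit_mean B z = INR n ^ 2 * box n (fun x => equil n B x * green n (psub x z)).
Proof.
  intros HB. pose proof HB as (Hn & _ & _).
  pose proof (box_green_equation n (hit_mean B) z Hn (periodic_hit_mean n B HB)) as H.
  rewrite (box_ext n _ (fun x => green n (psub x z)
     - INR n ^ 2 * (equil n B x * green n (psub x z)))) in H
    by (intros; rewrite (equil_equation n) by auto; ring).
  rewrite box_minus, box_green_shift, box_scal in H by auto. unfold mean_hit. lra.
Qed.

(** At a point of [B] the hitting time is 0. As [equil] is a probability measure, writing the Green
    function as its value at the origin minus [apot] isolates [gsum]. *)
Lemma mean_hit_deficit n B z :
  kill_set n B -> B z = true ->
  mean_hit n B = gsum n - INR n ^ 2 * box n (fun x => equil n B x * apot n (psub x z)).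
Proof.
  intros HB Hz. pose proof HB as (Hn & _ & _).
  pose proof (mean_hit_potential n B z HB) as H.
  rewrite (hit_mean_equation n B z HB), Hz, Rminus_0_r in H. rewrite H.
  rewrite (box_ext n _ (fun x => green n orig * equil n B x - equil n B x * apot n (psub x z)))
    by (intros; unfold apot; ring).
  rewrite box_minus, box_scal, equil_total, green_origin by auto.
  field. apply not_0_INR. lia.
Qed.

Lemma green_even n x y : green n (psub x y) = green n (psub y x).
Proof.
  pose proof (apot_neg n (psub x y)) as H. unfold apot in H.
  replace (psub orig (psub x y)) with (psub y x) in H; [lra|].
  unfold psub. cbn [fst snd]. f_equal; ring.
Qed.

(** The deviation of [hit_mean] from its average is, up to sign, [n^2] times a mixture of translated
    Green functions with weights [equil]; Jensen reduces its square to [avg_green_sq], uniformly in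
    [B]. *)
Lemma hit_mean_variance n B :
  kill_set n B -> avg n (fun z => (hit_mean B z - mean_hit n B) ^ 2) <= 64 * INR n ^ 4.
Proof.
  intros HB. pose proof HB as (Hn & _ & _). set (N := INR n).
  apply Rle_trans with (avg n (fun z => N ^ 4 * box n (fun x => equil n B x * green n (psub x z) ^ 2))).
  - apply avg_le; auto. intros z.
    replace ((hit_mean B z - mean_hit n B) ^ 2) with ((mean_hit n B - hit_mean B z) ^ 2) by ring.
    rewrite mean_hit_potential by auto. rewrite Rpow_mult_distr. fold N.
    replace ((N ^ 2) ^ 2) with (N ^ 4) by ring.
    apply Rmult_le_compat_l; [apply pow_le, pos_INR|].
    apply (jensen_square n (fun i j => equil n B (gpt i j)) (fun i j => green n (psub (gpt i j) z))).
    + intros; now apply equil_nonneg.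
    + now apply equil_total.
  - rewrite avg_scal, Rmult_comm. apply Rmult_le_compat_r; [apply pow_le, pos_INR|].
    unfold avg, box at 1 2. rewrite bsum2_bsum2, <- bsum2_scal.
    apply Rle_trans with (bsum2 n (fun i j => 64 * equil n B (gpt i j))).
    + apply bsum2_le. intros i j _ _. rewrite bsum2_scal.
      rewrite <- Rmult_assoc, (Rmult_comm (/ _)), Rmult_assoc, Rmult_comm.
      apply Rmult_le_compat_r; [now apply equil_nonneg|].
      fold (box n (fun z => green n (psub (gpt i j) z) ^ 2)).
      assert (Hsq : periodic n (fun y => green n y ^ 2))
        by (apply (periodic_map n (fun t => t ^ 2)); now apply periodic_green).
      pose proof (box_shift n _ i j Hsq) as E. cbv beta in E.
      rewrite (box_ext n _ (fun z => green n (psub z (gpt i j)) ^ 2))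
        by (intros; now rewrite green_even).
      rewrite E. now apply avg_green_sq.
    + rewrite bsum2_scal. fold (box n (equil n B)). rewrite equil_total by auto. lra.
Qed.

(** * Tails of the survival probability *)

(** The tail [sum_(k >= j) u_k], written as a scalar product by the symmetry of the killed walk, so
    that no infinite sum is handled. *)
Definition wtail (n : nat) (B : pt -> bool) (j : nat) : R :=
  avg n (fun x => kwalk B j x * hit_mean B x).

Lemma wtail_0 n B : kill_set n B -> wtail n B 0 = mean_hit n B.
Proof.
  intros HB. apply avg_ext. intros x. rewrite (hit_mean_equation n B x HB).
  simpl. destruct (B x); ring.
Qed.

(** One step is moved onto [hit_mean], where it subtracts 1 off [B]; on [B] the survival function
    vanishes. *)
Lemma wtail_S n B j : kill_set n B -> wtail n B (S j) = wtail n B j - usurv n B j.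
Proof.
  intros HB. pose proof HB as (Hn & HP & _).
  assert (E : wtail n B (S j) = avg n (fun x => kwalk B j x * Pop (hit_mean B) x)).
  { rewrite <- avg_Pop_sym by (first [now apply periodic_kwalk | now apply periodic_hit_mean]).
    apply avg_ext. intros x. rewrite kwalk_S. destruct (B x) eqn:Ex; auto.
    rewrite (hit_mean_equation n B x HB), Ex. ring. }
  rewrite E. unfold wtail, usurv. rewrite <- avg_minus. apply avg_ext. intros x.
  rewrite (hit_mean_equation n B x HB). destruct (B x) eqn:Ex; [|ring].
  rewrite (kwalk_on B j x Ex). ring.
Qed.

Lemma wtail_sum n B j : kill_set n B -> mean_hit n B = bsum j (usurv n B) + wtail n B j.
Proof.
  intros HB. induction j as [|j IH]; [simpl; rewrite wtail_0 by auto; ring|].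
  cbn [bsum]. rewrite wtail_S by auto. lra.
Qed.

Lemma wtail_le n B j : kill_set n B -> wtail n B j <= 2 * gsum n * usurv n B j.
Proof.
  intros HB. unfold wtail, usurv. rewrite <- avg_scal. apply avg_le; [apply HB|].
  intros x. pose proof (kwalk_bounds B j x). pose proof (hit_mean_bounds n B x HB). nra.
Qed.

Lemma avg_cauchy_schwarz n f g :
  (0 < n)%nat -> avg n (fun x => f x * g x) ^ 2 <= avg n (fun x => f x ^ 2) * avg n (fun x => g x ^ 2).
Proof.
  intros Hn. apply discriminant_le.
  - apply avg_nonneg; auto. intros; apply pow2_ge_0.
  - intros t. replace (_ + _ + _) with (avg n (fun x => (f x + t * g x) ^ 2)).
    + apply avg_nonneg; auto. intros; apply pow2_ge_0.
    + rewrite (avg_ext n _ (fun x => f x ^ 2 + (2 * t * (f x * g x) + t ^ 2 * g x ^ 2)))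
        by (intros; ring).
      rewrite !avg_plus, !avg_scal. ring.
Qed.

Lemma avg_variance n f :
  (0 < n)%nat ->
  avg n (fun x => (f x - avg n f) ^ 2) = avg n (fun x => f x ^ 2) - avg n f ^ 2.
Proof.
  intros Hn. set (m := avg n f).
  rewrite (avg_ext n _ (fun x => f x ^ 2 - (2 * m * f x - m ^ 2))) by (intros; ring).
  rewrite !avg_minus, avg_scal, avg_const by auto. fold m. ring.
Qed.

(** Variance of the survival function under the uniform measure: by [kwalk_inner] its second moment
    is [usurv n B (2 * j)]. *)
Definition kvar (n : nat) (B : pt -> bool) (j : nat) : R :=
  usurv n B (2 * j) - usurv n B j ^ 2.

Lemma kwalk_variance n B j :
  kill_set n B -> avg n (fun x => (kwalk B j x - usurv n B j) ^ 2) = kvar n B j.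
Proof.
  intros HB. unfold usurv. rewrite avg_variance by apply HB. unfold kvar. f_equal.
  replace (2 * j)%nat with (j + j)%nat by lia. rewrite <- kwalk_inner by auto.
  apply avg_ext. intros; ring.
Qed.

Lemma wtail_covariance n B j :
  kill_set n B ->
  (wtail n B j - mean_hit n B * usurv n B j) ^ 2 <= kvar n B j * (64 * INR n ^ 4).
Proof.
  intros HB. pose proof HB as (Hn & _ & _).
  replace (wtail n B j - mean_hit n B * usurv n B j)
    with (avg n (fun x => (kwalk B j x - usurv n B j) * (hit_mean B x - mean_hit n B))).
  - eapply Rle_trans; [now apply avg_cauchy_schwarz|].
    cbv beta. rewrite kwalk_variance by auto. apply Rmult_le_compat_l.
    + rewrite <- kwalk_variance by auto. apply avg_nonneg; auto. intros; apply pow2_ge_0.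
    + now apply hit_mean_variance.
  - rewrite (avg_ext n _ (fun x => kwalk B j x * hit_mean B x
       - (mean_hit n B * kwalk B j x + (usurv n B j * hit_mean B x - usurv n B j * mean_hit n B))))
      by (intros; ring).
    rewrite avg_minus, avg_plus, avg_minus, !avg_scal, avg_const by auto.
    unfold wtail, usurv, mean_hit. ring.
Qed.

(** The Dirichlet form of the survival function is exactly one decrement of [usurv]: killing does
    not matter there, because the other factor already vanishes on [B]. *)
Lemma kvar_poincare n B j :
  kill_set n B ->
  kvar n B j <= 8 * INR n ^ 2 * (usurv n B (2 * j) - usurv n B (2 * j + 1)).
Proof.
  intros HB. pose proof HB as (Hn & HP & _).
  rewrite <- kwalk_variance by auto. unfold usurv at 1.
  eapply Rle_trans; [apply poincare; auto; now apply periodic_kwalk|].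
  right. f_equal. f_equal.
  - replace (2 * j)%nat with (j + j)%nat by lia. rewrite <- kwalk_inner by auto.
    apply avg_ext. intros; ring.
  - replace (2 * j + 1)%nat with (j + S j)%nat by lia. rewrite <- kwalk_inner by auto.
    apply avg_ext. intros x. rewrite kwalk_S. destruct (B x) eqn:E; auto.
    rewrite (kwalk_on B j x E). ring.
Qed.

(** Cauchy-Schwarz, with the middle term read as the scalar product of the survival functions at
    times [j] and [j + 2]. *)
Lemma usurv_log_convex n B j :
  kill_set n B -> usurv n B (2 * S j) ^ 2 <= usurv n B (2 * j) * usurv n B (2 * S (S j)).
Proof.
  intros HB.
  replace (2 * S j)%nat with (j + S (S j))%nat by lia.
  replace (2 * j)%nat with (j + j)%nat by lia.
  replace (2 * S (S j))%nat with (S (S j) + S (S j))%nat by lia.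
  rewrite <- !kwalk_inner by auto. eapply Rle_trans; [apply avg_cauchy_schwarz, HB|].
  right. f_equal; apply avg_ext; intros; ring.
Qed.

(** * Exponential law of the survival probability *)

Lemma ln_one_minus x : 0 <= x <= 1 / 2 -> Rabs (ln (1 - x) + x) <= 2 * x ^ 2.
Proof.
  intros Hx. pose proof (ln_le_sub_1 (1 - x) ltac:(lra)) as H1.
  pose proof (ln_sub_le 1 (1 - x) ltac:(lra) ltac:(lra)) as H2. rewrite ln_1 in H2.
  assert (H3 : 1 / (1 - x) - 1 <= x + 2 * x ^ 2).
  { apply Rmult_le_reg_r with (1 - x); [lra|].
    replace ((1 / (1 - x) - 1) * (1 - x)) with x by (field; lra). nra. }
  apply Rabs_le. nra.
Qed.

Lemma ln_near_1 y e : Rabs (y - 1) <= e -> e <= 1 / 2 -> Rabs (ln y) <= 2 * e.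
Proof.
  intros Hy He. apply Rabs_le_inv in Hy.
  pose proof (ln_le_sub_1 y ltac:(lra)) as H1.
  pose proof (ln_sub_le 1 y ltac:(lra) ltac:(lra)) as H2. rewrite ln_1 in H2.
  assert (H3 : 1 / y - 1 <= 2 * e).
  { apply Rmult_le_reg_r with y; [lra|].
    replace ((1 / y - 1) * y) with (1 - y) by (field; lra). nra. }
  apply Rabs_le. lra.
Qed.

(** The ratio [w (S j) / w j] is [1 - x] with [x = u j / w j] close to [1 / M], so the logarithms
    telescope. Each step costs [2 e j / M] for replacing [x] by [1 / M] and [8 / M^2] for the second
    order of the logarithm; the last [2 e m] passes from [w m / M] to [u m]. As [4 <= M], always
    [x <= 2 / M <= 1 / 2]. *)
Lemma log_of_tail_recursion (u w e : nat -> R) (M : R) :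
  4 <= M -> w 0%nat = M -> (forall j, w (S j) = w j - u j) -> (forall j, 0 < u j) ->
  (forall j, 0 <= e j <= 1 / 2) ->
  (forall j, Rabs (w j - M * u j) <= e j * (M * u j)) ->
  forall m, Rabs (ln (u m) + INR m / M) <= bsum m (fun j => 2 * e j / M + 8 / M ^ 2) + 2 * e m.
Proof.
  intros HM H0 HS Hu He Hw m.
  assert (Hpos : forall j, M * u j / 2 <= w j /\ Rabs (w j / (M * u j) - 1) <= e j).
  { intros j. specialize (Hu j). specialize (He j). specialize (Hw j).
    assert (HMu : 0 < M * u j) by nra. split.
    - apply Rabs_le_inv in Hw. nra.
    - replace (w j / (M * u j) - 1) with ((w j - M * u j) / (M * u j)) by (field; lra).
      unfold Rdiv. rewrite Rabs_mult, Rabs_inv, (Rabs_pos_eq (M * u j)) by lra.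
      apply Rmult_le_reg_r with (M * u j); auto. rewrite Rmult_assoc, Rinv_l; lra. }
  assert (Hlog : Rabs (ln (w m / M) + INR m / M) <= bsum m (fun j => 2 * e j / M + 8 / M ^ 2)).
  { induction m as [|m IH].
    - simpl. rewrite H0. replace (M / M) with 1 by (field; lra). rewrite ln_1.
      replace (0 + 0 / M) with 0 by (field; lra). rewrite Rabs_R0. lra.
    - cbn [bsum]. destruct (Hpos m) as [Hw1 Hw2]. specialize (Hu m). specialize (He m).
      assert (HMu : 0 < M * u m) by nra. assert (Hwm : 0 < w m) by lra.
      set (x := u m / w m).
      assert (Hx0 : 0 < x) by (unfold x; apply Rdiv_lt_0_compat; lra).
      assert (Hxw : x * w m = u m) by (unfold x; field; lra).
      assert (Hx1 : x <= 2 / M).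
      { apply Rmult_le_reg_r with (w m); auto. rewrite Hxw.
        apply Rle_trans with (2 / M * (M * u m / 2)); [right; field; lra|].
        apply Rmult_le_compat_l; auto. left. apply Rdiv_lt_0_compat; lra. }
      assert (H2M : 2 / M <= 1 / 2).
      { apply Rmult_le_reg_r with M; [lra|]. unfold Rdiv at 1. rewrite Rmult_assoc, Rinv_l; lra. }
      assert (HxM : Rabs (x - / M) <= 2 * e m / M).
      { assert (E : x - / M = (M * u m - w m) * / (M * w m)) by (unfold x; field; lra).
        rewrite E, Rabs_mult, Rabs_inv, (Rabs_pos_eq (M * w m)) by nra.
        rewrite Rabs_minus_sym.
        apply Rle_trans with (e m * (M * u m) * / (M * w m)).
        - apply Rmult_le_compat_r; [left; apply Rinv_0_lt_compat; nra|apply Hw].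
        - replace (e m * (M * u m) * / (M * w m)) with (e m * x) by (unfold x; field; lra).
          replace (2 * e m / M) with (e m * (2 / M)) by (field; lra).
          apply Rmult_le_compat_l; lra. }
      assert (Hstep : ln (w (S m) / M) = ln (w m / M) + ln (1 - x)).
      { rewrite <- ln_mult.
        - f_equal. rewrite HS. unfold x. field. lra.
        - apply Rdiv_lt_0_compat; lra.
        - lra. }
      rewrite Hstep, S_INR.
      pose proof (ln_one_minus x ltac:(lra)) as Hl.
      assert (Hx2 : 2 * x ^ 2 <= 8 / M ^ 2).
      { replace (8 / M ^ 2) with (2 * (2 / M) ^ 2) by (field; lra).
        apply Rmult_le_compat_l; [lra|]. apply pow_incr. lra. }
      replace ((INR m + 1) / M) with (INR m / M + / M) by (field; lra).
      apply Rabs_le_inv in IH, Hl, HxM. apply Rabs_le. lra. }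
  destruct (Hpos m) as [Hw1 Hw2]. specialize (Hu m).
  assert (HMu : 0 < M * u m) by nra.
  pose proof (ln_near_1 _ _ Hw2 (proj2 (He m))) as H3.
  assert (E : ln (w m / M) = ln (u m) + ln (w m / (M * u m))).
  { rewrite <- ln_mult; [f_equal; field; lra|lra|apply Rdiv_lt_0_compat; lra]. }
  apply Rabs_le_inv in Hlog, H3. apply Rabs_le. lra.
Qed.

(** From [1 - t <= exp(-t)] the power is at most [exp(-2)], and [exp 1 > 2]. *)
Lemma one_minus_2_div_pow (J : nat) : (2 < J)%nat -> (1 - 2 / INR J) ^ J < 1 / 4.
Proof.
  intros HJ. assert (HJ' : 2 < INR J) by (apply (lt_INR 2); auto).
  assert (H2 : 2 / INR J < 1).
  { apply Rmult_lt_reg_r with (INR J); [lra|]. unfold Rdiv. rewrite Rmult_assoc, Rinv_l; lra. }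
  apply Rle_lt_trans with (exp (- (2 / INR J)) ^ J).
  - apply pow_incr. pose proof (exp_ineq1_le (- (2 / INR J))). lra.
  - assert (E : exp (- (2 / INR J)) ^ J = exp (- 2)).
    { assert (HE : forall k, exp (- (2 / INR J)) ^ k = exp (INR k * - (2 / INR J))).
      { induction k as [|k IH]; [simpl; now rewrite Rmult_0_l, exp_0|].
        rewrite S_INR. simpl pow. rewrite IH, <- exp_plus. f_equal. ring. }
      rewrite HE. f_equal. field. lra. }
    rewrite E. replace (- 2) with (- (1 + 1)) by ring. rewrite exp_Ropp, exp_plus.
    pose proof (exp_ineq1 1 ltac:(lra)).
    replace (1 / 4) with (/ (2 * 2)) by field. apply Rinv_lt_contravar; nra.
Qed.

(* A log-convex sequence has nondecreasing ratios; a ratio below [1 - 2/J] at [J]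
   would force [U J <= (1 - 2/J)^J < 1/4]. *)
Lemma log_convex_decay (U : nat -> R) (J : nat) :
  (2 < J)%nat -> (forall i, 0 <= U i <= 1) -> (forall i, U (S i) ^ 2 <= U i * U (S (S i))) ->
  (forall i, (i <= J)%nat -> 1 / 4 <= U i) ->
  forall j, (J <= j)%nat -> 0 < U j /\ (1 - 2 / INR J) * U j <= U (S j).
Proof.
  intros HJ Hb Hc HU. pose proof (one_minus_2_div_pow J HJ) as HqJ.
  set (q := 1 - 2 / INR J) in *.
  assert (Hq : 0 < q).
  { assert (HJ' : 2 < INR J) by (apply (lt_INR 2); auto). unfold q.
    assert (2 / INR J < 1).
    { apply Rmult_lt_reg_r with (INR J); [lra|]. unfold Rdiv. rewrite Rmult_assoc, Rinv_l; lra. }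
    lra. }
  assert (HatJ : q * U J <= U (S J)).
  { destruct (Rle_lt_dec (q * U J) (U (S J))) as [|Hlt]; auto. exfalso.
    assert (HD : forall k, (k <= J)%nat -> U (S (J - k)) <= q * U (J - k)%nat).
    { induction k as [|k IH]; intros Hk; [rewrite Nat.sub_0_r; lra|].
      specialize (IH ltac:(lia)). replace (J - k)%nat with (S (J - S k)) in IH by lia.
      set (i := (J - S k)%nat) in *. specialize (Hc i).
      pose proof (HU i ltac:(unfold i; lia)). pose proof (HU (S i) ltac:(unfold i; lia)).
      apply Rmult_le_reg_r with (U (S i)); nra. }
    assert (HP : forall i, (i <= J)%nat -> U i <= q ^ i).
    { induction i as [|i IH]; intros Hi; [simpl; apply Hb|].
      specialize (IH ltac:(lia)). specialize (HD (J - i)%nat ltac:(lia)).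
      replace (J - (J - i))%nat with i in HD by lia. simpl. nra. }
    specialize (HP J (le_n J)). specialize (HU J (le_n J)). lra. }
  intros j Hj. induction Hj as [|j Hj IH].
  - split; auto. specialize (HU J (le_n J)). lra.
  - destruct IH as [H0 H1]. assert (H2 : 0 < U (S j)) by nra. split; auto.
    specialize (Hc j). apply Rmult_le_reg_l with (U j); auto. nra.
Qed.

(* Used with [k = n^2 / M], [r = m / M] and [v = 1 / M], where [M] is the mean hitting time. *)
Definition surv_error (k r v : R) : R := 100 * k + 400 * (1 + r) * (k * sqrt k) + 8 * r * v.

(** The first hypothesis on the mean keeps [u] above [1/4] up to a time of order [M]. The second
    gives [k <= 1/65536] and [sqrt k <= 1/256], small enough for all numerical constants in the
    argument. *)
Lemma survival_log n B :
  kill_set n B -> 2 * gsum n <= 3 * mean_hit n B -> 65536 * INR n ^ 2 <= mean_hit n B ->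
  forall m, 0 < usurv n B m /\
    Rabs (ln (usurv n B m) + INR m / mean_hit n B)
    <= surv_error (INR n ^ 2 / mean_hit n B) (INR m / mean_hit n B) (/ mean_hit n B).
Proof.
  intros HB HG HM. pose proof HB as (Hn & _ & _).
  set (M := mean_hit n B) in *. set (u := usurv n B) in *. set (N := INR n) in *.
  assert (HN : 1 <= N) by (apply (le_INR 1); lia).
  assert (HN2 : 1 <= N ^ 2) by nra.
  assert (HM0 : 65536 <= M) by lra.
  assert (Hub : forall j, 0 <= u j <= 1) by (intros; now apply usurv_bounds).
  (* The integer part of [M / 8] from below, as [up] exceeds its argument by at most 1.
     Log-convexity is used along even times, so [J] stands for the time [2 J], at most [M / 4]. *)
  set (J := Z.to_nat (up (M / 8) - 1)).
  assert (HJ : M / 16 <= INR J <= M / 8).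
  { pose proof (archimed (M / 8)) as [Ha1 Ha2].
    assert (HZ : (0 <= up (M / 8) - 1)%Z).
    { apply le_IZR. rewrite minus_IZR. lra. }
    unfold J. rewrite INR_IZR_INZ, Z2Nat.id, minus_IZR by auto. lra. }
  assert (HJ2 : (2 < J)%nat) by (apply INR_lt; simpl; lra).
  (* The first [2 J] terms of the sum [M] of all [u_j] use at most [M / 4]. The remaining [3 M / 4]
     is at most [2 gsum u <= 3 M u] at time [2 J]. *)
  assert (Hearly : forall j, (j <= 2 * J)%nat -> 1 / 4 <= u j).
  { intros j Hj. apply Rle_trans with (u (2 * J)%nat); [|now apply usurv_decreasing].
    pose proof (wtail_sum n B (2 * J) HB) as H1. fold M u in H1.
    pose proof (wtail_le n B (2 * J) HB) as H2. fold u in H2.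
    assert (H3 : bsum (2 * J) u <= M / 4).
    { apply Rle_trans with (bsum (2 * J) (fun _ => 1)); [apply bsum_le; intros; apply Hub|].
      rewrite bsum_const, mult_INR. simpl (INR 2). lra. }
    specialize (Hub (2 * J)%nat). nra. }
  pose proof (log_convex_decay (fun i => u (2 * i)%nat) J HJ2 (fun i => Hub _)
    (fun i => usurv_log_convex n B i HB) (fun i Hi => Hearly (2 * i)%nat ltac:(lia))) as Hlate.
  cbv beta in Hlate.
  assert (Hpos : forall j, 0 < u j).
  { intros j. destruct (le_lt_dec J j) as [Hj|Hj].
    - destruct (Hlate j Hj) as [H _].
      apply Rlt_le_trans with (u (2 * j)%nat); auto. apply usurv_decreasing; auto; lia.
    - specialize (Hearly j ltac:(lia)). lra. }
  set (k := N ^ 2 / M).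
  assert (Hk : 0 < k <= / 65536).
  { split; [apply Rdiv_lt_0_compat; lra|]. unfold k.
    apply Rmult_le_reg_r with M; [lra|]. unfold Rdiv. rewrite Rmult_assoc, Rinv_l; lra. }
  assert (HkM : k * M = N ^ 2) by (unfold k; field; lra).
  (* By covariance the relative error is at most [8 k sqrt(V) / u] with [V = kvar]. Before [J],
     [V <= 1] and [u >= 1/4] give 32 [k]; from [J] on, [V <= 512 k u^2], and [8 sqrt 512 < 182]. *)
  set (e1 := 32 * k). set (e2 := 182 * (k * sqrt k)).
  assert (Hsk : 0 < sqrt k <= / 256).
  { split; [apply sqrt_lt_R0; lra|]. replace (/ 256) with (sqrt (/ 256 * / 256)).
    - apply sqrt_le_1; lra.
    - apply sqrt_square; lra. }
  assert (Hsk2 : sqrt k ^ 2 = k) by (apply pow2_sqrt; lra).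
  assert (He1 : 0 < e1 <= / 4) by (unfold e1; lra).
  assert (He2 : 0 < e2 <= / 4) by (unfold e2; nra).
  assert (Hcov : forall j e, 0 <= e -> kvar n B j * (64 * N ^ 4) <= (e * (M * u j)) ^ 2 ->
     Rabs (wtail n B j - M * u j) <= e * (M * u j)).
  { intros j e He H. pose proof (wtail_covariance n B j HB) as Hc. fold M u N in Hc.
    assert (0 <= e * (M * u j)).
    { apply Rmult_le_pos; auto. specialize (Hpos j). nra. }
    rewrite <- (Rabs_pos_eq (e * (M * u j))) by auto.
    apply Rsqr_le_abs_0. unfold Rsqr. lra. }
  set (e := fun j => if le_lt_dec J j then e2 else e1).
  assert (Hw : forall j, Rabs (wtail n B j - M * u j) <= e j * (M * u j)).
  { intros j. unfold e. destruct (le_lt_dec J j) as [Hj|Hj]; apply Hcov; try lra.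
    - destruct (Hlate j Hj) as [HU0 HU1].
      pose proof (kvar_poincare n B j HB) as HP. fold u N in HP.
      pose proof (usurv_decreasing n B (2 * j + 1) (2 * S j) Hn ltac:(lia)) as HD. fold u in HD.
      set (U := u (2 * j)%nat) in *.
      assert (HJM : 2 / INR J <= 32 / M).
      { replace (32 / M) with (2 / (M / 16)) by (field; lra).
        apply Rmult_le_compat_l; [lra|]. apply Rinv_le_contravar; lra. }
      assert (Hd : U - u (2 * j + 1)%nat <= 32 / M * U) by nra.
      assert (HV : kvar n B j <= 256 * k * U).
      { eapply Rle_trans; [exact HP|].
        apply Rle_trans with (8 * N ^ 2 * (32 / M * U)); [apply Rmult_le_compat_l; lra|].
        right. unfold k. field. lra. }
      (* Here [U - u_j^2] is the variance itself, hence at most [256 k U <= U / 256]. *)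
      assert (HU2 : U <= 2 * u j ^ 2).
      { unfold kvar in HV. fold u U in HV. nra. }
      assert (HV2 : kvar n B j <= 512 * k * u j ^ 2) by nra.
      apply Rle_trans with (512 * k * u j ^ 2 * (64 * N ^ 4)).
      { apply Rmult_le_compat_r; auto. assert (0 <= N ^ 4) by (apply pow_le; lra). lra. }
      replace ((e2 * (M * u j)) ^ 2) with (33124 * (k * M) ^ 2 * sqrt k ^ 2 * u j ^ 2)
        by (unfold e2; ring).
      rewrite Hsk2, HkM.
      replace (512 * k * u j ^ 2 * (64 * N ^ 4)) with (32768 * (N ^ 4 * k * u j ^ 2)) by ring.
      replace (33124 * (N ^ 2) ^ 2 * k * u j ^ 2) with (33124 * (N ^ 4 * k * u j ^ 2)) by ring.
      assert (HN4 : 0 <= N ^ 4) by (apply pow_le; lra).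
      assert (HNk : 0 <= N ^ 4 * k) by (apply Rmult_le_pos; lra).
      assert (Hj2 : 0 <= N ^ 4 * k * u j ^ 2) by (apply Rmult_le_pos; [lra|apply pow2_ge_0]).
      lra.
    - assert (H4 : 1 / 4 <= u j) by (apply Hearly; lia).
      assert (HV : kvar n B j <= 1).
      { unfold kvar. fold u. pose proof (Hub (2 * j)%nat). pose proof (pow2_ge_0 (u j)). lra. }
      replace ((e1 * (M * u j)) ^ 2) with (1024 * (k * M) ^ 2 * u j ^ 2) by (unfold e1; ring).
      rewrite HkM. replace ((N ^ 2) ^ 2) with (N ^ 4) by ring.
      assert (HN4 : 0 < N ^ 4) by (apply pow_lt; lra).
      assert (Hu2 : 1 / 16 <= u j ^ 2) by nra. nra. }
  assert (He : forall j, 0 <= e j <= 1 / 2).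
  { intros j. unfold e. destruct (le_lt_dec J j); lra. }
  intros m. split; auto.
  pose proof (log_of_tail_recursion u (wtail n B) e M ltac:(lra) (wtail_0 n B HB)
    (fun j => wtail_S n B j HB) Hpos He Hw m) as HL.
  eapply Rle_trans; [exact HL|].
  assert (HS : bsum m (fun j => 2 * e j / M + 8 / M ^ 2)
     <= 2 / M * (INR J * e1 + INR m * e2) + INR m * (8 / M ^ 2)).
  { rewrite bsum_plus, bsum_const. apply Rplus_le_compat_r.
    rewrite (bsum_ext m _ (fun j => 2 / M * e j)) by (intros; field; lra).
    rewrite bsum_scal. apply Rmult_le_compat_l; [left; apply Rdiv_lt_0_compat; lra|].
    (* The larger error [e1] is charged to at most [J <= M / 8] steps, so its total weight after
       division by [M] stays bounded. *)
    assert (H1 : bsum m e <= INR (min m J) * e1 + INR m * e2).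
    { clear - He1 He2. induction m as [|m IH]; [simpl; lra|].
      cbn [bsum]. rewrite S_INR. unfold e at 2. destruct (le_lt_dec J m) as [Hj|Hj].
      - replace (min (S m) J) with (min m J) by lia. lra.
      - replace (min (S m) J) with (S (min m J)) by lia. rewrite S_INR. lra. }
    assert (H2 : INR (min m J) <= INR J) by (apply le_INR; lia). nra. }
  set (r := INR m / M) in *. unfold surv_error. fold k.
  assert (Hr : 0 <= r).
  { unfold r, Rdiv. apply Rmult_le_pos; [apply pos_INR|left; apply Rinv_0_lt_compat; lra]. }
  assert (Hem : e m <= e1 + e2) by (unfold e; destruct (le_lt_dec J m); lra).
  assert (HJM : INR J / M <= 1 / 8).
  { apply Rmult_le_reg_r with M; [lra|]. unfold Rdiv at 1. rewrite Rmult_assoc, Rinv_l; lra. }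
  replace (2 / M * (INR J * e1 + INR m * e2) + INR m * (8 / M ^ 2))
    with (2 * (INR J / M) * e1 + 2 * r * e2 + 8 * r * / M) in HS by (unfold r; field; lra).
  assert (H1 : 2 * (INR J / M) * e1 <= e1 / 4) by nra.
  assert (H3 : 0 <= k * sqrt k) by nra.
  assert (H4 : 0 <= r * (k * sqrt k)) by (apply Rmult_le_pos; lra).
  unfold e1, e2 in *. nra.
Qed.

(** * From the torus to the plane *)

Lemma periodic_of_proj {T} n (f : pt -> T) : periodic n (fun x => f (proj (Z.of_nat n) x)).
Proof.
  intros x. unfold proj. cbn [fst snd].
  replace (fst x + Z.of_nat n)%Z with (fst x + 1 * Z.of_nat n)%Z by ring.
  replace (snd x + Z.of_nat n)%Z with (snd x + 1 * Z.of_nat n)%Z by ring.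
  now rewrite !Z_mod_plus_full.
Qed.

(** The torus walk lifts to the plane: the killed recursion commutes with projection, since the
    lifted functions are periodic. *)
Lemma avoid_kwalk n B m x :
  (0 < n)%nat ->
  avoid (Z.of_nat n) B m (proj (Z.of_nat n) x) = kwalk (fun y => B (proj (Z.of_nat n) y)) m x.
Proof.
  intros Hn. revert x. induction m as [|m IH]; intros x; [reflexivity|].
  rewrite kwalk_S. cbn [avoid]. destruct (B _); auto.
  unfold tnbrs. rewrite map_map.
  change (Pop (fun y => avoid (Z.of_nat n) B m (proj (Z.of_nat n) y)) (proj (Z.of_nat n) x)
    = Pop (kwalk (fun y => B (proj (Z.of_nat n) y)) m) x).
  rewrite (periodic_proj n (Pop _)) by (auto; apply periodic_Pop, (periodic_of_proj n)).
  now apply Pop_ext.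
Qed.

Lemma kwalk_ext B B' m x : (forall y, B y = B' y) -> kwalk B m x = kwalk B' m x.
Proof.
  intros H. revert x. induction m as [|m IH]; intros x; simpl; rewrite H; auto.
  destruct (B' x); auto. now apply Pop_ext.
Qed.

Lemma sumR_app l1 l2 : sumR (l1 ++ l2) = sumR l1 + sumR l2.
Proof. unfold sumR. induction l1 as [|x l IH]; simpl; lra. Qed.

Lemma sumR_seq n f : sumR (map f (seq 0 n)) = bsum n f.
Proof.
  induction n as [|n IH]; [reflexivity|].
  rewrite seq_S, map_app, sumR_app, IH. unfold sumR. simpl. ring.
Qed.

Lemma sumR_flat_map {S T} (f : T -> R) (g : S -> list T) l :
  sumR (map f (flat_map g l)) = sumR (map (fun i => sumR (map f (g i))) l).
Proof.
  induction l as [|i l IH]; [reflexivity|]. simpl. rewrite map_app, sumR_app, IH. reflexivity.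
Qed.

Lemma avoid_unif_usurv n B m :
  (0 < n)%nat -> avoid_unif n B m = usurv n (fun x => B (proj (Z.of_nat n) x)) m.
Proof.
  intros Hn. unfold avoid_unif, usurv, avg. f_equal; [f_equal; ring|].
  unfold torus_points. rewrite sumR_flat_map, sumR_seq. apply bsum_ext. intros i Hi.
  rewrite map_map, sumR_seq. apply bsum_ext. intros j Hj.
  rewrite <- avoid_kwalk by auto. f_equal. unfold proj, gpt. cbn [fst snd].
  now rewrite !Z.mod_small by lia.
Qed.

(** Matches the event in the numerator of [cond_prob] up to conversion; adjoining the origin makes
    it a kill set for every list. *)
Definition target (n : nat) (A : list pt) (x : pt) : bool :=
  let y := proj (Z.of_nat n) x in orb (proj_set n A y) (pt_eqb y orig).

Lemma proj_orig n : (0 < n)%nat -> proj (Z.of_nat n) orig = orig.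
Proof. intros Hn. unfold proj. cbn [fst snd]. now rewrite Z.mod_0_l by lia. Qed.

Lemma target_kill_set n A : (0 < n)%nat -> kill_set n (target n A).
Proof.
  intros Hn. split; auto. split.
  - apply (periodic_of_proj n (fun y => orb (proj_set n A y) (pt_eqb y orig))).
  - unfold target. rewrite proj_orig by auto. apply Bool.orb_true_r.
Qed.

Lemma target_spec n A x :
  (0 < n)%nat -> In orig A ->
  target n A x = true <-> exists a, In a A /\ proj (Z.of_nat n) a = proj (Z.of_nat n) x.
Proof.
  intros Hn HA. unfold target, proj_set. rewrite Bool.orb_true_iff, existsb_exists, pt_eqb_spec. split.
  - intros [[a [Ha E]]|E].
    + apply pt_eqb_spec in E. now exists a.
    + exists orig. now rewrite proj_orig.
  - intros [a [Ha E]]. left. exists a. split; auto. now apply pt_eqb_spec.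
Qed.

Definition torus_cap (n : nat) (A : list pt) : R :=
  box n (fun x => equil n (target n A) x * apot n x).

(** The torus potential of [equil] is constant on [A], because [mean_hit_deficit] expresses the same
    mean hitting time from any point of the target. *)
Lemma torus_cap_at n A z :
  (0 < n)%nat -> In orig A -> In z A ->
  box n (fun x => equil n (target n A) x * apot n (psub x z)) = torus_cap n A.
Proof.
  intros Hn HA Hz. pose proof (target_kill_set n A Hn) as HK.
  assert (HT : forall a, In a A -> target n A a = true)
    by (intros a Ha; apply target_spec; auto; now exists a).
  pose proof (mean_hit_deficit n _ z HK (HT z Hz)) as H1.
  pose proof (mean_hit_deficit n _ orig HK (HT orig HA)) as H2.
  unfold torus_cap.
  rewrite (box_ext n (fun x => equil n (target n A) x * apot n x)
     (fun x => equil n (target n A) x * apot n (psub x orig))).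
  - pose proof (INR_sq_neq_0 n Hn). apply (Rmult_eq_reg_l (INR n ^ 2)); auto. lra.
  - intros [a b]. unfold psub. cbn [fst snd]. now rewrite !Z.sub_0_r.
Qed.

Lemma mean_hit_torus_cap n A :
  (0 < n)%nat -> In orig A ->
  mean_hit n (target n A) = gsum n - INR n ^ 2 * torus_cap n A.
Proof.
  intros Hn HA. rewrite <- (torus_cap_at n A orig) by auto.
  apply mean_hit_deficit; [now apply target_kill_set|].
  apply target_spec; auto. now exists orig.
Qed.

Lemma box_sumR {T} n (F : T -> pt -> R) l :
  box n (fun x => sumR (map (fun t => F t x) l)) = sumR (map (fun t => box n (F t)) l).
Proof.
  induction l as [|t l IH].
  - unfold box, sumR. simpl. rewrite bsum2_const. ring.
  - cbn [map]. unfold sumR in *. cbn [fold_right]. now rewrite box_plus, IH.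
Qed.

Lemma CV_uniform_list {T} (F : nat -> T -> R) c l :
  (forall t, In t l -> Un_cv (fun n => F n t) c) ->
  forall eps, 0 < eps -> exists N, forall n t, (N <= n)%nat -> In t l -> Rabs (F n t - c) < eps.
Proof.
  intros H eps He. induction l as [|t l IH]; [exists 0%nat; intros ? ? ? []|].
  destruct (H t ltac:(simpl; auto) eps He) as [N1 H1].
  destruct IH as [N2 H2]; [intros; apply H; simpl; auto|].
  exists (max N1 N2). intros n s Hn [<-|Hs]; [apply H1; lia|apply H2; auto; lia].
Qed.

(* Integrate the torus equilibrium measure against the equilibrium potential of the plane. *)
Lemma torus_cap_cv A :
  In orig A -> NoDup A -> Un_cv (fun n => torus_cap n A) (cap A).
Proof.
  intros HA HN.
  (* Planar harmonic measure is paired with the torus kernel: the double sum then collapses exactly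
     to [torus_cap], and a limit is needed only at the finitely many points of [A]. *)
  set (F := fun n a => sumR (map (fun z => harm_meas A z * apot n (psub a z)) A)).
  assert (HF : forall a, In a A -> Un_cv (fun n => F n a) (cap A)).
  { intros a Ha. rewrite <- (equilibrium_potential A a HA HN Ha).
    rewrite (sumR_ext _ (fun z => harm_meas A z * pot_kernel (psub a z))).
    - apply (CV_sumR (fun n z => harm_meas A z * apot n (psub a z))).
      intros z _. apply CV_mult; [apply CV_const|apply apot_cv].
    - intros z _. rewrite <- (pot_kernel_neg (psub a z)), Rmult_comm. do 2 f_equal.
      unfold psub. cbn [fst snd]. f_equal; ring. }
  intros eps He. destruct (CV_uniform_list F (cap A) A HF (eps / 2) ltac:(lra)) as [N H].
  exists (S N). intros n Hn. assert (Hn0 : (0 < n)%nat) by lia.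
  pose proof (target_kill_set n A Hn0) as HK. set (e := equil n (target n A)).
  assert (E : torus_cap n A - cap A = box n (fun x => e x * (F n x - cap A))).
  { assert (E1 : torus_cap n A = box n (fun x => e x * F n x)).
    { rewrite (box_ext n _ (fun x => sumR (map (fun z => harm_meas A z * (e x * apot n (psub x z))) A))).
      - rewrite (box_sumR n (fun z x => harm_meas A z * (e x * apot n (psub x z)))).
        rewrite (sumR_ext _ (fun z => torus_cap n A * harm_meas A z)).
        + rewrite sumR_scal, harm_meas_total by auto. ring.
        + intros z Hz. rewrite box_scal. unfold e. rewrite torus_cap_at by auto. ring.
      - intros x. unfold F. rewrite <- sumR_scal. apply sumR_ext. intros; ring. }
    rewrite (box_ext n _ (fun x => e x * F n x - cap A * e x)) by (intros; ring).
    rewrite box_minus, box_scal, <- E1. unfold e. rewrite equil_total by auto. ring. }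
  unfold Rdist. rewrite E. apply Rle_lt_trans with (eps / 2); [|lra].
  unfold box. eapply Rle_trans; [apply bsum2_abs|].
  apply Rle_trans with (bsum2 n (fun i j => eps / 2 * e (gpt i j))).
  - apply bsum2_le. intros i j _ _. set (x := gpt i j).
    assert (He0 : 0 <= e x) by now apply equil_nonneg.
    rewrite Rabs_mult, (Rabs_pos_eq (e x)), Rmult_comm by auto.
    (* Off the target [equil] vanishes; on it, periodicity replaces [x] by a point of [A], where the
       convergence is uniform. *)
    destruct (target n A x) eqn:Ex.
    + apply Rmult_le_compat_r; auto. apply target_spec in Ex; auto.
      destruct Ex as [a [Ha Epr]]. left.
      replace (F n x) with (F n a); [apply H; auto; lia|].
      apply sumR_ext. intros z _. f_equal.
      pose proof (periodic_shift n _ z (periodic_apot n Hn0)) as HP.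
      rewrite <- (periodic_proj n _ a Hn0 HP), Epr. apply (periodic_proj n _ x Hn0 HP).
    + unfold e, equil. rewrite Ex. lra.
  - rewrite bsum2_scal. fold (box n e). unfold e. rewrite equil_total by auto. lra.
Qed.

(** * Asymptotics *)

Lemma CV_squeeze u v l N0 :
  (forall n, (N0 <= n)%nat -> Rabs (u n - l) <= v n) -> Un_cv v 0 -> Un_cv u l.
Proof.
  intros H Hv eps He. destruct (Hv eps He) as [N HN]. exists (max N0 N). intros n Hn.
  specialize (HN n ltac:(lia)). specialize (H n ltac:(lia)). unfold Rdist in *.
  rewrite Rminus_0_r in HN. pose proof (Rle_abs (v n)). lra.
Qed.

Lemma CV_eventually_ext u v l N0 :
  (forall n, (N0 <= n)%nat -> u n = v n) -> Un_cv u l -> Un_cv v l.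
Proof.
  intros H Hu eps He. destruct (Hu eps He) as [N HN]. exists (max N0 N). intros n Hn.
  rewrite <- H by lia. apply HN. lia.
Qed.

Lemma CV_eventually_gt u l c : Un_cv u l -> c < l -> exists N, forall n, (N <= n)%nat -> c < u n.
Proof.
  intros Hu Hc. destruct (Hu (l - c) ltac:(lra)) as [N HN]. exists N. intros n Hn.
  specialize (HN n Hn). unfold Rdist in HN. apply Rabs_def2 in HN. lra.
Qed.

Lemma CV_inv u l : l <> 0 -> Un_cv u l -> Un_cv (fun n => / u n) (/ l).
Proof.
  intros Hl Hu. apply (continuity_seq (fun x => / x) u l); auto.
  apply (continuity_pt_inv id); auto. apply derivable_continuous_pt, derivable_pt_id.
Qed.

Lemma CV_sqrt_0 u : Un_cv u 0 -> Un_cv (fun n => sqrt (u n)) 0.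
Proof.
  intros Hu. rewrite <- sqrt_0. apply (continuity_seq sqrt u 0); auto.
  apply continuity_pt_sqrt. lra.
Qed.

Lemma CV_exp u l : Un_cv u l -> Un_cv (fun n => exp (u n)) (exp l).
Proof.
  intros Hu. apply (continuity_seq exp u l); auto.
  apply derivable_continuous_pt, derivable_pt_exp.
Qed.

Lemma ln_INR_bounds n : (3 <= n)%nat -> 1 <= ln (INR n) <= INR n.
Proof.
  intros Hn. assert (H3 : 3 <= INR n) by (apply (le_INR 3) in Hn; simpl in Hn; lra). split.
  - rewrite <- (ln_exp 1). pose proof exp_le_3.
    destruct (Rle_lt_or_eq_dec (exp 1) (INR n)) as [Hlt|<-]; [lra| |lra].
    left. apply ln_increasing; auto. apply exp_pos.
  - pose proof (ln_le_sub_1 (INR n) ltac:(lra)). lra.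
Qed.

Lemma inv_ln_cv_0 : Un_cv (fun n => / ln (INR n)) 0.
Proof.
  intros eps He. destruct (INR_archimed 1 (exp (/ eps)) ltac:(lra)) as [N HN].
  exists (S N). intros n Hn. unfold Rdist. rewrite Rminus_0_r.
  assert (H1 : INR N <= INR n) by (apply le_INR; lia).
  assert (H0 : 0 < / eps) by now apply Rinv_0_lt_compat.
  assert (H2 : / eps < ln (INR n)).
  { rewrite <- (ln_exp (/ eps)). apply ln_increasing; [apply exp_pos|lra]. }
  rewrite Rabs_pos_eq by (left; apply Rinv_0_lt_compat; lra).
  rewrite <- (Rinv_inv eps). apply Rinv_lt_contravar; auto. nra.
Qed.

Definition scale (n : nat) : R := INR n ^ 2 * ln (INR n).

Lemma scale_pos n : (3 <= n)%nat -> 0 < scale n.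
Proof.
  intros Hn. pose proof (ln_INR_bounds n Hn). unfold scale.
  apply Rmult_lt_0_compat; [apply pow_lt, lt_0_INR; lia|lra].
Qed.

Lemma gsum_scale_cv : Un_cv (fun n => gsum n / scale n) (2 / PI).
Proof.
  apply (CV_squeeze _ (fun n => 20 * / ln (INR n)) _ 3).
  - intros n Hn. pose proof (scale_pos n Hn) as Hs.
    pose proof (gsum_asymptotics n ltac:(lia)) as H. pose proof (ln_INR_bounds n Hn) as HL.
    assert (HN : 0 < INR n) by (apply lt_0_INR; lia). pose proof PI_RGT_0.
    replace (gsum n / scale n - 2 / PI)
      with ((gsum n - 2 / PI * INR n ^ 2 * ln (INR n)) * / scale n)
      by (unfold scale; field; lra).
    rewrite Rabs_mult, (Rabs_pos_eq (/ _)) by (left; now apply Rinv_0_lt_compat).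
    apply Rle_trans with (20 * INR n ^ 2 * / scale n).
    + apply Rmult_le_compat_r; auto. left; now apply Rinv_0_lt_compat.
    + right. unfold scale. field. lra.
  - replace 0 with (20 * 0) by ring. apply CV_mult; [apply CV_const|apply inv_ln_cv_0].
Qed.

Lemma mean_hit_scale_cv A :
  In orig A -> NoDup A -> Un_cv (fun n => mean_hit n (target n A) / scale n) (2 / PI).
Proof.
  intros HA HN.
  apply (CV_eventually_ext (fun n => gsum n / scale n - torus_cap n A * / ln (INR n)) _ _ 3).
  - intros n Hn. rewrite mean_hit_torus_cap by (auto; lia).
    pose proof (ln_INR_bounds n Hn). assert (0 < INR n) by (apply lt_0_INR; lia).
    unfold scale. field. lra.
  - replace (2 / PI) with (2 / PI - cap A * 0) by ring.
    apply CV_minus; [apply gsum_scale_cv|].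
    apply CV_mult; [now apply torus_cap_cv|apply inv_ln_cv_0].
Qed.

Definition time (alpha : R) (n : nat) : nat := Z.to_nat (Int_part (t_alpha alpha n)).

(** Rounding down changes the time by less than 1, which is negligible against [n^2 (ln n)^2]. *)
Lemma time_scale_cv alpha :
  0 < alpha -> Un_cv (fun n => INR (time alpha n) / (INR n ^ 2 * ln (INR n) ^ 2)) (4 * alpha / PI).
Proof.
  intros Ha. apply (CV_squeeze _ (fun n => / ln (INR n)) _ 3); [|apply inv_ln_cv_0].
  intros n Hn. pose proof (ln_INR_bounds n Hn) as HL. pose proof PI_RGT_0.
  assert (HN : 1 <= INR n) by (apply (le_INR 1); lia).
  set (s := INR n ^ 2 * ln (INR n) ^ 2).
  assert (Hs : ln (INR n) <= s).
  { unfold s. rewrite <- (Rmult_1_l (ln (INR n))) at 1. apply Rmult_le_compat; nra. }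
  assert (Ht : t_alpha alpha n = 4 * alpha / PI * s) by (unfold t_alpha, s; ring).
  assert (Hc : 0 < 4 * alpha / PI) by (apply Rdiv_lt_0_compat; lra).
  set (t := t_alpha alpha n) in *.
  assert (Ht0 : 0 <= t) by (rewrite Ht; apply Rmult_le_pos; lra).
  assert (Hm : t - 1 < INR (time alpha n) <= t).
  { unfold time. fold t. destruct (base_Int_part t) as [Hi1 Hi2].
    assert (HZ : (0 <= Int_part t)%Z).
    { assert (-1 < Int_part t)%Z by (apply lt_IZR; lra). lia. }
    rewrite INR_IZR_INZ, Z2Nat.id by auto. lra. }
  replace (INR (time alpha n) / s - 4 * alpha / PI) with ((INR (time alpha n) - t) * / s)
    by (rewrite Ht; field; lra).
  rewrite Rabs_mult, (Rabs_pos_eq (/ s)) by (left; apply Rinv_0_lt_compat; lra).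
  apply Rle_trans with (1 * / s).
  - apply Rmult_le_compat_r; [left; apply Rinv_0_lt_compat; lra|]. apply Rabs_le. lra.
  - rewrite Rmult_1_l. apply Rinv_le_contravar; lra.
Qed.

(** Here [k] is of order [1 / ln n] and [r = m / M] of order [ln n], so [r k sqrt k] and [r / M] in
    [surv_error] both tend to 0. *)
Lemma survival_log_cv alpha A :
  0 < alpha -> In orig A -> NoDup A ->
  (exists N, forall n, (N <= n)%nat -> 0 < usurv n (target n A) (time alpha n)) /\
  Un_cv (fun n => ln (usurv n (target n A) (time alpha n))
                  + INR (time alpha n) / mean_hit n (target n A)) 0.
Proof.
  intros Ha HA HN. pose proof PI_RGT_0 as HPI.
  assert (H2P : 0 < 2 / PI) by (apply Rdiv_lt_0_compat; lra).
  set (M := fun n => mean_hit n (target n A)).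
  set (y := fun n => M n / scale n).
  set (x := fun n => INR (time alpha n) / (INR n ^ 2 * ln (INR n) ^ 2)).
  assert (Hy : Un_cv y (2 / PI)) by now apply mean_hit_scale_cv.
  assert (Hx : Un_cv x (4 * alpha / PI)) by now apply time_scale_cv.
  destruct (CV_eventually_gt y (2 / PI) 0 Hy H2P) as [N1 HN1].
  assert (HM : forall n, (max 3 N1 <= n)%nat -> 0 < M n /\ M n = y n * scale n).
  { intros n Hn. pose proof (scale_pos n ltac:(lia)) as Hs. specialize (HN1 n ltac:(lia)).
    assert (E : M n = y n * scale n) by (unfold y; field; lra). split; auto. rewrite E. nra. }
  set (k := fun n => INR n ^ 2 / M n).
  assert (Hk : Un_cv k 0).
  { apply (CV_eventually_ext (fun n => / ln (INR n) * / y n) _ _ (max 3 N1)).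
    - intros n Hn. destruct (HM n Hn) as [H1 H2]. pose proof (ln_INR_bounds n ltac:(lia)).
      assert (0 < INR n) by (apply lt_0_INR; lia). specialize (HN1 n ltac:(lia)).
      unfold k. rewrite H2. unfold scale. field. repeat split; lra.
    - replace 0 with (0 * / (2 / PI)) by ring. apply CV_mult; [apply inv_ln_cv_0|].
      apply CV_inv; auto. lra. }
  (* The ratio [m / M] diverges; only its product with [k] has a limit, and the error is rewritten
     in terms of it. *)
  set (rk := fun n => INR (time alpha n) / M n * k n).
  assert (Hrk : Un_cv rk (4 * alpha / PI * (/ (2 / PI) * / (2 / PI)))).
  { apply (CV_eventually_ext (fun n => x n * (/ y n * / y n)) _ _ (max 3 N1)).
    - intros n Hn. destruct (HM n Hn) as [H1 H2]. pose proof (ln_INR_bounds n ltac:(lia)).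
      assert (0 < INR n) by (apply lt_0_INR; lia). specialize (HN1 n ltac:(lia)).
      unfold rk, k, x. rewrite H2. unfold scale. field. repeat split; lra.
    - apply CV_mult; auto. apply CV_mult; apply CV_inv; auto; lra. }
  assert (Hn2 : Un_cv (fun n => / INR n ^ 2) 0).
  { apply (CV_squeeze _ (fun n => / ln (INR n)) _ 3); [|apply inv_ln_cv_0].
    intros n Hn. pose proof (ln_INR_bounds n Hn). assert (1 <= INR n) by (apply (le_INR 1); lia).
    rewrite Rminus_0_r, Rabs_pos_eq by (left; apply inv_INR_sq_pos; lia).
    apply Rinv_le_contravar; nra. }
  assert (Herr : Un_cv (fun n => surv_error (k n) (INR (time alpha n) / M n) (/ M n)) 0).
  { apply (CV_eventually_ext
      (fun n => 100 * k n + 400 * ((k n + rk n) * sqrt (k n)) + 8 * (rk n * / INR n ^ 2)) _ _ (max 3 N1)).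
    - intros n Hn. destruct (HM n Hn) as [H1 _]. assert (0 < INR n) by (apply lt_0_INR; lia).
      unfold surv_error, rk.
      replace (INR (time alpha n) / M n * k n * / INR n ^ 2)
        with (INR (time alpha n) / M n * / M n) by (unfold k; field; lra). ring.
    - set (l := 4 * alpha / PI * (/ (2 / PI) * / (2 / PI))) in *.
      replace 0 with (100 * 0 + 400 * ((0 + l) * 0) + 8 * (l * 0)) by ring.
      apply CV_plus; [apply CV_plus|]; apply CV_mult; try apply CV_const; auto.
      + apply CV_mult; [now apply CV_plus|now apply CV_sqrt_0].
      + now apply CV_mult. }
  assert (Hbig : exists N, forall n, (N <= n)%nat -> 65536 * INR n ^ 2 <= M n).
  { destruct (Hk (/ 65536) ltac:(lra)) as [N2 HN2]. exists (max (max 3 N1) N2). intros n Hn.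
    destruct (HM n ltac:(lia)) as [H1 _]. specialize (HN2 n ltac:(lia)).
    unfold Rdist in HN2. rewrite Rminus_0_r in HN2. apply Rabs_def2 in HN2.
    assert (E : k n * M n = INR n ^ 2) by (unfold k; field; lra). nra. }
  (* Both [gsum] and [M] are [2 / PI] times [scale] to leading order, so the difference of the two
     sides, divided by [scale], tends to [2 / PI > 0]. *)
  assert (Hratio : exists N, forall n, (N <= n)%nat -> 2 * gsum n <= 3 * M n).
  { assert (HC : Un_cv (fun n => 3 * y n - 2 * (gsum n / scale n)) (3 * (2 / PI) - 2 * (2 / PI))).
    { apply CV_minus; apply CV_mult; try apply CV_const; auto. apply gsum_scale_cv. }
    destruct (CV_eventually_gt _ _ 0 HC ltac:(lra)) as [N2 HN2]. exists (max (max 3 N1) N2).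
    intros n Hn. destruct (HM n ltac:(lia)) as [_ H2]. specialize (HN2 n ltac:(lia)).
    pose proof (scale_pos n ltac:(lia)) as Hs.
    assert (E : gsum n = gsum n / scale n * scale n) by (field; lra). nra. }
  destruct Hbig as [N2 HN2], Hratio as [N3 HN3].
  assert (HS : forall n, (max 3 (max N2 N3) <= n)%nat ->
    0 < usurv n (target n A) (time alpha n) /\
    Rabs (ln (usurv n (target n A) (time alpha n)) + INR (time alpha n) / M n)
      <= surv_error (k n) (INR (time alpha n) / M n) (/ M n)).
  { intros n Hn. apply survival_log.
    - apply target_kill_set. lia.
    - apply HN3. lia.
    - apply HN2. lia. }
  split.
  - exists (max 3 (max N2 N3)). intros n Hn. now apply HS.
  - apply (CV_squeeze _ (fun n => surv_error (k n) (INR (time alpha n) / M n) (/ M n)) _ (max 3 (max N2 N3))); auto.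
    intros n Hn. rewrite Rminus_0_r. now apply HS.
Qed.

Theorem theorem2p6 (alpha : R) (A : list pt) :
  alpha > 0 -> NoDup A -> In (0%Z, 0%Z) A ->
  Un_cv (fun n => cond_prob n A (t_alpha alpha n)) (exp (- (PI * alpha * cap A))).
Proof.
  intros Ha HN HA. pose proof PI_RGT_0 as HPI.
  assert (H2P : 0 < 2 / PI) by (apply Rdiv_lt_0_compat; lra).
  set (O := [orig]).
  assert (HO : In orig O) by (simpl; auto).
  assert (HNO : NoDup O) by (constructor; [simpl; tauto|constructor]).
  assert (HcapO : cap O = 0).
  { unfold cap, O, sumR. simpl. rewrite pot_kernel_orig. ring. }
  destruct (survival_log_cv alpha A Ha HA HN) as [[N1 HN1] HuA].
  destruct (survival_log_cv alpha O Ha HO HNO) as [[N2 HN2] HuO].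
  pose proof (mean_hit_scale_cv A HA HN) as HyA.
  pose proof (mean_hit_scale_cv O HO HNO) as HyO.
  destruct (CV_eventually_gt _ _ 0 HyA H2P) as [N3 HN3].
  destruct (CV_eventually_gt _ _ 0 HyO H2P) as [N4 HN4].
  set (x := fun n => INR (time alpha n) / (INR n ^ 2 * ln (INR n) ^ 2)).
  set (yA := fun n => mean_hit n (target n A) / scale n) in *.
  set (yO := fun n => mean_hit n (target n O) / scale n) in *.
  assert (HD : Un_cv (fun n => INR (time alpha n) / mean_hit n (target n A)
                 - INR (time alpha n) / mean_hit n (target n O)) (PI * alpha * cap A)).
  { apply (CV_eventually_ext
      (fun n => x n * (torus_cap n A - torus_cap n O) * (/ yA n * / yO n)) _ _ (max 3 (max N3 N4))).
    - intros n Hn. pose proof (ln_INR_bounds n ltac:(lia)). pose proof (scale_pos n ltac:(lia)) as Hs.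
      assert (0 < INR n) by (apply lt_0_INR; lia).
      specialize (HN3 n ltac:(lia)). specialize (HN4 n ltac:(lia)). cbv beta in HN3, HN4.
      assert (EA : mean_hit n (target n A) = yA n * scale n)
        by (unfold yA; field; now apply Rgt_not_eq).
      assert (EO : mean_hit n (target n O) = yO n * scale n)
        by (unfold yO; field; now apply Rgt_not_eq).
      (* In the difference of the two mean hitting times [gsum] drops out, leaving [n^2] times the
         difference of the torus capacities. *)
      assert (ED : torus_cap n A - torus_cap n O = (yO n - yA n) * scale n / INR n ^ 2).
      { pose proof (mean_hit_torus_cap n A ltac:(lia) HA).
        pose proof (mean_hit_torus_cap n O ltac:(lia) HO).
        rewrite Rmult_minus_distr_r, <- EA, <- EO, H1, H2. field. lra. }
      rewrite EA, EO, ED. unfold x, scale. clear EA EO ED Hs.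
      change (0 < yA n) in HN3. change (0 < yO n) in HN4.
      revert HN3 HN4. generalize (yA n) (yO n). intros a b Hpa Hpb.
      field. repeat split; lra.
    - replace (PI * alpha * cap A)
        with (4 * alpha / PI * (cap A - cap O) * (/ (2 / PI) * / (2 / PI)))
        by (rewrite HcapO; field; lra).
      apply CV_mult; [apply CV_mult|].
      + now apply time_scale_cv.
      + apply CV_minus; now apply torus_cap_cv.
      + apply CV_mult; apply CV_inv; auto; lra. }
  apply (CV_eventually_ext (fun n => exp (
     (ln (usurv n (target n A) (time alpha n)) + INR (time alpha n) / mean_hit n (target n A))
     - (ln (usurv n (target n O) (time alpha n)) + INR (time alpha n) / mean_hit n (target n O))
     - (INR (time alpha n) / mean_hit n (target n A)
        - INR (time alpha n) / mean_hit n (target n O)))) _ _ (max 3 (max N1 N2))).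
  - intros n Hn. specialize (HN1 n ltac:(lia)). specialize (HN2 n ltac:(lia)).
    unfold cond_prob. fold (time alpha n). rewrite !avoid_unif_usurv by lia.
    change (usurv n (fun x0 => orb (proj_set n A (proj (Z.of_nat n) x0))
      (pt_eqb (proj (Z.of_nat n) x0) orig)) (time alpha n)) with (usurv n (target n A) (time alpha n)).
    replace (usurv n (fun x0 => pt_eqb (proj (Z.of_nat n) x0) orig) (time alpha n))
      with (usurv n (target n O) (time alpha n)).
    + replace (_ - _ - _) with (ln (usurv n (target n A) (time alpha n))
         - ln (usurv n (target n O) (time alpha n))) by ring.
      unfold Rminus. rewrite exp_plus, exp_Ropp, !exp_ln by auto. reflexivity.
    (* For the list [O] the target names the origin twice, with the arguments of [pt_eqb] in either
       order; both tests are the event of the denominator. *)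
    + apply avg_ext. intros z. apply kwalk_ext. intros w. unfold target, proj_set, O.
      cbn [existsb]. rewrite proj_orig by lia. rewrite Bool.orb_false_r.
      replace (pt_eqb orig (proj (Z.of_nat n) w)) with (pt_eqb (proj (Z.of_nat n) w) orig).
      * apply Bool.orb_diag.
      * apply Bool.eq_true_iff_eq. rewrite !pt_eqb_spec. split; congruence.
  - apply CV_exp. replace (- (PI * alpha * cap A)) with (0 - 0 - PI * alpha * cap A) by ring.
    apply CV_minus; auto. apply CV_minus; auto.
Qed.
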